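(* Let $c_\Lambda\in(0,1)$ be the universal constant described in the context. For every large enough constant $\lambda$ there is a constant $c_s$ such that the following holds. Consider any instance of cluster aggregation on an edge-weighted graph $G=(V,E,w)$ of doubling dimension $d$, with portals $P$ and an input partition $\mathcal C$ of strong diameter $\Delta$, where: (1) $P$ is a $\Lambda$-net for $\Lambda=\lambda\cdot d^3\log d\cdot\Delta$; that is, $\max_{v\in V}d_G(v,P)\le\Lambda$ and the minimum pairwise distance between (distinct) portals satisfies $\min_{p,p'\in P}d_G(p,p')\ge c_\Lambda\cdot\Lambda$; (2) every cluster $C\in\mathcal C$ has a center $v_C\in C$ such that the minimum pairwise distance between centers (of distinct clusters) satisfies $\min_{C,C'\in\mathcal C}d_G(v_C,v_{C'})\ge\frac{c_\Lambda}{3}\cdot\Delta$. Then the instance has a $\beta$-distortion solution with $\beta=4c_s\cdot\ln\frac{4}{c_\Lambda}\cdot d^2\log d$, computable in polynomial time.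
   Context: An instance of cluster aggregation consists of an edge-weighted graph $G=(V,E,w)$, a partition $\mathcal C$ of $V$ into clusters of strong diameter $\Delta$ (each induced subgraph $G[C]$ has diameter at most $\Delta$ in its own shortest-path metric), and a set of portals $P\subseteq V$. A $\beta$-distortion solution is an assignment $f:\mathcal C\to P$ such that for every $v\in V$ $$d_{G[f^{-1}(f(v))]}(v,f(v))\le d_G(v,P)+\beta\cdot\Delta,$$ where $f(v):=f(C_v)$ with $C_v\in\mathcal C$ the cluster containing $v$, and $f^{-1}(p):=\{v\in V:f(v)=p\}$. Here $d_G$ is shortest-path distance and $d_G(v,P)=\min_{p\in P}d_G(v,p)$. A metric space has doubling constant $\mu$ if for every point $x$ and $r>0$ the ball $B(x,2r)$ can be covered by $\mu$ balls of radius $r$; its doubling dimension is $\log\mu$ (base 2). The doubling dimension of a weighted graph is that of its shortest-path metric. The constant $c_\Lambda$ is a fixed universal constant in $(0,1)$ coming from a known result on dangling nets: for every weighted graph $G$ of doubling dimension $d$ and every $\Lambda>0$ there is a set $N$ of new vertices, joined to $V$ by a weighted matching whose endpoint set in $V$ is $N_V$, such that in the resulting graph $G+N$ every $v\in V$ satisfies $d_{G+N}(v,N)\le\Lambda$ and $|\{t\in N:d_{G+N}(v,t)\le d_{G+N}(v,N)+\Lambda/\alpha\}|\le\tau$ with $\alpha=O(d)$, $\tau=\tilde O(d)$, and moreover distinct $u,v\in N_V$ satisfy $d_G(u,v)\ge c_\Lambda\cdot\Lambda$. Polynomial-time algorithms here may be randomized.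
   Formalization: The doubling dimension d is required to exceed 1, since for d = 1 we have log d = 0, so Λ = β = 0 and the claim fails (one edge, a single cluster, P = V); graphs of smaller dimension are covered by using doubling constant 3. *)

(* Defs.v *)
From HB Require Import structures.
From mathcomp Require Import all_boot all_order all_algebra.
From mathcomp Require Import all_classical all_reals all_analysis.

Set Implicit Arguments.
Unset Strict Implicit.
Unset Printing Implicit Defensive.

Import Order.TTheory GRing.Theory Num.Theory.

Local Open Scope ring_scope.

Definition log2 {R : realType} (x : R) : R := ln x / ln 2.

(** * Weighted graphs and shortest-path distances *)

Record wgraph (K : Type) (V : finType) := WGraph {
  adj : rel V;
  wt : V -> V -> K  (* only meaningful on adjacent pairs *)
}.

(* Nonempty finite simple undirected graph with positive weights.  Connectedness is not
   required: distances take values in the extended reals. *)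
Definition is_wgraph (R : realType) (V : finType) (G : wgraph R V) : Prop :=
  [/\ (0 < #|V|)%N, symmetric (adj G), irreflexive (adj G),
      forall u v, wt G u v = wt G v u
    & forall u v, adj G u v -> 0 < wt G u v].

Section Distance.
Context {R : realType} {V : finType} (G : wgraph R V).

Fixpoint walk_length (u : V) (p : seq V) : R :=
  if p is v :: p' then wt G u v + walk_length v p' else 0.

(* u :: p is a walk from u to v all of whose vertices lie in S *)
Definition is_walk (S : {set V}) (u v : V) (p : seq V) : bool :=
  [&& path (adj G) u p, last u p == v & all (mem S) (u :: p)].

(* d_{G[S]}(u, v), equal to +oo if there is no walk *)
Definition sub_dist (S : {set V}) (u v : V) : \bar R :=
  ereal_inf [set ((walk_length u p)%:E : \bar R) |
             p in [set p : seq V | is_walk S u v p]]%classic.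

Definition dist (u v : V) : \bar R := sub_dist [set: V] u v.

Definition dist_set (v : V) (P : {set V}) : \bar R :=
  \big[Order.min/+oo%E]_(p in P) dist v p.

Definition ball_cover (x : V) (r : R) (Z : {set V}) : Prop :=
  forall y, (dist x y <= (2 * r)%:E)%E ->
    exists2 z, z \in Z & (dist z y <= r%:E)%E.

Definition has_doubling_constant (mu : nat) : Prop :=
  forall (x : V) (r : R), 0 < r ->
    exists2 Z : {set V}, (#|Z| <= mu)%N & ball_cover x r Z.

(* As for the doubling constant, this is an upper-bound notion: a graph has
   doubling dimension log2 mu for each mu satisfying the covering property. *)
Definition has_doubling_dimension (d : R) : Prop :=
  exists mu : nat,
    [/\ (0 < mu)%N, has_doubling_constant mu & d = log2 mu%:R].

End Distance.

(** * Dangling nets *)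

(* The graph G + N: the vertex t of N is joined to [foot t] only, by an edge of
   weight [len t]. *)
Definition dangle (R : realType) (V N : finType) (G : wgraph R V)
    (foot : N -> V) (len : N -> R) : wgraph R (V + N)%type :=
  WGraph
    (fun x y => match x, y with
       | inl u, inl v => adj G u v
       | inl u, inr t | inr t, inl u => foot t == u
       | inr _, inr _ => false
       end)
    (fun x y => match x, y with
       | inl u, inl v => wt G u v
       | inl _, inr t | inr t, inl _ => len t
       | inr _, inr _ => 0
       end).

(* c is an admissible separation constant for dangling nets.  O(d) and
   \tilde O(d) are K d and K d (log2 (d + 2))^k for universal K and k; since a
   larger alpha or tau only weakens the requirement, they are taken equal to
   these bounds.  The restriction 1 <= d (i.e. mu >= 2) avoids d = 0, where the
   bounds degenerate. *)
Definition dangling_net_constant (R : realType) (c : R) : Prop :=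
  exists (K : R) (k : nat), 0 < K /\
  forall (V : finType) (G : wgraph R V) (d Lam : R),
    is_wgraph G -> has_doubling_dimension G d -> 1 <= d -> 0 < Lam ->
    exists (N : finType) (foot : N -> V) (len : N -> R),
      let GN := dangle G foot len in
      let NN : {set V + N} := [set inr t | t : N] in
      let alpha := K * d in
      let tau := K * d * log2 (d + 2) ^+ k in
      [/\ injective foot,
          forall t, 0 <= len t,
          forall v : V, (dist_set GN (inl v) NN <= Lam%:E)%E,
          forall v : V,
            #|[set t : N | (dist GN (inl v) (inr t) <=
                 dist_set GN (inl v) NN + (Lam / alpha)%:E)%E]|%:R <= tau
        & forall s t : N, s != t ->
            ((c * Lam)%:E <= dist G (foot s) (foot t))%E].

(** * Cluster aggregation *)

Record ca_instance (K : Type) (V : finType) := CAInstance {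
  ca_graph : wgraph K V;
  ca_clusters : {set {set V}};
  ca_diam : K;
  ca_portals : {set V}
}.

Definition map_ca_instance (K L : Type) (h : K -> L) (V : finType)
    (I : ca_instance K V) : ca_instance L V :=
  CAInstance
    (WGraph (adj (ca_graph I)) (fun u v => h (wt (ca_graph I) u v)))
    (ca_clusters I) (h (ca_diam I)) (ca_portals I).

Section ClusterAggregation.
Context {R : realType} {V : finType} (I : ca_instance R V).
Let G := ca_graph I.
Let CC := ca_clusters I.
Let Delta := ca_diam I.
Let P := ca_portals I.

Definition is_ca_instance : Prop :=
  [/\ is_wgraph G, finset.partition CC [set: V], 0 <= Delta
    & forall C, C \in CC ->
        {in C &, forall u v, (sub_dist G C u v <= Delta%:E)%E}].

Definition portal_of (f : {set V} -> V) (v : V) : V := f (finset.pblock CC v).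

(* f is only relevant on the members of CC *)
Definition is_ca_solution (beta : R) (f : {set V} -> V) : Prop :=
  (forall C, C \in CC -> f C \in P) /\
  forall v : V,
    (sub_dist G [set u | portal_of f u == portal_of f v] v (portal_of f v) <=
       dist_set G v P + (beta * Delta)%:E)%E.

Definition portals_net (c Lam : R) : Prop :=
  (forall v, (dist_set G v P <= Lam%:E)%E) /\
  {in P &, forall p q, p != q -> ((c * Lam)%:E <= dist G p q)%E}.

Definition separated_centers (c : R) : Prop :=
  exists center : {set V} -> V,
    (forall C, C \in CC -> center C \in C) /\
    {in CC &, forall C C', C != C' ->
       ((c / 3 * Delta)%:E <= dist G (center C) (center C'))%E}.

(* For d <= 1 we have log2 d <= 0, so the scale of the net and the distortion
   degenerate; by monotonicity of [has_doubling_dimension] in d, no graph is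
   excluded by 1 < d. *)
Definition admissible (c lam d : R) : Prop :=
  [/\ is_ca_instance, 1 < d, has_doubling_dimension G d,
      portals_net c (lam * d ^+ 3 * log2 d * Delta) & separated_centers c].

End ClusterAggregation.

(** * Randomized polynomial time

    The model is Jones' WHILE language over binary trees, extended with coin
    tossing.  Its unit-cost running time is polynomially equivalent to that of
    Turing machines: a step allocates a bounded number of cells, whence the
    absence of a tree-equality test. *)

Inductive tree := Leaf | Node of tree & tree.

Fixpoint tree_size (x : tree) : nat :=
  if x is Node y z then (tree_size y + tree_size z).+1 else 1%N.

Inductive expr :=
  | EVar of nat | ELeaf | ENode of expr & expr | EHd of expr | ETl of expr.

Inductive cmd :=
  | Assign of nat & expr
  | Flip of nat
  | Seq of cmd & cmd
  | If of expr & cmd & cmd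
  | While of expr & cmd.

Definition store := nat -> tree.

Definition update (s : store) (x : nat) (a : tree) : store :=
  fun y => if y == x then a else s y.

Fixpoint eval (s : store) (e : expr) : tree :=
  match e with
  | EVar x => s x
  | ELeaf => Leaf
  | ENode e1 e2 => Node (eval s e1) (eval s e2)
  | EHd e1 => if eval s e1 is Node a _ then a else Leaf
  | ETl e1 => if eval s e1 is Node _ b then b else Leaf
  end.

Definition tree_of_bool (b : bool) : tree := if b then Node Leaf Leaf else Leaf.

(* exec c s r s' r' t: from store s and coin tape r, the command c halts in t
   steps with store s', r' being the unread part of the tape. *)
Inductive exec : cmd -> store -> seq bool -> store -> seq bool -> nat -> Prop :=
  | exec_assign x e s r :
      exec (Assign x e) s r (update s x (eval s e)) r 1
  | exec_flip x s b r :
      exec (Flip x) s (b :: r) (update s x (tree_of_bool b)) r 1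
  | exec_seq c1 c2 s0 r0 s1 r1 s2 r2 t1 t2 :
      exec c1 s0 r0 s1 r1 t1 -> exec c2 s1 r1 s2 r2 t2 ->
      exec (Seq c1 c2) s0 r0 s2 r2 (t1 + t2)
  | exec_if_true e c1 c2 s r s' r' t :
      eval s e <> Leaf -> exec c1 s r s' r' t ->
      exec (If e c1 c2) s r s' r' t.+1
  | exec_if_false e c1 c2 s r s' r' t :
      eval s e = Leaf -> exec c2 s r s' r' t ->
      exec (If e c1 c2) s r s' r' t.+1
  | exec_while_true e c s0 r0 s1 r1 s2 r2 t1 t2 :
      eval s0 e <> Leaf -> exec c s0 r0 s1 r1 t1 ->
      exec (While e c) s1 r1 s2 r2 t2 ->
      exec (While e c) s0 r0 s2 r2 (t1 + t2).+1
  | exec_while_false e c s r :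
      eval s e = Leaf -> exec (While e c) s r s r 1.

(* Input and output are passed in variable 0. *)
Definition outputs (c : cmd) (T : nat) (x : tree) (r : seq bool) (y : tree) :
    Prop :=
  exists s r' t,
    [/\ exec c (update (fun=> Leaf) 0%N x) r s r' t, (t <= T)%N & s 0%N = y].

(* A single program which, on each input x in X, always halts within T steps,
   T polynomial in the size of the encoding of x, and returns a good answer
   with probability at least 2/3 over T uniform coins. *)
Definition randomized_polytime (X : Type) (encode : X -> tree)
    (promise : X -> Prop) (good : X -> tree -> Prop) : Prop :=
  exists (c : cmd) (a k : nat), forall x : X, promise x ->
    let T := (a * tree_size (encode x) ^ k + a)%N in
    (forall r : T.-tuple bool, exists y, outputs c T (encode x) r y) /\
    (2 * 2 ^ T <=
     3 * #|[set r : T.-tuple bool |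
             `[< exists2 y, outputs c T (encode x) r y & good x y >]]|)%N.

(** * Encodings *)

Fixpoint tree_of_pos (p : BinNums.positive) : tree :=
  match p with
  | BinNums.xH => Leaf
  | BinNums.xO q => Node (tree_of_bool false) (tree_of_pos q)
  | BinNums.xI q => Node (tree_of_bool true) (tree_of_pos q)
  end.

(* binary *)
Definition tree_of_nat (n : nat) : tree :=
  if bin_of_nat n is BinNums.Npos p then Node Leaf (tree_of_pos p) else Leaf.

Definition tree_of_seq (X : Type) (enc : X -> tree) (s : seq X) : tree :=
  foldr (fun x y => Node (enc x) y) Leaf s.

(* used on nonnegative rationals only, so the sign is dropped *)
Definition tree_of_rat (q : rat) : tree :=
  Node (tree_of_nat `|numq q|%N) (tree_of_nat `|denq q|%N).

Definition tree_of_set (n : nat) (A : {set 'I_n}) : tree :=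
  tree_of_seq (fun i : 'I_n => tree_of_nat i) (enum A).

Definition tree_of_wgraph (n : nat) (G : wgraph rat 'I_n) : tree :=
  tree_of_seq (fun i : 'I_n =>
    tree_of_seq (fun j : 'I_n =>
      if adj G i j then Node Leaf (tree_of_rat (wt G i j)) else Leaf)
    (enum 'I_n)) (enum 'I_n).

Definition tree_of_ca_instance (n : nat) (I : ca_instance rat 'I_n) : tree :=
  Node (tree_of_wgraph (ca_graph I))
    (Node (tree_of_seq (@tree_of_set n) (enum (ca_clusters I)))
      (Node (tree_of_rat (ca_diam I)) (tree_of_set (ca_portals I)))).

(* the list of the portals of the clusters of the vertices 0, ..., n - 1 *)
Definition tree_of_solution (n : nat) (I : ca_instance rat 'I_n)
    (f : {set 'I_n} -> 'I_n) : tree :=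
  tree_of_seq (fun v : 'I_n => tree_of_nat (f (finset.pblock (ca_clusters I) v)))
    (enum 'I_n).

(* Rational instances, paired with the dimension d.  The latter determines the
   promise and the required distortion but is not part of the encoding, hence
   not available to the algorithm. *)
Record rat_problem (R : realType) := RatProblem {
  rp_n : nat;
  rp_inst : ca_instance rat 'I_rp_n;
  rp_dim : R
}.

Definition real_inst (R : realType) (X : rat_problem R) :
    ca_instance R 'I_(rp_n X) :=
  map_ca_instance (ratr : rat -> R) (rp_inst X).

Definition ca_polytime (R : realType) (c lam : R) (beta : R -> R) : Prop :=
  randomized_polytime
    (fun X : rat_problem R => tree_of_ca_instance (rp_inst X))
    (fun X => admissible (real_inst X) c lam (rp_dim X))
    (fun X y => exists2 f,
       is_ca_solution (real_inst X) (beta (rp_dim X)) f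
       & y = tree_of_solution (rp_inst X) f).

(* Main.v *)
(* The algorithm is deterministic and works in phases.  Clusters are assigned to
   portals one after the other, each portal p keeping a connected territory in
   which every vertex v carries an upper bound g(v) on its distance to p; at the
   beginning, the clusters containing a portal are assigned.  In a phase, let H(v)
   be the distance from an unassigned vertex v to the assigned ones, offset by g.
   Each portal p in turn computes the same distance D_p(v) to its own territory and
   captures the unassigned clusters having a vertex with D_p(v) <= H(v) + 2 r Delta,
   for a radius r < 8m.  Shortest paths to p stay in the captured region, so a phase
   costs an additive 16 m Delta, and a cluster missed by all portals lies, for some
   p, at radius r + 1 but not r.

   The radius is found by region growing: for some r < 8m, the number of clusters
   gained from r to r + 1 is at most 1/4 of the number at r plus 2^-m times the
   number at 8m.  If every cluster is within reach of at most 2^m portals, this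
   halves, in each phase, the number of unassigned clusters, and does so locally, up
   to enlarging the region by O(Lambda).  The net property gives m = O(d); as the
   number of clusters in a region grows polynomially with its radius, of degree O(d),
   O(d log d) phases exhaust them all, which yields the distortion O(d^2 log d).

   The program does not know d: it tries all numbers m of radii and J of phases up to
   the number of vertices, and keeps the successful pair with the least product m J. *)

Require Import Defs.
From HB Require Import structures.
From mathcomp Require Import all_boot all_order all_algebra.
From mathcomp Require Import all_classical all_reals all_analysis.
From mathcomp Require Import zify ring lra.

Set Implicit Arguments.
Unset Strict Implicit.
Unset Printing Implicit Defensive.

Import Order.TTheory GRing.Theory Num.Theory.

Local Open Scope ring_scope.

(** * Distances and the Bellman-Ford iteration *)

(** Halving alone would need a number of phases logarithmic in the number of clusters, which [d]
    does not control. What it controls is a neighbourhood: a cluster unassigned after [J] phases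
    forces at least [2^J] clusters with centers within [2 rho J] of its own, where [rho] bounds the
    distance from a portal to the centers of the clusters it can touch. Doubling allows at most
    [2^(dd i1)] of them, where [2^i1] bounds the ratio of this radius to the separation of centers,
    so [J > dd i1] ends the run. As [rho] is of order [Lambda], the ratio is polynomial in [d] and
    [J], whence [i1 = O(log d)]. The constants are circular: [rho] must cover the detours
    [16 m J Delta] of all phases, these are [d^2 log d Delta] times a factor of order [log lam], and
    they must fit into [Lambda = lam d^3 log d Delta]. A large [lam] breaks the circle by dominating
    its own logarithm. The term with weight [2^-m] gives region growing a positive starting volume
    even if nothing is touched at radius 0; its sum over the portals stays bounded because each
    cluster is within reach of at most [2^m] of them. *)

Section GraphDistance.
Context {R : realType} {V : finType} (G : wgraph R V) (Gok : is_wgraph G).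
Implicit Types (S : {set V}) (u v w : V) (p q : seq V).

Lemma walk_length_cat u p q :
  walk_length G u (p ++ q) = walk_length G u p + walk_length G (last u p) q.
Proof.
elim: p u => [|x p IH] u /=; first by rewrite add0r.
by rewrite IH addrA.
Qed.

Lemma walk_length_ge0 u p : path (adj G) u p -> 0 <= walk_length G u p.
Proof.
case: Gok => _ _ _ _ wpos.
elim: p u => [|x p IH] u //= /andP[aux pp].
by rewrite addr_ge0 ?IH // ltW // wpos.
Qed.

Lemma is_walk_cat S u v w p q :
  is_walk G S u v p -> is_walk G S v w q -> is_walk G S u w (p ++ q).
Proof.
move=> /and3P[pp /eqP lp ap] /and3P[pq /eqP lq aq].
rewrite /is_walk cat_path last_cat lp pp pq lq eqxx /=.
move: ap aq => /= /andP[-> ap] /andP[_ aq].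
by rewrite all_cat ap aq.
Qed.

Lemma is_walk_rev S u v p : is_walk G S u v p ->
  is_walk G S v u (rev (belast u p)) /\
  walk_length G v (rev (belast u p)) = walk_length G u p.
Proof.
case: Gok => _ asym _ wsym _.
elim: p u => [|x p IH] u.
  by move=> /and3P[_ /eqP /= ->]; rewrite /is_walk /= => ->; rewrite eqxx.
move=> /and3P[/= /andP[aux pp] lp /andP[uS ap]].
have /IH[/and3P[rp /eqP rl ra] rw] : is_walk G S x v p by rewrite /is_walk pp lp.
rewrite rev_cons; split; last first.
  by rewrite -cats1 walk_length_cat rl rw /= addr0 addrC wsym.
rewrite /is_walk rcons_path rp rl last_rcons eqxx asym aux /=.
by move: ra => /= /andP[-> ra]; rewrite all_rcons ra andbT.
Qed.

Lemma sub_dist_le S u v p :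
  is_walk G S u v p -> (sub_dist G S u v <= (walk_length G u p)%:E)%E.
Proof. by move=> wp; apply: ereal_inf_lbound; exists p. Qed.

Lemma le_sub_dist S u v (x : \bar R) :
  (forall p, is_walk G S u v p -> (x <= (walk_length G u p)%:E)%E) ->
  (x <= sub_dist G S u v)%E.
Proof. by move=> H; apply: le_ereal_inf_tmp => _ [p wp <-]; apply: H. Qed.

Lemma sub_distS S S' u v :
  S \subset S' -> (sub_dist G S' u v <= sub_dist G S u v)%E.
Proof.
move=> SS; apply: le_sub_dist => p /and3P[pp lp ap]; apply: sub_dist_le.
rewrite /is_walk pp lp; apply: sub_all ap => x; apply: (fintype.subsetP SS).
Qed.

Lemma sub_dist_ge0 S u v : (0 <= sub_dist G S u v)%E.
Proof.
by apply: le_sub_dist => p /and3P[pp _ _]; rewrite lee_fin walk_length_ge0.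
Qed.

Lemma sub_dist_triangle S u v w :
  (sub_dist G S u w <= sub_dist G S u v + sub_dist G S v w)%E.
Proof.
case E : (sub_dist G S v w) => [y||]; last 2 first.
- by rewrite addey ?leey // gt_eqF // (lt_le_trans _ (sub_dist_ge0 _ _ _)) ?ltNy0.
- by have := sub_dist_ge0 S v w; rewrite E.
rewrite -leeBlDr //; apply: le_sub_dist => p wp.
rewrite leeBlDr // addeC -leeBlDr // -E; apply: le_sub_dist => q wq.
rewrite leeBlDr // -EFinD addrC.
have /and3P[_ /eqP lp _] := wp.
rewrite -[X in walk_length G X q]lp -walk_length_cat.
by apply: sub_dist_le (is_walk_cat wp wq).
Qed.

Lemma sub_dist_sym S u v : sub_dist G S u v = sub_dist G S v u.
Proof.
by apply/eqP; rewrite eq_le; apply/andP; split; apply: le_sub_dist => p wp;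
  have [wr <-] := is_walk_rev wp; apply: sub_dist_le.
Qed.

Lemma dist_xx S u : u \in S -> (sub_dist G S u u <= 0)%E.
Proof.
by move=> uS; apply: (@sub_dist_le S u u [::]); rewrite /is_walk /= eqxx uS.
Qed.

Lemma dist_le_sub S u v : (dist G u v <= sub_dist G S u v)%E.
Proof. by apply: sub_distS; apply: finset.subsetT. Qed.

Lemma le_dist_set v (P : {set V}) (x : \bar R) :
  (forall z, z \in P -> (x <= dist G v z)%E) -> (x <= dist_set G v P)%E.
Proof. by move=> H; apply: le_bigmin => //; rewrite leey. Qed.

Lemma dist_set_ge0 v (P : {set V}) : (0 <= dist_set G v P)%E.
Proof. by apply: le_dist_set => z _; apply: sub_dist_ge0. Qed.

End GraphDistance.

Section FoldMin.
Context {R : realType} {T : eqType} (c : pred T) (F : T -> \bar R).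
Let fmin a s := foldl (fun a u => if c u then Order.min a (F u) else a) a s.

Lemma foldl_min_le0 a s : (fmin a s <= a)%E.
Proof.
elim: s a => [|x s IH] a //=; apply: le_trans (IH _) _.
by case: ifP => // _; rewrite ge_min lexx.
Qed.

Lemma foldl_min_le a s u : u \in s -> c u -> (fmin a s <= F u)%E.
Proof.
elim: s a => [|x s IH] a //=; rewrite inE => /orP[/eqP <-|us] cu; last exact: IH.
by rewrite cu; apply: le_trans (foldl_min_le0 _ _) _; rewrite ge_min lexx orbT.
Qed.

Lemma foldl_min_witness a s :
  fmin a s = a \/ exists2 u, c u & fmin a s = F u.
Proof.
elim: s a => [|x s IH] a /=; first by left.
case cx: (c x); last exact: IH.
have [->|] := IH (Order.min a (F x)); last by right.
by case: (leP a (F x)) => _; [left | right; exists x].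
Qed.
End FoldMin.

Section BellmanFord.
Context {R : realType} {V : finType} (G : wgraph R V) (Gok : is_wgraph G).
Implicit Types (U : {set V}) (u v w : V) (p q : seq V) (D : V -> \bar R).

Definition relax U D v : \bar R :=
  if v \in U then
    foldl (fun a u => if adj G v u then Order.min a (D u + (wt G v u)%:E)%E else a)
      (D v) (enum V)
  else D v.

Definition bellman_ford U D : V -> \bar R := iter #|V| (relax U) D.

(** The last vertex is exempt: it is the source at which [D] is read. Vertices outside [U] are never
    relaxed, so a walk may end at one but not pass through it. *)
Definition walk_through U v q := path (adj G) v q && all (mem U) (belast v q).

Definition walk_cost D v q : \bar R := ((walk_length G v q)%:E + D (last v q))%E.

Lemma walk_through_cat U v p q :
  walk_through U v (p ++ q) = walk_through U v p && walk_through U (last v p) q.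
Proof. by rewrite /walk_through cat_path belast_cat all_cat andbACA. Qed.

Lemma walk_cost_cat D v p q :
  walk_cost D v (p ++ q) = ((walk_length G v p)%:E + walk_cost D (last v p) q)%E.
Proof. by rewrite /walk_cost walk_length_cat last_cat EFinD addeA. Qed.

(** Weights are positive, so dropping closed subwalks never lengthens a walk. This is why [#|V|]
    rounds suffice in [bellman_ford]. *)
Lemma walk_through_shorten U v q : walk_through U v q ->
  exists q', [/\ walk_through U v q', last v q' = last v q,
    walk_length G v q' <= walk_length G v q & uniq (v :: q')].
Proof.
elim: q v => [|x q IH] v; first by exists [::].
rewrite -cat1s walk_through_cat => /andP[wx /IH[q' [wq' lq' len uq']]].
have wq : walk_through U v (x :: q') by rewrite -cat1s walk_through_cat wx.
have lenx : walk_length G v (x :: q') <= walk_length G v (x :: q).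
  by rewrite /= lerD2l.
have [vx|vx] := boolP (v \in x :: q'); last first.
  by exists (x :: q'); split => //=; rewrite -/(uniq (x :: q')) ?uq' ?vx.
move: wq lenx lq' uq' => /=; rewrite -/(last v (x :: q')).
have -> : last x q' = last v (x :: q') by [].
have -> : walk_length G x q' = walk_length G v (x :: q') - wt G v x.
  by rewrite /= addrC addKr.
rewrite -/(uniq (x :: q')).
(* The walk returns to [v]: the part up to this return is closed and is dropped, leaving [r2]. *)
case/splitPr: vx => r1 r2.
rewrite -cat_rcons walk_through_cat last_rcons => /andP[w1 w2].
rewrite walk_length_cat last_rcons last_cat last_rcons => lenx lq.
rewrite cat_rcons cat_uniq => /and3P[_ _ u2].
exists r2; split => //.
apply: le_trans lenx; rewrite addrCA subrr addr0 lerDr walk_length_ge0 //.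
by case/andP: w1.
Qed.

Lemma walk_through_short U v q : walk_through U v q ->
  exists q', [/\ walk_through U v q', last v q' = last v q,
    walk_length G v q' <= walk_length G v q & (size q' < #|V|)%N].
Proof.
move=> /walk_through_shorten[q' [wq lq len /card_uniqP uq]]; exists q'; split=> //.
by rewrite -[X in (X <= _)%N]/(size (v :: q')) -uq max_card.
Qed.

Lemma iter_relax_le U D k v q : (size q <= k)%N -> walk_through U v q ->
  (iter k (relax U) D v <= walk_cost D v q)%E.
Proof.
elim: k v q => [|k IH] v q.
  by rewrite leqn0 => /nilP -> _; rewrite /walk_cost /= add0e.
have relax_le E x : (relax U E x <= E x)%E.
  by rewrite /relax; case: ifP => // _; apply: foldl_min_le0.
case: q => [_ _|x q /= sq].
  by apply: le_trans (relax_le _ _) _; apply: IH.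
rewrite -cat1s walk_through_cat walk_cost_cat => /andP[w1 wq].
rewrite /walk_through /= !andbT in w1; have /andP[avx vU] := w1.
rewrite /relax vU; apply: le_trans (foldl_min_le _ _ _ _) _; last 1 first.
- by rewrite /= addr0 addeC; apply: leeD => //; apply: IH.
- by rewrite mem_enum.
- exact: avx.
Qed.

Lemma iter_relax_witness U D k v :
  exists2 q, walk_through U v q & iter k (relax U) D v = walk_cost D v q.
Proof.
elim: k v => [|k IH] v; first by exists [::]; rewrite // /walk_cost /= add0e.
rewrite iterS [relax U _ v]/relax; case: ifP => // vU.
have [->//|[u avu ->]] := foldl_min_witness (adj G v)
  (fun u => iter k (relax U) D u + (wt G v u)%:E)%E (iter k (relax U) D v) (enum V).
have [q wq ->] := IH u.
exists (u :: q).
  by rewrite -cat1s walk_through_cat wq andbT /walk_through /= avu vU.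
by rewrite -cat1s walk_cost_cat /= addr0 addeC.
Qed.

(** Together with [bellman_ford_witness], this characterizes the iteration as an attained minimum
    over walks of arbitrary length; later arguments use only these two facts. *)
Lemma bellman_ford_le U D v q :
  walk_through U v q -> (bellman_ford U D v <= walk_cost D v q)%E.
Proof.
move=> /walk_through_short[q' [wq lq len sq]].
apply: le_trans (iter_relax_le D (ltnW sq) wq) _.
by rewrite /walk_cost lq leeD2r ?lee_fin.
Qed.

Lemma bellman_ford_witness U D v :
  exists2 q, walk_through U v q & bellman_ford U D v = walk_cost D v q.
Proof. exact: iter_relax_witness. Qed.

Lemma bellman_ford_out U D v : v \notin U -> bellman_ford U D v = D v.
Proof.
move=> vU; rewrite /bellman_ford; elim: #|V| => //= k IH.
by rewrite /relax (negbTE vU).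
Qed.

Lemma bellman_ford_walk U D v q : walk_through U v q ->
  (bellman_ford U D v <= (walk_length G v q)%:E + bellman_ford U D (last v q))%E.
Proof.
move=> wq; have [q' wq' ->] := bellman_ford_witness U D (last v q).
by rewrite -walk_cost_cat; apply: bellman_ford_le; rewrite walk_through_cat wq.
Qed.

Lemma bellman_ford_ge0 U D v :
  (forall x, 0 <= D x)%E -> (0 <= bellman_ford U D v)%E.
Proof.
move=> D0; have [q /andP[pq _] ->] := bellman_ford_witness U D v.
by rewrite adde_ge0 // lee_fin walk_length_ge0.
Qed.

Lemma walk_through_sub U U' v q :
  U \subset U' -> walk_through U v q -> walk_through U' v q.
Proof.
move=> sU /andP[pq aq]; rewrite /walk_through pq /=.
by apply: sub_all aq => x; apply: (fintype.subsetP sU).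
Qed.

Lemma walk_through_belast U v q x : walk_through U v q -> x \in belast v q ->
  x \in U /\ exists q1 q2, [/\ q = q1 ++ q2, last v q1 = x,
    walk_through U v q1 & walk_through U x q2].
Proof.
move=> wq xq; split; first by case/andP: wq => _ /allP; apply.
elim: q v wq xq => [|y q IH] v //=; rewrite inE => wq.
have [-> _|_ /= xq] := eqVneq x v; first by exists [::], (y :: q).
move: wq; rewrite -cat1s walk_through_cat => /andP[w1 /IH /(_ xq)].
move=> [q1 [q2 [-> lx w2 w3]]]; exists (y :: q1), q2; split => //.
by rewrite -[y :: q1]cat1s walk_through_cat w1.
Qed.

(** The iteration is 1-Lipschitz along walks inside [U]; on an unassigned cluster it therefore
    varies by at most the strong diameter. *)
Lemma bellman_ford_sub_dist U D (C : {set V}) u v (d : R) :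
    (forall x, 0 <= D x)%E -> C \subset U -> (sub_dist G C u v <= d%:E)%E ->
  (bellman_ford U D u <= d%:E + bellman_ford U D v)%E.
Proof.
move=> D0 CU duv; have := bellman_ford_ge0 U v D0.
case E: (bellman_ford U D v) => [y||] // _; last by rewrite addey ?leey.
rewrite -leeBlDr //; apply: le_trans duv; apply: le_sub_dist => q.
move=> /and3P[pq /eqP lq aq]; rewrite leeBlDr // -E -lq.
apply: bellman_ford_walk; rewrite /walk_through pq /=; apply/allP => x xq.
by apply: (fintype.subsetP CU); apply: (allP aq); apply: mem_belast.
Qed.

End BellmanFord.

(** * Packing in doubling metrics *)

Section Packing.
Context {R : realType} {V T : finType} (G : wgraph R V) (Gok : is_wgraph G).

(** Each halving of the radius costs a factor [mu]; after [i] halvings the radius is [r], and a ball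
    of radius [r] contains at most one of the points, which are more than [2 r] apart. *)
Lemma packing mu (f : T -> V) (r : R) i : has_doubling_constant G mu -> 0 < r ->
  forall x (S : {set T}),
    (forall y, y \in S -> (dist G x (f y) <= (2 ^+ i * r)%:E)%E) ->
    {in S &, forall y z, y != z -> ((2 * r)%:E < dist G (f y) (f z))%E} ->
  (#|S| <= mu ^ i)%N.
Proof.
move=> Gmu r0; elim: i => [|i IH] x S Sx Ssep.
  rewrite expn0; apply/card_le1_eqP => z y zS yS; apply/eqP.
  apply: contraT => yz; have := Ssep _ _ yS zS yz; rewrite ltNge => /negP; case.
  apply: le_trans (sub_dist_triangle Gok _ _ x _) _.
  rewrite mulr2n mulrDl !mul1r EFinD leeD //.
    by rewrite sub_dist_sym //; have := Sx _ yS; rewrite expr0 mul1r.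
  by have := Sx _ zS; rewrite expr0 mul1r.
have [Z Zmu Zcov] := Gmu x (2 ^+ i * r) (mulr_gt0 (exprn_gt0 i (ltr0Sn R 1)) r0).
pose B z := [set y in S | (dist G z (f y) <= (2 ^+ i * r)%:E)%E].
have BI z : (#|B z| <= mu ^ i)%N.
  apply: (IH z) => [y|y w]; first by rewrite inE => /andP[].
  by rewrite !inE => /andP[yS _] /andP[wS _]; apply: Ssep.
(* The balls cover [S], so every point is counted at least once in the sum. *)
apply: leq_trans (_ : \sum_(z in Z) #|B z| <= _)%N; last first.
  rewrite expnS; apply: leq_trans (_ : \sum_(z in Z) mu ^ i <= _)%N.
    by apply: leq_sum => z _; apply: BI.
  by rewrite sum_nat_const leq_mul2r Zmu orbT.
rewrite -sum1_card.
under [X in (_ <= X)%N]eq_bigr => z _ do rewrite -sum1_card big_mkcond.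
rewrite exchange_big /= big_mkcond; apply: leq_sum => y _.
case: ifP => // yS.
have [|z zZ zy] := Zcov (f y); first by rewrite mulrA -exprS; apply: Sx.
by rewrite (bigD1 z) //= inE yS zy.
Qed.
End Packing.

Section FoldPick.
Context {T : eqType}.

Lemma foldl_pick_last (c : pred T) b l :
  foldl (fun b r => if c r then r else b) b l = last b (seq.filter c l).
Proof. by elim: l b => //= x l IH b; rewrite IH; case: ifP. Qed.

Lemma foldl_pickP (c : pred T) b l : has c l ->
  let r := foldl (fun b r => if c r then r else b) b l in r \in l /\ c r.
Proof.
rewrite foldl_pick_last has_filter /=; case E: (seq.filter c l) => [|x l'] //= _.
have : last x l' \in seq.filter c l by rewrite E; apply: mem_last.
by rewrite mem_filter => /andP[].
Qed.
End FoldPick.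

(** Double counting of the pairs [(p, C)] with [C] in [F p]. It is used with [K = 1] for captured
    clusters and [K = 2^m] for clusters within reach. *)
Lemma sum_card_le (T U : finType) (S : {set T}) (F : T -> {set U}) (X : {set U})
    (K : nat) : (forall p, p \in S -> F p \subset X) ->
    (forall C, C \in X -> (#|[set p in S | C \in F p]| <= K)%N) ->
  (\sum_(p in S) #|F p| <= K * #|X|)%N.
Proof.
move=> FX FK.
rewrite mulnC -sum_nat_const.
have -> : (\sum_(p in S) #|F p| = \sum_(p in S) \sum_(C in X) (C \in F p))%N.
  apply: eq_bigr => p pS; rewrite -sum1_card big_mkcond /= [RHS]big_mkcond /=.
  apply: eq_bigr => C _; case: ifP => [/(fintype.subsetP (FX p pS)) -> //|_].
  by case: ifP.
rewrite exchange_big /=; apply: leq_sum => C CX; apply: leq_trans (FK C CX).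
rewrite -sum1_card big_mkcond [X in (_ <= X)%N]big_mkcond /=; apply: leq_sum => p _.
by rewrite inE; case: (p \in S); case: (C \in F p).
Qed.

(** * The aggregation algorithm *)

Section Algorithm.
Context {R : realType} {V : finType} (I : ca_instance R V).
Let G := ca_graph I.
Let CC := ca_clusters I.
Let Delta := ca_diam I.
Let P := ca_portals I.

(* the portal of a vertex, if any, and the bound on its distance to the portal,
   +oo for unassigned vertices *)
Definition state := V -> option V * \bar R.
Implicit Types (s : state) (H : V -> \bar R) (m r : nat) (p u v : V) (C : {set V}).

Definition unassigned s : {set V} := [set v | (s v).1 == None].

Definition levels s : V -> \bar R :=
  bellman_ford G (unassigned s) (fun v => (s v).2).

(** Only the territory of [p] is a source. The other territories have value [+oo] and lie outside
    [unassigned s], hence act as obstacles. *)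
Definition portal_levels s p : V -> \bar R :=
  bellman_ford G (unassigned s)
    (fun v => if (s v).1 == Some p then (s v).2 else +oo%E).

Definition reached H s p r : {set V} := [set v in unassigned s |
  (portal_levels s p v <= H v + (2 * Delta * r%:R)%:E)%E].

Definition touched H s p r : {set {set V}} :=
  [set C in CC | [exists v in C, v \in reached H s p r]].

(* 4 (t_(r+1) - t_r) <= t_r + 2^-m t_(8m), where t_r is the number of clusters
   touched at radius r: the last term is the seed volume of region growing. *)
Definition thin m H s p r : bool :=
  (4 * 2 ^ m * #|touched H s p r.+1| <=
     5 * 2 ^ m * #|touched H s p r| + #|touched H s p (8 * m)|)%N.

Definition pick_radius m H s p : nat :=
  foldl (fun b r => if thin m H s p r then r else b) 0%N (iota 0 (8 * m)).

(** The radius [r.+1] in the bound accounts for vertices that are not reached themselves: walking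
    inside the cluster to a reached vertex [y] costs [Delta], and replacing [H y] by [H v] costs
    another [Delta]. *)
Definition capture H s p r : state := fun v =>
  if finset.pblock CC v \in touched H s p r
  then (Some p, (H v + (2 * Delta * r.+1%:R)%:E)%E) else s v.

Definition step m H s p : state := capture H s p (pick_radius m H s p).

(** The levels are those at the start of the phase, for all portals, whereas [portal_levels] follows
    the current state. Thus the bounds set in one phase do not build on each other. *)
Definition phase m s : state := foldl (step m (levels s)) s (enum P).

Definition init_state : state := fun v =>
  let o := foldl (fun b p => if p \in finset.pblock CC v then Some p else b)
             None (enum P) in
  (o, if o is Some _ then Delta%:E else +oo%E).

Definition run m J : state := iter J (phase m) init_state.

Definition territory s p : {set V} := [set u | (s u).1 == Some p].

(** Distances to the portal are measured inside its territory, as a solution requires, and this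
    survives growth of the territory. Constancy on clusters makes a touched cluster entirely
    unassigned, and the value [+oo] keeps unassigned vertices from being sources. *)
Definition valid s : Prop :=
  [/\ forall v p, (s v).1 = Some p -> [/\ p \in P, (s v).2 != +oo%E &
         (sub_dist G (territory s p) v p <= (s v).2)%E],
      forall C, C \in CC -> {in C &, forall u v, (s u).1 = (s v).1}
    & forall v, (s v).1 = None -> (s v).2 = +oo%E].

Hypothesis Iok : is_ca_instance I.
Let Gok : is_wgraph G. Proof. by case: Iok. Qed.
Let CCpart : finset.partition CC [set: V]. Proof. by case: Iok. Qed.
Let Delta_ge0 : 0 <= Delta. Proof. by case: Iok. Qed.

Lemma mem_cluster v : v \in finset.pblock CC v.
Proof. by rewrite mem_pblock (cover_partition CCpart) inE. Qed.

Lemma cluster_in v : finset.pblock CC v \in CC.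
Proof. by rewrite pblock_mem // (cover_partition CCpart) inE. Qed.

Lemma clusterE C v : C \in CC -> v \in C -> finset.pblock CC v = C.
Proof. by move=> CCC; apply: def_pblock => //; case/and3P: CCpart. Qed.

Lemma cluster_diam C u v : C \in CC -> u \in C -> v \in C ->
  (sub_dist G C u v <= Delta%:E)%E.
Proof. by case: Iok => _ _ _ H CCC uC vC; apply: H. Qed.

Lemma unassignedE s v : (v \in unassigned s) = ((s v).1 == None).
Proof. by rewrite inE. Qed.

Lemma valid_ge0 s v : valid s -> (0 <= (s v).2)%E.
Proof.
move=> [sa _ sc]; case E: (s v).1 => [p|]; last by rewrite sc.
by have [_ _] := sa _ _ E; apply: le_trans; apply: sub_dist_ge0.
Qed.

Lemma valid_restrict_ge0 s p v : valid s ->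
  (0 <= (if (s v).1 == Some p then (s v).2 else +oo))%E.
Proof. by move=> vs; case: ifP => // _; apply: valid_ge0. Qed.

Lemma levels_close s C u v (d : R) : valid s -> C \subset unassigned s ->
  (sub_dist G C u v <= d%:E)%E -> (levels s u <= d%:E + levels s v)%E.
Proof.
by move=> vs CU; apply: bellman_ford_sub_dist => // x; apply: valid_ge0.
Qed.

Lemma portal_levels_close s p C u v (d : R) : valid s -> C \subset unassigned s ->
  (sub_dist G C u v <= d%:E)%E ->
  (portal_levels s p u <= d%:E + portal_levels s p v)%E.
Proof.
by move=> vs CU; apply: bellman_ford_sub_dist => // x; apply: valid_restrict_ge0.
Qed.

Lemma portal_levels_witness s p v : valid s -> portal_levels s p v != +oo%E ->
  exists q, [/\ walk_through G (unassigned s) v q, (s (last v q)).1 = Some p &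
    portal_levels s p v = ((walk_length G v q)%:E + (s (last v q)).2)%E].
Proof.
move=> vs; rewrite /portal_levels.
have [q wq ->] := bellman_ford_witness G (unassigned s)
  (fun v => if (s v).1 == Some p then (s v).2 else +oo%E) v.
rewrite /walk_cost /=; case: ((s (last v q)).1 =P Some p) => [lq _|_]; last by rewrite addey ?eqxx.
by exists q.
Qed.

Lemma dist_portal_levels s p v : valid s ->
  (dist G v p <= portal_levels s p v)%E.
Proof.
move=> vs; have [->|fin] := eqVneq (portal_levels s p v) +oo%E; first exact: leey.
have [q [wq lq ->]] := portal_levels_witness vs fin.
apply: le_trans (sub_dist_triangle Gok _ _ (last v q) _) _; apply: leeD.
  apply: sub_dist_le; rewrite /is_walk eqxx; case/andP: wq => -> _.
  by apply/allP => x _; rewrite /= inE.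
case: vs => sa _ _; have [_ _] := sa _ _ lq.
by apply: le_trans; apply: dist_le_sub.
Qed.

Lemma touched_sub H s p r C : valid s -> C \in touched H s p r ->
  C \in CC /\ C \subset unassigned s.
Proof.
move=> [_ sb _]; rewrite inE => /andP[CCC /exists_inP[v vC]].
rewrite !inE => /andP[/eqP vN _]; split => //.
by apply/fintype.subsetP => u uC; rewrite inE (sb C CCC u v) ?vN.
Qed.

Lemma touchedP H s p r C : C \in CC ->
  reflect (exists2 v, v \in C & v \in reached H s p r) (C \in touched H s p r).
Proof. by move=> CCC; rewrite inE CCC; apply: exists_inP. Qed.

Lemma reached_le H s p r r' : (r <= r')%N -> (forall v, H v \is a fin_num) ->
  reached H s p r \subset reached H s p r'.
Proof.
move=> rr Hf; apply/fintype.subsetP => v; rewrite !inE => /andP[-> /=] /le_trans; apply.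
by rewrite leeD2lE // lee_fin ler_wpM2l ?mulr_ge0 // ler_nat.
Qed.

Lemma touched_le H s p r r' : (r <= r')%N -> (forall v, H v \is a fin_num) ->
  touched H s p r \subset touched H s p r'.
Proof.
move=> rr Hf; apply/fintype.subsetP => C; rewrite !inE => /andP[-> /=].
move=> /exists_inP[v vC vr]; apply/exists_inP; exists v => //.
exact: (fintype.subsetP (reached_le _ _ rr Hf)).
Qed.

(** * Analysis of one phase *)

Section Phase.
Variables (s0 : state) (m : nat).
Hypotheses (vs0 : valid s0) (m_gt0 : (0 < m)%N).
Let H := levels s0.
Hypothesis Hfin : forall v, H v \is a fin_num.

Lemma levels_walk v q : walk_through G (unassigned s0) v q ->
  (H v <= (walk_length G v q)%:E + H (last v q))%E.
Proof. exact: bellman_ford_walk. Qed.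

(** Both sides of the test [D_p <= H + 2 Delta r] vary by at most [Delta] on a cluster, so one more
    unit of radius turns touching a cluster into reaching all of it. *)
Lemma reached_close s p r C v : valid s -> unassigned s \subset unassigned s0 ->
  C \in touched H s p r -> v \in C -> v \in reached H s p r.+1.
Proof.
move=> vs sub Ct vC; have [CCC CU] := touched_sub vs Ct.
case/(touchedP _ _ _ _ CCC): Ct => y yC; rewrite !inE => /andP[_ yr].
have := fintype.subsetP CU v vC; rewrite inE => -> /=.
apply: le_trans (portal_levels_close p vs CU (cluster_diam CCC vC yC)) _.
apply: le_trans (leeD (lexx _) yr) _.
have := levels_close vs0 (fintype.subset_trans CU sub) (cluster_diam CCC yC vC).
rewrite -/H -(fineK (Hfin y)) -(fineK (Hfin v)) -!EFinD !lee_fin => hy.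
by rewrite -natr1; lra.
Qed.

(** Along a walk realizing [portal_levels s p v], the level of [p] drops by at least the length
    walked, while [H] drops by at most that length. Hence the excess over [H] does not increase
    towards [p]. *)
Lemma reached_walk s p r v q x : valid s -> unassigned s \subset unassigned s0 ->
    v \in reached H s p r -> walk_through G (unassigned s) v q ->
    portal_levels s p v = ((walk_length G v q)%:E + (s (last v q)).2)%E ->
    (s (last v q)).1 = Some p ->
  x \in belast v q -> x \in reached H s p r.
Proof.
move=> vs sub vr wq vE lq /(walk_through_belast wq)[xU [q1 [q2 [qE lx w1 w2]]]].
rewrite inE xU /=.
have xle : (portal_levels s p x <= (walk_length G x q2)%:E + (s (last v q)).2)%E.
  have := bellman_ford_le Gok
    (fun v => if (s v).1 == Some p then (s v).2 else +oo%E) w2.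
  by rewrite /walk_cost -lx -last_cat -qE lq eqxx.
move: vr; rewrite inE vE {1}qE walk_length_cat lx => /andP[_ vle].
have := levels_walk (walk_through_sub sub w1); rewrite lx => Hle.
have := valid_ge0 (last v q) vs.
case E: (s (last v q)).2 xle vle => [g||] // xle vle _.
  apply: le_trans xle _; move: vle Hle.
  by rewrite -(fineK (Hfin x)) -(fineK (Hfin v)) -!EFinD !lee_fin; lra.
by move: vle; rewrite addey // -(fineK (Hfin v)).
Qed.

Lemma capture_unassigned s p r v :
  (v \in unassigned (capture H s p r)) =
    (v \in unassigned s) && (finset.pblock CC v \notin touched H s p r).
Proof. by rewrite !unassignedE /capture; case: ifP => _; rewrite ?andbF ?andbT. Qed.

Lemma capture_territory s p r p' : valid s ->
  territory s p' \subset territory (capture H s p r) p'.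
Proof.
move=> vs; apply/fintype.subsetP => v; rewrite !inE /capture; case: ifP => // vt.
have [_ /fintype.subsetP/(_ _ (mem_cluster v))] := touched_sub vs vt.
by rewrite inE => /eqP ->.
Qed.

(** A captured vertex gets to [p] within the new territory in three stages: inside its cluster to a
    reached vertex [y], along a realizing walk whose vertices lie in captured clusters by
    [reached_walk], and finally through the old territory. *)
Lemma capture_valid s p r : p \in P -> valid s ->
  unassigned s \subset unassigned s0 -> valid (capture H s p r).
Proof.
move=> pP vs sub; have [sa sb sc] := vs; split; last 2 first.
- move=> C CCC u v uC vC; rewrite /capture -/CC !(clusterE CCC) //.
  by case: ifP => // _; apply: sb uC vC.
- by move=> v; rewrite /capture; case: ifP => // _; apply: sc.
move=> v p'; rewrite {1 2 4}/capture; case: ifP => vt; last first.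
  move=> /sa[p'P fin le]; split => //; apply: le_trans le.
  exact/sub_distS/capture_territory.
move=> /= [<-]; split => //; first by rewrite -(fineK (Hfin v)).
set S := territory _ p; set C := finset.pblock CC v in vt.
have vC : v \in C := mem_cluster v.
have [CCC CU] := touched_sub vs vt.
have inS x C' : C' \in touched H s p r -> x \in C' -> x \in S.
  move=> C't xC'; have [C'CC _] := touched_sub vs C't.
  by rewrite inE /capture (clusterE C'CC xC') C't.
have /(touchedP _ _ _ _ CCC)[y yC yr] := vt.
have yle : (portal_levels s p y <= H y + (2 * Delta * r%:R)%:E)%E.
  by move: yr; rewrite inE => /andP[].
have yfin : portal_levels s p y != +oo%E.
  by apply: contraTneq yle => ->; rewrite -(fineK (Hfin y)).
have [q [wq lq yE]] := portal_levels_witness vs yfin.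
have yp : (sub_dist G S y p <= portal_levels s p y)%E.
  rewrite yE; apply: le_trans (sub_dist_triangle Gok _ _ (last y q) _) _.
  have lS : last y q \in S.
    by apply: (fintype.subsetP (capture_territory p r p vs)); rewrite inE lq.
  apply: leeD; last first.
    have [_ _] := sa _ _ lq; apply: le_trans; apply: sub_distS.
    exact: capture_territory.
  apply: sub_dist_le; rewrite /is_walk eqxx /=; have /andP[-> _] := wq => /=.
  rewrite -[_ && _]/(all (mem S) (y :: q)) lastI all_rcons /= lS /=.
  apply/allP => x xq; have xr := reached_walk vs sub yr wq yE lq xq.
  apply: (inS x (finset.pblock CC x)); last exact: mem_cluster.
  apply/touchedP; first exact: cluster_in.
  by exists x => //; apply: mem_cluster.
apply: le_trans (sub_dist_triangle Gok _ _ y _) _.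
have vy : (sub_dist G S v y <= Delta%:E)%E.
  apply: le_trans (cluster_diam CCC vC yC); apply: sub_distS.
  by apply/fintype.subsetP => x; apply: inS.
apply: le_trans (leeD vy (le_trans yp yle)) _.
have := levels_close vs0 (fintype.subset_trans CU sub) (cluster_diam CCC yC vC).
rewrite -/H -(fineK (Hfin y)) -(fineK (Hfin v)) -!EFinD !lee_fin => hy.
by rewrite -natr1; lra.
Qed.

(* Otherwise t_r + 2^-m t_(8m) would grow by the factor (5/4)^(8m) > 1 + 2^m. *)
Lemma thin_exists s p : exists2 r, (r < 8 * m)%N & thin m H s p r.
Proof.
apply/exists2P; apply: contrapT => no.
(* Each radius that is not thin multiplies [t_r + 2^-m t_(8m)] by more than 5/4; the inequality is
   cleared of denominators. *)
have grow r : (r <= 8 * m)%N ->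
    (5 ^ r * #|touched H s p (8 * m)| <=
     4 ^ r * (2 ^ m * #|touched H s p r| + #|touched H s p (8 * m)|))%N.
  elim: r => [|r IH] rm; first by rewrite !expn0 !mul1n leq_addl.
  have /negP : ~ thin m H s p r by move=> th; apply: no; exists r; split.
  rewrite /thin -ltnNge => th; have := IH (ltnW rm).
  rewrite !expnS; set a := (5 ^ r)%N; set b := (4 ^ r)%N; set k := (2 ^ m)%N in th *.
  move: th; set x := #|touched H s p r|; set t := #|touched H s p (8 * m)|.
  set y := #|touched H s p r.+1| => th h.
  have : (5 * (a * t) <= 5 * (b * (k * x + t)))%N by rewrite leq_mul2l h.
  have : (b * (5 * k * x + t) <= b * (4 * k * y))%N by rewrite leq_mul2l ltnW ?orbT.
  by nia.
(* If nothing is touched at radius [8 m], the radius [8 m - 1] is trivially thin. *)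
have t_gt0 : (0 < #|touched H s p (8 * m)|)%N.
  rewrite lt0n; apply/negP => /eqP t0; apply: no; exists (8 * m).-1; split.
    by rewrite prednK // muln_gt0.
  by rewrite /thin prednK ?muln_gt0 // t0 muln0.
have := grow (8 * m)%N (leqnn _); rewrite -mulSnr mulnA leq_pmul2r //.
apply/negP; rewrite -ltnNge.
(* Here [2 * 4^4 = 512 <= 625 = 5^4]: four radii double the volume, so [8 m] radii multiply it by at
   least [4^m], which exceeds [2^m + 1]. *)
have : (2 ^ (2 * m) * 4 ^ (8 * m) <= 5 ^ (8 * m))%N.
  rewrite (_ : (8 * m = 4 * (2 * m))%N); last by lia.
  by rewrite !(expnM _ 4) -expnMn leq_exp2r // muln_gt0.
apply: leq_trans; rewrite mulnC ltn_pmul2r ?expn_gt0 // expnM.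
have : (2 ^ m < 4 ^ m)%N by rewrite ltn_exp2r.
have : (1 < 2 ^ m)%N by rewrite -{1}(expn0 2) ltn_exp2l.
have -> : (2 ^ 2 = 4)%N by [].
have -> : (4 ^ m = 2 ^ m * 2 ^ m)%N by rewrite -expnMn.
by nia.
Qed.

Lemma pick_radiusP s p :
  (pick_radius m H s p < 8 * m)%N /\ thin m H s p (pick_radius m H s p).
Proof.
have [r rm th] := thin_exists s p.
have [|] := @foldl_pickP _ (thin m H s p) 0%N (iota 0 (8 * m)).
  by apply/hasP; exists r; rewrite // mem_iota.
by rewrite mem_iota.
Qed.

Definition phase_inv s : Prop :=
  [/\ valid s, unassigned s \subset unassigned s0,
      forall v, v \notin unassigned s0 -> s v = s0 v
    & forall v, v \in unassigned s0 -> v \notin unassigned s ->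
        ((s v).2 <= H v + (16 * m%:R * Delta)%:E)%E].

Lemma step_sub s p : unassigned (step m H s p) \subset unassigned s.
Proof.
by apply/fintype.subsetP => v; rewrite capture_unassigned => /andP[].
Qed.

Lemma step_inv s p : p \in P -> phase_inv s -> phase_inv (step m H s p).
Proof.
move=> pP [vs sub out ins].
have captured v : v \notin unassigned s ->
    finset.pblock CC v \notin touched H s p (pick_radius m H s p).
  apply: contra => vt; have [_ /fintype.subsetP] := touched_sub vs vt.
  by apply; apply: mem_cluster.
split.
- exact: capture_valid.
- exact: fintype.subset_trans (step_sub _ _) sub.
- move=> v v0; rewrite /step /capture ifN ?out // captured //.
  by apply: contra v0; apply: (fintype.subsetP sub).
- move=> v v0; rewrite /step capture_unassigned negb_and negbK /capture.
  have [vU /= vt|vU _] := boolP (v \in unassigned s); last first.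
    by rewrite ifN ?captured // ins.
  rewrite vt /= leeD2lE // lee_fin; have [rm _] := pick_radiusP s p.
  (* Since [r < 8 m], also [r.+1 <= 8 m]; this gives the cost [16 m Delta] of a phase. *)
  apply: le_trans (_ : 2 * Delta * (8 * m)%:R <= _).
    by rewrite ler_wpM2l ?mulr_ge0 // ler_nat.
  by rewrite natrM; lra.
Qed.

Let ps := enum P.
Definition partial k : state := foldl (step m H) s0 (take k ps).

Lemma partialS k p0 : (k < size ps)%N ->
  partial k.+1 = step m H (partial k) (nth p0 ps k).
Proof. by move=> kp; rewrite /partial (take_nth p0) // foldl_rcons. Qed.

Lemma partial_end : partial (size ps) = phase m s0.
Proof. by rewrite /partial take_size. Qed.

Lemma partial_inv k : phase_inv (partial k).
Proof.
have inv0 : phase_inv s0 by split => // v v0 /negP; case.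
rewrite /partial; have : all (mem P) (take k ps).
  by apply/allP => p /mem_take; rewrite mem_enum.
elim: (take k ps) (s0) inv0 => //= p l IH s inv /andP[pP lP].
by apply: IH => //; apply: step_inv.
Qed.

Lemma partial_sub k k' : (k <= k')%N ->
  unassigned (partial k') \subset unassigned (partial k).
Proof.
move=> /subnK <-; elim: (k' - k)%N => [|j IH]; first by rewrite add0n.
apply: fintype.subset_trans IH; rewrite addSn; case: (ltnP (j + k) (size ps)) => jk.
  have p0 : V by case: (ps) jk.
  by rewrite (partialS p0) //; apply: step_sub.
by rewrite /partial !take_oversize // ltnW.
Qed.

Definition before p : state := partial (index p ps).
Definition radius p : nat := pick_radius m H (before p) p.

Lemma after_portal p : p \in P ->
  partial (index p ps).+1 = capture H (before p) p (radius p).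
Proof.
move=> pP; have ip : (index p ps < size ps)%N by rewrite index_mem mem_enum.
by rewrite (partialS p ip) nth_index // mem_enum.
Qed.

(* A shortest path realizing H leads v to some portal; when a first cluster on this
   path is captured by p, v itself is close enough to p to be touched at the next
   radius. *)
Lemma phase_marked v : v \in unassigned (phase m s0) ->
  exists2 p, p \in P & (finset.pblock CC v \in
    touched H (before p) p (radius p).+1 :\: touched H (before p) p (radius p)).
Proof.
rewrite -partial_end => vend; apply/exists2P; apply: contrapT => no.
have sizeP p : p \in P -> (index p ps < size ps)%N by rewrite index_mem mem_enum.
have vU k : (k <= size ps)%N -> v \in unassigned (partial k).
  by move=> kp; apply: (fintype.subsetP (partial_sub kp)).
have v0 : v \in unassigned s0 by have := vU 0%N (leq0n _); rewrite /partial take0.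
have [q wq HE] := bellman_ford_witness G (unassigned s0) (fun v => (s0 v).2) v.
rewrite -/(levels s0 v) -/H in HE.
have lq : last v q \notin unassigned s0.
  apply/negP; rewrite unassignedE => /eqP lN; have [_ _ sc] := vs0.
  by have := Hfin v; rewrite HE /walk_cost sc.
(* No vertex [x] before the end of the walk is captured by a portal [p]: otherwise [D_p(v)] is at
   most the length of [q1] plus [H x + 2 Delta (r + 1)], and on a walk realizing [H v] the length of
   [q1] plus [H x] is at most [H v], so [p] would mark [v]. *)
have wk k : (k <= size ps)%N -> walk_through G (unassigned (partial k)) v q.
  elim: k => [|k IH] kp; first by rewrite /partial take0.
  have {}IH := IH (ltnW kp).
  set p := nth v ps k; have pP : p \in P by rewrite -mem_enum mem_nth.
  have pk : index p ps = k by rewrite index_uniq ?enum_uniq.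
  have [vs sub _ _] := partial_inv k.
  rewrite /walk_through; case/andP: (IH) => -> _ /=; apply/allP => x xq.
  have [xU [q1 [q2 [qE lx w1 w2]]]] := walk_through_belast IH xq.
  rewrite /= -pk after_portal // capture_unassigned /before pk xU /=.
  apply/negP => xt; apply: no; exists p; split => //.
  rewrite inE; apply/andP; split.
    have := vU _ (sizeP _ pP); rewrite after_portal // capture_unassigned.
    by case/andP.
  rewrite /before pk in xt *; apply/touchedP; first exact: cluster_in.
  exists v; first exact: mem_cluster.
  have := reached_close vs sub xt (mem_cluster x).
  rewrite !inE => /andP[_ xr]; have := vU k (ltnW kp); rewrite inE => -> /=.
  have := bellman_ford_walk Gok (fun u => if (partial k u).1 == Some p
    then (partial k u).2 else +oo%E) w1; rewrite -/(portal_levels _ _).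
  rewrite lx => /le_trans; apply; apply: le_trans (leeD (lexx _) xr) _.
  rewrite addeA leeD2rE // HE qE walk_cost_cat leeD2l // lx.
  by apply: bellman_ford_le => //; apply: walk_through_sub w2.
(* The walk is thus still free at the turn of the portal [p] owning its end, which gives
   [D_p(v) <= H v]: then [p] touches the cluster of [v] already at radius 0, and [v] cannot remain
   unassigned. *)
have [p lp] : exists p, (s0 (last v q)).1 = Some p.
  by move: lq; rewrite unassignedE; case: (s0 _).1 => // p _; exists p.
have [sa _ _] := vs0; have [pP _ _] := sa _ _ lp.
have [vs sub out _] := partial_inv (index p ps).
have := vU _ (sizeP _ pP); rewrite after_portal // capture_unassigned => /andP[_].
move=> /negP; apply; apply: (fintype.subsetP (touched_le _ _ (leq0n _) Hfin)).
apply/touchedP; first exact: cluster_in.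
exists v; first exact: mem_cluster.
rewrite !inE; have := vU _ (ltnW (sizeP _ pP)); rewrite inE => -> /=.
rewrite mulr0 adde0; apply: le_trans (bellman_ford_le Gok _ (wk _ (ltnW (sizeP _ pP)))) _.
by rewrite /walk_cost /before out // lp eqxx HE.
Qed.

Definition remaining s : {set {set V}} := [set C in CC | C \subset unassigned s].

(* Each marked cluster is charged to the clusters captured by p and, with weight
   2^-m, to those within reach of p. *)
Lemma contraction (A A' : {set {set V}}) :
    (forall C, C \in CC ->
       (#|[set p in P | C \in touched H (before p) p (8 * m)]| <= 2 ^ m)%N) ->
    (forall p C, p \in P -> C \in A -> C \in touched H (before p) p (8 * m) ->
       touched H (before p) p (8 * m) \subset A') ->
  (2 * #|remaining (phase m s0) :&: A| <= #|remaining s0 :&: A'|)%N.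
Proof.
move=> few near.
pose T p r := touched H (before p) p r.
(* Only portals whose reach meets [A] can mark a cluster of [A]; everything they touch lies in [A'],
   which makes the count local. *)
pose Q := [set p in P | ~~ [disjoint T p (8 * m)%N & A]].
have QP p : p \in Q -> p \in P by rewrite inE => /andP[].
have TS p : T p (8 * m)%N \subset remaining s0.
  have [vs sub _ _] := partial_inv (index p ps); apply/fintype.subsetP => C Ct.
  have [CCC CU] := touched_sub vs Ct.
  by rewrite inE CCC (fintype.subset_trans CU sub).
have rm p : (radius p < 8 * m)%N by have [] := pick_radiusP (before p) p.
have TX p r : p \in Q -> (r <= 8 * m)%N -> T p r \subset remaining s0 :&: A'.
  move=> pQ r8; apply: fintype.subset_trans (touched_le _ _ r8 Hfin) _.
  rewrite finset.subsetI TS /=; move: pQ; rewrite inE => /andP[pP].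
  by move=> /pred0Pn[C /andP[Ct CA]]; apply: near CA Ct.
have cov : remaining (phase m s0) :&: A \subset
    \bigcup_(p in Q) (T p (radius p).+1 :\: T p (radius p)).
  apply/fintype.subsetP => C; rewrite inE => /andP[]; rewrite inE => /andP[CCC CU] CA.
  have [v vC] : exists v, v \in C.
    apply/set0Pn; apply: contraTneq CCpart => C0.
    by rewrite /finset.partition -C0 CCC !andbF.
  have [p pP] := phase_marked (fintype.subsetP CU v vC).
  rewrite (clusterE CCC vC) => Cm; apply/bigcupP; exists p => //.
  rewrite inE pP; apply/pred0Pn; exists C; rewrite /= CA andbT.
  apply: (fintype.subsetP (touched_le _ _ (rm p) Hfin)).
  by move: Cm; rewrite inE => /andP[].
have mk p : (4 * 2 ^ m * #|T p (radius p).+1 :\: T p (radius p)| <=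
     2 ^ m * #|T p (radius p)| + #|T p (8 * m)|)%N.
  rewrite cardsD (finset.setIidPr (touched_le _ _ (leqnSn _) Hfin)).
  have [_] := pick_radiusP (before p) p; rewrite /thin -/(radius p) -!/(T _ _).
  by move: (2 ^ m)%N => k; set x := #|_|; set y := #|_|; set z := #|_|; nia.
(* A cluster is captured at most once: after its capture it is no longer unassigned, so no later
   portal can touch it. *)
have capsum : (\sum_(p in Q) #|T p (radius p)| <= 1 * #|remaining s0 :&: A'|)%N.
  apply: sum_card_le => [p pQ|C CX]; first by apply: TX => //; apply: ltnW.
  have later p p' : p \in P -> p' \in P -> (index p ps < index p' ps)%N ->
      C \in T p (radius p) -> C \notin T p' (radius p').
    move=> pP p'P lt Cp; apply/negP => Cp'.
    have [vs' _ _ _] := partial_inv (index p' ps).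
    have [vs _ _ _] := partial_inv (index p ps).
    have [CCC CU'] := touched_sub vs' Cp'.
    case/(touchedP _ _ _ _ CCC): (Cp') => v vC _.
    have := fintype.subsetP (partial_sub lt) v (fintype.subsetP CU' v vC).
    by rewrite after_portal // capture_unassigned (clusterE CCC vC) Cp andbF.
  apply/card_le1_eqP => p p' hp hp'; move: hp; rewrite inE => /andP[/QP pP Cp].
  move: hp'; rewrite inE => /andP[/QP p'P Cp'].
  case: (ltngtP (index p ps) (index p' ps)) => [lt|lt|].
  - by have := later _ _ pP p'P lt Cp; rewrite Cp'.
  - by have := later _ _ p'P pP lt Cp'; rewrite Cp.
  - by move=> /(@index_inj _ p ps) -> //; rewrite mem_enum.
have tlsum : (\sum_(p in Q) #|T p (8 * m)%N| <= 2 ^ m * #|remaining s0 :&: A'|)%N.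
  apply: sum_card_le => [p pQ|C]; first by apply: TX.
  rewrite inE => /andP[]; rewrite inE => /andP[CCC _] _.
  apply: leq_trans (few C CCC); apply: subset_leq_card; apply/fintype.subsetP => p.
  by rewrite inE => /andP[/QP pP Ct]; rewrite inE pP.
(* The captured clusters and the seed terms each contribute [2^m] times the size of
   [remaining s0 :&: A']; dividing by [2 * 2^m] leaves the factor 2. *)
have : (4 * 2 ^ m * #|remaining (phase m s0) :&: A| <=
    2 ^ m * (1 * #|remaining s0 :&: A'|) + 2 ^ m * #|remaining s0 :&: A'|)%N.
  apply: leq_trans (leq_add (leq_mul (leqnn _) capsum) tlsum).
  rewrite big_distrr -big_split /=.
  apply: leq_trans (_ : \sum_(p in Q)
      4 * 2 ^ m * #|T p (radius p).+1 :\: T p (radius p)| <= _)%N; last first.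
    by apply: leq_sum => p _; apply: mk.
  rewrite -big_distrr /= leq_mul2l; apply/orP; right.
  apply: leq_trans (subset_leq_card cov) _.
  elim/big_rec2: _ => [|p x y _ le]; first by rewrite cards0.
  by apply: leq_trans (leq_card_setU _ _) _; rewrite leq_add2l.
have : (0 < 2 ^ m)%N by rewrite expn_gt0.
by move: (2 ^ m)%N => k; nia.
Qed.

End Phase.
End Algorithm.

(** * Successive phases: distortion, termination and locality *)

Section Runs.
Context {R : realType} {V : finType} (I : ca_instance R V).
Let G := ca_graph I.
Let CC := ca_clusters I.
Let Delta := ca_diam I.
Let P := ca_portals I.
Hypothesis Iok : is_ca_instance I.
Let Gok : is_wgraph G. Proof. by case: Iok. Qed.
Let CCpart : finset.partition CC [set: V]. Proof. by case: Iok. Qed.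
Let Delta_ge0 : 0 <= Delta. Proof. by case: Iok. Qed.
Hypothesis reachable : forall v, dist_set G v P \is a fin_num.

Lemma init_portalP v p : (init_state I v).1 = Some p ->
  p \in P /\ p \in finset.pblock CC v.
Proof.
have : forall x, x \in enum P -> x \in P by move=> x; rewrite mem_enum.
rewrite /init_state /= -/P -/CC; move: (enum P) => l lP.
suff H b : (forall q, b = Some q -> q \in P /\ q \in finset.pblock CC v) ->
    foldl (fun b p => if p \in finset.pblock CC v then Some p else b) b l = Some p ->
    p \in P /\ p \in finset.pblock CC v by apply: H.
elim: l b lP => [|x l IH] b lP Hb /=; first exact: Hb.
apply: IH => [y yl|q]; first by apply: lP; rewrite inE yl orbT.
by case: ifP => [xv [<-]|_ /Hb //]; split=> //; apply: lP; rewrite mem_head.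
Qed.

Lemma init_assigned v p : p \in P -> p \in finset.pblock CC v ->
  exists q, (init_state I v).1 = Some q.
Proof.
rewrite -mem_enum /init_state /= -/CC -/P; move: (enum P) => l pl pv.
suff H b : isSome b || (p \in l) -> exists q,
    foldl (fun b p => if p \in finset.pblock CC v then Some p else b) b l = Some q.
  by apply: H; rewrite pl.
elim: l b {pl} => [|x l IH] [b|] //=; first by exists b.
  by move=> _; apply: IH; case: ifP.
rewrite inE => /orP[/eqP <-|pl]; apply: IH; first by rewrite pv.
by rewrite pl orbT.
Qed.

Lemma init_valid : valid I (init_state I).
Proof.
split.
- move=> v p vp; have [pP pv] := init_portalP vp; split => //.
    by rewrite /init_state; move: vp; rewrite /init_state /= => ->.
  have -> : (init_state I v).2 = Delta%:E.
    by rewrite /init_state; move: vp; rewrite /init_state /= => ->.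
  apply: le_trans (cluster_diam Iok (cluster_in Iok v) (mem_cluster Iok v) pv).
  apply: sub_distS; apply/fintype.subsetP => u uv.
  by rewrite inE -vp /init_state /= (clusterE Iok (cluster_in Iok v) uv).
- by move=> C CCC u v uC vC; rewrite /init_state /= !(clusterE Iok CCC).
- by move=> v; rewrite /init_state /= => ->.
Qed.

(** A walk to a portal is cut at its first assigned vertex, whose bound is [Delta]; such a vertex
    exists because the cluster of the portal is assigned. *)
Lemma init_levels v :
  (levels I (init_state I) v <= dist_set G v P + Delta%:E)%E.
Proof.
rewrite -leeBlDr //; apply: le_dist_set => p pP; apply: le_sub_dist => q.
move=> /and3P[pq lq _]; rewrite leeBlDr //.
have assigned x : x \notin unassigned (init_state I) ->
    levels I (init_state I) x = Delta%:E.
  move=> xU; rewrite /levels bellman_ford_out //.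
  by move: xU; rewrite unassignedE /init_state /=; case: foldl.
elim: q v pq lq => [|x q IH] v /=.
  move=> _ /eqP vp; rewrite add0e assigned // unassignedE.
  have vv : p \in finset.pblock CC v by rewrite vp; apply: mem_cluster.
  by have [q ->] := init_assigned pP vv.
move=> /andP[avx pq] lq; have [vU|vU] := boolP (v \in unassigned (init_state I)).
  have w1 : walk_through G (unassigned (init_state I)) v [:: x].
    by rewrite /walk_through /= avx vU.
  apply: le_trans (bellman_ford_walk Gok _ w1) _.
  by rewrite /= addr0 EFinD -addeA leeD2l // IH.
rewrite assigned // -EFinD lee_fin lerDr (@walk_length_ge0 _ _ _ Gok v (x :: q)) //=.
by rewrite avx pq.
Qed.

Lemma phase_end_inv s m : valid I s -> (0 < m)%N ->
  (forall v, levels I s v \is a fin_num) -> phase_inv I s m (phase I m s).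
Proof. by move=> vs m0 Hf; rewrite -partial_end; apply: partial_inv. Qed.

(** A walk realizing the old level is cut at the first vertex assigned after the phase. There the
    new bound exceeds the old level by at most [16 m Delta], and the excess is paid only once. *)
Lemma phase_levels s m v : valid I s -> (0 < m)%N ->
    (forall v, levels I s v \is a fin_num) ->
  (levels I (phase I m s) v <= levels I s v + (16 * m%:R * Delta)%:E)%E.
Proof.
move=> vs m0 Hf; have [vs' sub out ins] := phase_end_inv vs m0 Hf.
have c0 : 0 <= 16 * m%:R * Delta by rewrite !mulr_ge0.
have assigned x : x \notin unassigned (phase I m s) ->
    (levels I (phase I m s) x <= levels I s x + (16 * m%:R * Delta)%:E)%E.
  move=> xU; rewrite {1}/levels bellman_ford_out //.
  have [x0|x0] := boolP (x \in unassigned s); first exact: ins.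
  by rewrite out // /levels bellman_ford_out // leeDl.
have [q wq HE] := bellman_ford_witness (ca_graph I) (unassigned s) (fun v => (s v).2) v.
rewrite -/(levels I s v) in HE; rewrite HE.
have : last v q \notin unassigned s.
  apply/negP; rewrite unassignedE => /eqP lN; have [_ _ sc] := vs.
  by have := Hf v; rewrite HE /walk_cost sc.
elim: q v wq {HE} => [|x q IH] v /=.
  move=> _ vU; apply: le_trans (assigned v _) _.
    by apply: contra vU; apply: (fintype.subsetP sub).
  by rewrite /levels bellman_ford_out // /walk_cost /= add0e.
have [vU|vU] := boolP (v \in unassigned (phase I m s)); last first.
  move=> wq _; apply: le_trans (assigned v vU) _; apply: leeD2r.
  exact: bellman_ford_le.
rewrite -cat1s walk_through_cat => /andP[/andP[pvx _] wq] lq.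
have w1 : walk_through (ca_graph I) (unassigned (phase I m s)) v [:: x].
  by rewrite /walk_through pvx /= vU.
apply: le_trans (bellman_ford_walk Gok _ w1) _.
rewrite walk_cost_cat -addeA leeD2l //.
exact: IH.
Qed.

Lemma levels_fin s v (b : R) : valid I s ->
  (levels I s v <= dist_set G v P + b%:E)%E -> levels I s v \is a fin_num.
Proof.
move=> vs le; rewrite fin_numElt; apply/andP; split.
  apply: lt_le_trans (ltNyr 0) _; apply: bellman_ford_ge0 => // x.
  by apply: (valid_ge0 Iok).
apply: le_lt_trans le _.
by rewrite -(fineK (reachable v)) -EFinD ltry.
Qed.

Lemma run_inv m J : (0 < m)%N -> valid I (run I m J) /\
  forall v, (levels I (run I m J) v <=
               dist_set G v P + ((1 + 16 * m%:R * J%:R) * Delta)%:E)%E.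
Proof.
move=> m0; elim: J => [|J [vs le]].
  split=> [|v]; first exact: init_valid.
  by rewrite mulr0 addr0 mul1r; apply: init_levels.
have Hf v : levels I (run I m J) v \is a fin_num by apply: levels_fin (le v).
have [vs' _ _ _] := phase_end_inv vs m0 Hf; split => // v.
apply: le_trans (phase_levels v vs m0 Hf) _.
apply: le_trans (leeD2r _ (le v)) _; rewrite -addeA leeD2l // -EFinD lee_fin.
by rewrite -natr1; lra.
Qed.

Lemma run_levels_fin m J v : (0 < m)%N -> levels I (run I m J) v \is a fin_num.
Proof. by move=> /(run_inv J)[vs /(_ v)]; apply: levels_fin. Qed.

(** Any vertex of [C] will do, since valid states are constant on clusters; [x0] fills in where
    there is no vertex or no portal. *)
Definition solution_of (x0 : V) (s : @state R V) (C : {set V}) : V :=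
  odflt x0 (obind (fun v => (s v).1) [pick v in C]).

Lemma portal_of_solution x0 s v p : valid I s -> (s v).1 = Some p ->
  portal_of I (solution_of x0 s) v = p.
Proof.
move=> [_ sb _] vp; rewrite /portal_of /solution_of -/CC.
case: pickP => [u uv|/(_ v)]; last by rewrite /= mem_cluster.
by rewrite /= (sb _ (cluster_in Iok v) u v uv (mem_cluster Iok v)) vp.
Qed.

Lemma run_solution x0 m J : (0 < m)%N -> unassigned (run I m J) = finset.set0 ->
  is_ca_solution I (1 + 16 * m%:R * J%:R) (solution_of x0 (run I m J)).
Proof.
move=> m0 all_assigned; have [vs le] := run_inv J m0.
have [sa sb sc] := vs.
have port v : exists p, (run I m J v).1 = Some p.
  have : v \notin unassigned (run I m J) by rewrite all_assigned finset.in_set0.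
  by rewrite unassignedE; case: (run I m J v).1 => // p _; exists p.
split=> [C CCC|v].
  have [v vC] : exists v, v \in C.
    apply/set0Pn; apply: contraTneq CCpart => C0.
    by rewrite /finset.partition -C0 CCC !andbF.
  have [p vp] := port v; have := portal_of_solution x0 vs vp.
  by rewrite /portal_of (clusterE Iok CCC vC) => ->; have [] := sa _ _ vp.
have [p vp] := port v; have [pP _ vle] := sa _ _ vp.
rewrite (portal_of_solution x0 vs vp).
have -> : [set u | portal_of I (solution_of x0 (run I m J)) u == p] =
    territory (run I m J) p.
  apply/setP => u; rewrite !inE; have [p' up] := port u.
  by rewrite (portal_of_solution x0 vs up) up.
apply: le_trans vle (le_trans _ (le v)).
by rewrite /levels bellman_ford_out // all_assigned finset.in_set0.
Qed.

Lemma remaining_unassigned s : valid I s -> remaining I s = finset.set0 ->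
  unassigned s = finset.set0.
Proof.
move=> [_ sb _] rem0; apply/setP => v; rewrite finset.in_set0; apply/negP => vU.
suff : finset.pblock CC v \in remaining I s by rewrite rem0 finset.in_set0.
rewrite inE (cluster_in Iok); apply/fintype.subsetP => u uv.
move: vU; rewrite !unassignedE.
by rewrite (sb _ (cluster_in Iok v) u v uv (mem_cluster Iok v)).
Qed.

Lemma card_clusters : (#|CC| <= #|V|)%N.
Proof.
have sub : CC \subset [set finset.pblock CC v | v in V].
  apply/fintype.subsetP => C CCC.
  have [v vC] : exists v, v \in C.
    apply/set0Pn; apply: contraTneq CCpart => C0.
    by rewrite /finset.partition -C0 CCC !andbF.
  by apply/imsetP; exists v; rewrite // (clusterE Iok CCC vC).
exact: leq_trans (subset_leq_card sub) (leq_imset_card _ _).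
Qed.

Lemma remaining_sub_clusters s : remaining I s \subset CC.
Proof. by apply/fintype.subsetP => C; rewrite inE => /andP[]. Qed.

Lemma card_gt0 : (0 < #|V|)%N. Proof. by case: Gok. Qed.

(** There are at most [2^m] portals in all, so every phase halves the unassigned clusters globally.
    This settles the case [Delta = 0], where packing has no scale. *)
Lemma run_full m J : (#|V| <= m)%N -> (#|V| <= J)%N ->
  unassigned (run I m J) = finset.set0.
Proof.
move=> Vm VJ; have m0 : (0 < m)%N := leq_trans card_gt0 Vm.
have [vs _] := run_inv J m0.
apply: remaining_unassigned => //; apply: cards0_eq.
have half j : (2 ^ j * #|remaining I (run I m j)| <= #|V|)%N.
  elim: j => [|j IH].
    rewrite mul1n; apply: leq_trans card_clusters.
    exact: subset_leq_card (remaining_sub_clusters _).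
  apply: leq_trans IH; rewrite expnSr -mulnA leq_mul2l; apply/orP; right.
  have [vsj _] := run_inv j m0.
  have := @contraction _ _ _ Iok _ _ vsj m0 (fun v => run_levels_fin j v m0)
            [set: {set V}] [set: {set V}].
  rewrite !finset.setIT; apply=> [C _|p C _ _ _]; last exact: finset.subsetT.
  apply: leq_trans (_ : #|V| <= _)%N; first exact: max_card.
  by apply: leq_trans Vm (ltnW _); apply: ltn_expl.
apply/eqP; have := half J; have : (#|V| < 2 ^ J)%N.
  by apply: leq_ltn_trans VJ _; apply: ltn_expl.
case: #|remaining _ _| => // k; rewrite mulnS => lt le.
by have := leq_trans lt (leq_trans (leq_addr _ _) le); rewrite ltnn.
Qed.

Section Local.
Variables (center : {set V} -> V) (m J : nat) (rho : R).
Hypotheses (m_gt0 : (0 < m)%N) (centerP : forall C, C \in CC -> center C \in C).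
Hypothesis few : forall x : V,
  (#|[set p in P | (dist G x p <= rho%:E)%E]| <= 2 ^ m)%N.
Hypothesis rho_big : forall v,
  (dist_set G v P + ((3 + 16 * m%:R * J%:R) * Delta)%:E <= rho%:E)%E.

(** Passing from a touched vertex to the center takes one more radius, so the center is within
    [H + 2 Delta (8 m + 1)] of [p]. With the bound on [H] after [j] phases, this adds up to the
    coefficient [3 + 16 m (j + 1)], whence the constant in [rho_big]. *)
Lemma touched_near j p C : (j < J)%N ->
    C \in touched I (levels I (run I m j)) (before I (run I m j) m p) p (8 * m) ->
  C \in CC /\ (dist G (center C) p <= rho%:E)%E.
Proof.
move=> jJ Ct; have [vs le] := run_inv j m_gt0.
have Hf v := run_levels_fin j v m_gt0.
have [vsb sub _ _] := partial_inv Iok vs m_gt0 Hf (index p (enum P)).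
have [CCC _] := touched_sub vsb Ct; split => //.
have := reached_close Iok vs Hf vsb sub Ct (centerP CCC).
rewrite inE => /andP[_ cr].
apply: le_trans (dist_portal_levels Iok _ _ vsb) (le_trans cr _).
apply: le_trans (leeD2r _ (le _)) _; apply: le_trans (rho_big (center C)).
rewrite -addeA leeD2l // -EFinD lee_fin.
have : m%:R * (j.+1)%:R * Delta <= m%:R * J%:R * Delta.
  by rewrite ler_wpM2r // ler_wpM2l // ler_nat.
by rewrite -!natr1 natrM -!/Delta; lra.
Qed.

Definition cluster_ball x (t : R) : {set {set V}} :=
  [set C in CC | (dist G x (center C) <= t%:E)%E].

(** Two clusters within reach of the same portal have centers at distance at most [2 rho], so
    [contraction] applies to concentric balls. *)
Lemma local_contraction j x t : (j < J)%N ->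
  (2 * #|remaining I (run I m j.+1) :&: cluster_ball x t| <=
     #|remaining I (run I m j) :&: cluster_ball x (t + 2 * rho)%R|)%N.
Proof.
move=> jJ; have [vs le] := run_inv j m_gt0.
apply: contraction => // [v|C CCC|p C pP]; first exact: run_levels_fin.
  apply: leq_trans (few (center C)); apply: subset_leq_card.
  apply/fintype.subsetP => p; rewrite inE => /andP[pP Ct].
  by rewrite inE pP; have [] := touched_near jJ Ct.
rewrite inE => /andP[_ Cx] /(touched_near jJ)[_ Cp].
apply/fintype.subsetP => C' /(touched_near jJ)[C'CC C'p].
rewrite inE C'CC /=; apply: le_trans (sub_dist_triangle Gok _ _ (center C) _) _.
rewrite EFinD; apply: leeD => //.
apply: le_trans (sub_dist_triangle Gok _ _ p _) _.
by rewrite mulr2n mulrDl !mul1r EFinD; apply: leeD => //; rewrite sub_dist_sym.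
Qed.

Lemma iter_local_contraction j x t : (j <= J)%N ->
  (2 ^ j * #|remaining I (run I m j) :&: cluster_ball x t| <=
     #|cluster_ball x (t + 2 * rho * j%:R)%R|)%N.
Proof.
elim: j t => [|j IH] t jJ.
  by rewrite mul1n mulr0 addr0 subset_leq_card ?finset.subsetIr.
rewrite expnSr -mulnA.
apply: leq_trans (leq_mul (leqnn _) (local_contraction x t jJ)) _.
apply: leq_trans (IH _ (ltnW jJ)) _.
by rewrite -[j.+1]addn1 natrD mulrDr mulr1 addrA addrAC.
Qed.

(** A surviving cluster lies in the ball of radius 0 around its own center; undoing the [J]
    contractions produces [2^J] clusters in the ball of radius [2 rho J], too many. *)
Lemma run_local :
    (forall x, (#|cluster_ball x (2 * rho * J%:R)%R| < 2 ^ J)%N) ->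
  unassigned (run I m J) = finset.set0.
Proof.
move=> small; have [vs _] := run_inv J m_gt0.
apply: remaining_unassigned => //; apply/setP => C; rewrite finset.in_set0.
apply/negP => Crem; have CCC := fintype.subsetP (remaining_sub_clusters _) C Crem.
have := iter_local_contraction (center C) 0 (leqnn J); rewrite add0r.
have : (0 < #|remaining I (run I m J) :&: cluster_ball (center C) 0|)%N.
  apply/card_gt0P; exists C; rewrite finset.in_setI Crem inE CCC.
  by apply: dist_xx; rewrite inE.
case: #|_| => // k _; rewrite mulnS => le.
have := leq_trans (small (center C)) (leq_trans (leq_addr _ _) le).
by rewrite ltnn.
Qed.

End Local.
End Runs.

(** * Choice of the parameters *)

Section ParameterChoice.
Context {R : realType}.
Implicit Types (x d c lam : R) (l k n : nat).

Lemma exists_pow2_ge x : exists n, x <= 2 ^+ n.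
Proof.
by exists (Num.bound x); apply/ltW/upper_nthrootP.
Qed.

Lemma exists_dyadic_scale lam l0 : 2 ^+ l0 <= lam ->
  exists l, [/\ (l0 <= l)%N, 2 ^+ l <= lam & lam < 2 ^+ l.+1].
Proof.
move=> l0lam.
have ex : exists l, lam < 2 ^+ l.+1.
  have [n le] := exists_pow2_ge lam; exists n; apply: le_lt_trans le _.
  by rewrite ltr_eXn2l ?ltr1n.
case: (ex_minnP ex) => l lt minl; exists l; split => //.
  rewrite leqNgt; apply/negP => ll0.
  have := le_lt_trans l0lam lt; rewrite ltr_eXn2l ?ltr1n // ltnS leqNgt.
  by rewrite ll0.
case: l lt minl => [|l] lt minl; last first.
  by rewrite leNgt; apply/negP => /minl; rewrite ltnn.
by apply: le_trans l0lam; rewrite ler_eXn2l ?ltr1n.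
Qed.

(** With [2^l <= lam], this expresses that [lam] dominates a linear function of its logarithm. *)
Lemma linear_le_pow2 a b : exists l0, forall l, (l0 <= l)%N -> (a * (l + b) <= 2 ^ l)%N.
Proof.
exists (a * b.+1 + 4)%N => l ll.
have sq : (l * l <= 2 ^ l)%N.
  have : (4 <= l)%N by lia.
  elim: l {ll} => // l IH; rewrite leq_eqVlt => /orP[/eqP <-//|l4].
  have {}IH := IH l4; rewrite expnS; have : (4 * l <= l * l)%N by rewrite leq_mul2r; apply/orP; right.
  by nia.
apply: leq_trans sq; have : (a * b.+1 * l <= l * l)%N by rewrite leq_mul2r; lia.
by nia.
Qed.

Lemma ln2_gt0 : 0 < ln (2 : R).
Proof. by rewrite ln_gt0 ?ltr1n. Qed.

Lemma log2_le_nat x n : 0 < x -> (log2 x <= n%:R) = (x <= 2 ^+ n).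
Proof.
move=> x0; rewrite /log2 ler_pdivrMr ?ln2_gt0 //.
rewrite -[X in _ = (_ <= X)]lnK ?posrE ?exprn_gt0 //.
by rewrite lnXn // -[X in _ = (X <= _)]lnK ?posrE // ler_expR mulr_natl.
Qed.

(** Integrality of [mu] keeps [log2 d] away from 0: [1 < d] forces [mu >= 3], hence [d > 3/2] by
    [2^3 < 3^2], hence [log2 d >= 1/2]. Rounding errors can then be absorbed into factors; for
    instance [ee < 3 + log2 d <= 7 log2 d]. *)
Lemma dimension_scales (mu : nat) d : (0 < mu)%N -> d = log2 mu%:R -> 1 < d ->
  exists dd ee : nat, [/\ (mu <= 2 ^ dd)%N, [/\ d <= dd%:R, dd%:R <= 2 * d,
    log2 d <= ee%:R & ee%:R <= 7 * log2 d], (dd <= 2 ^ ee)%N, (0 < ee <= dd)%N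
    & 1 / 2 <= log2 d].
Proof.
move=> mu0 dE d1.
have muR : 0 < mu%:R :> R by rewrite ltr0n.
have mu3 : (2 < mu)%N.
  rewrite ltnNge; apply/negP => mu2; move: d1; rewrite dE ltNge => /negP; apply.
  by rewrite (log2_le_nat 1) // expr1 ler_nat.
have d_gt0 : 0 < d by apply: lt_trans d1.
have d32 : 3 / 2 < d.
  rewrite ltNge; apply/negP => d32.
  have : log2 ((mu ^ 2)%:R : R) <= 3%:R.
    by rewrite /log2 natrX lnXn // mulr2n mulrDl -/(log2 _) -dE; lra.
  rewrite log2_le_nat ?ltr0n ?expn_gt0 ?mu0 // -natrX ler_nat leqNgt => /negP; apply.
  by apply: leq_trans (_ : 3 ^ 2 <= _)%N; rewrite // leq_exp2r.
have L12 : 1 / 2 <= log2 d.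
  rewrite leNgt; apply/negP => L12.
  have : log2 (d ^+ 2) <= 1%:R.
    by rewrite /log2 lnXn // mulr2n mulrDl -/(log2 _); lra.
  by rewrite log2_le_nat ?exprn_gt0 // expr1; nra.
pose dd := up_log 2 mu; pose ee := (up_log 2 dd).+1.
have mudd : (mu <= 2 ^ dd)%N by rewrite up_logP.
have ddd : d <= dd%:R by rewrite dE log2_le_nat // -natrX ler_nat.
have dd_gt1 : (1 < dd)%N.
  by rewrite -(ltr_nat R); apply: lt_le_trans d1 _.
have /andP[ltdd _] := up_log_bounds (isT : (1 < 2)%N) (ltn_trans (isT : (1 < 2)%N) mu3).
have dd2 : dd%:R <= 2 * d.
  have : dd.-1%:R < d by rewrite dE ltNge log2_le_nat // -ltNge -natrX ltr_nat.
  have -> : dd = dd.-1.+1 by rewrite prednK // ltnW.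
  by rewrite -natr1 /=; lra.
have /andP[ltee _] := up_log_bounds (isT : (1 < 2)%N) dd_gt1.
have ddee : (dd <= 2 ^ up_log 2 dd)%N by rewrite up_logP.
exists dd, ee; split => //.
- split => //.
    rewrite log2_le_nat // -natrX; apply: le_trans ddd _.
    by rewrite ler_nat (leq_trans ddee) // leq_exp2l.
  have : (up_log 2 dd).-1%:R < log2 (2 * d).
    rewrite ltNge log2_le_nat ?mulr_gt0 // -ltNge -natrX; apply: lt_le_trans dd2.
    by rewrite ltr_nat.
  rewrite [log2 (2 * d)]/log2 lnM ?posrE // mulrDl divff ?gt_eqF ?ln2_gt0 // -/(log2 d).
  have u0 : (0 < up_log 2 dd)%N by rewrite up_log_gt0.
  rewrite /ee -(prednK u0) -natr1 -natr1 /=; move: L12; lra.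
- by rewrite (leq_trans ddee) // leq_exp2l.
- have dd0 : (0 < dd)%N := ltnW dd_gt1.
  rewrite /ee /= -[X in (_ < X)%N](prednK dd0) ltnS; apply: up_log_min => //.
  by have := ltn_expl dd.-1 (isT : (1 < 2)%N); rewrite prednK.
Qed.

(* 28 c^-1 Lambda J / Delta is the ratio of scales in the packing bound for the
   clusters that can influence a given one during J phases. *)
Lemma choose_parameters c : 0 < c -> c < 1 -> exists c1 : nat, 28 / c <= 2 ^+ c1 /\
  exists lam0, forall lam, lam0 <= lam -> exists2 K, 0 < K &
    forall (mu : nat) d, (0 < mu)%N -> d = log2 mu%:R -> 1 < d ->
    exists dd J i1 : nat, [/\ (mu <= 2 ^ dd)%N, (0 < dd)%N, (dd * i1 < J)%N,
      28 / c * (lam * d ^+ 3 * log2 d) * J%:R <= 2 ^+ i1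
      & 3 + 16 * (c1 * dd)%:R * J%:R <= lam * d ^+ 3 * log2 d /\
        3 + 16 * (c1 * dd)%:R * J%:R <= K * (d ^+ 2 * log2 d)].
Proof.
move=> c0 c1lt; have [c1 c1P] := exists_pow2_ge (28 / c).
exists c1; split => //.
have c1_gt0 : (0 < c1)%N.
  rewrite lt0n; apply: contraTneq c1P => ->; rewrite -ltNge expr0.
  by rewrite ltr_pdivlMr // mul1r; lra.
(* [454 = 16 * 28 + 6]: the 28 comes from [dd <= 2 d] squared and [ee <= 7 log2 d], and the 6
   absorbs the summand 3 by means of [1/2 <= d^2 log2 d]. *)
have [k kE] : exists k, k = (454 * c1)%N by exists (454 * c1)%N.
have [l0 l0P] := linear_le_pow2 (k * 4) (c1 + 10).
exists (2 ^+ l0) => lam /exists_dyadic_scale[l [ll0 llam laml]].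
pose x := (l + c1 + 10)%N; pose a := (4 * x)%N.
have lam_big : (k * a)%:R <= lam.
  apply: le_trans llam; rewrite -natrX ler_nat.
  by rewrite /a /x -addnA mulnA; apply: l0P.
have a_gt0 : (0 < a)%N by rewrite /a /x; lia.
exists (k * a)%:R; first by rewrite ltr0n muln_gt0 a_gt0 kE muln_gt0 c1_gt0.
move=> mu d mu0 dE d1.
have [dd [ee [mudd [ddd dd2 Lee ee7] ddee /andP[ee0 eedd] L12]]] :=
  dimension_scales mu0 dE d1.
(* In the exponent of the ratio of scales, [dd^4 ee^2] contributes [6 ee], while [2^(l+1)] and
   [a <= 2^(x+2)] contribute the other 3 of the 9. As [c1 + l + x + 9 = 2 x - 1], the choice
   [a = 4 x] makes [J] exceed [dd i1]. *)
exists dd, (a * dd * ee)%N, ((c1 + l + x + 9) * ee)%N; split => //.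
- by apply: leq_trans eedd.
- have -> : (dd * ((c1 + l + x + 9) * ee) = (c1 + l + x + 9) * (dd * ee))%N by rewrite mulnCA.
  rewrite -mulnA ltn_pmul2r ?muln_gt0 ?(leq_trans ee0) ?ee0 //.
  by rewrite /a /x; clear; lia.
- have aP : (a <= 2 ^ (x + 2))%N.
    by rewrite expnD mulnC leq_mul // ltnW // ltn_expl.
  have nat_bound : (2 ^ c1 * (2 ^ l.+1 * dd ^ 3 * ee) * (a * dd * ee) <=
      2 ^ ((c1 + l + x + 9) * ee))%N.
    have ee2 : (ee <= 2 ^ ee)%N by rewrite ltnW // ltn_expl.
    have d3 : (dd ^ 3 <= 2 ^ (ee * 3))%N by rewrite expnM leq_exp2r.
    apply: leq_trans (leq_mul (leq_mul (leqnn _) (leq_mul (leq_mul (leqnn _) d3) ee2))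
      (leq_mul (leq_mul aP ddee) ee2)) _.
    rewrite -!expnD leq_exp2l //; move: (x) ee0 => y; clear; move=> ee0.
    by have := leq_pmulr (c1 + l + y + 3) ee0; lia.
  rewrite -natrX; move: nat_bound; rewrite -(ler_nat R).
  apply: le_trans; set J := (a * dd * ee)%N.
  have d0 : 0 <= d by apply: ltW; apply: lt_trans d1.
  have L0 : 0 <= log2 d by apply: le_trans L12.
  have lam0' : 0 <= lam by apply: le_trans llam; rewrite exprn_ge0.
  have c_ge0 : 0 <= 28 / c by rewrite divr_ge0 // ltW.
  have d3_ge0 : 0 <= d ^+ 3 by rewrite exprn_ge0.
  have s_ge0 : 0 <= lam * d ^+ 3 by rewrite mulr_ge0.
  have t_ge0 : 0 <= lam * d ^+ 3 * log2 d by rewrite mulr_ge0.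
  rewrite natrM (ler_pM (mulr_ge0 c_ge0 t_ge0)) // natrM natrX (ler_pM c_ge0) //.
  rewrite natrM (ler_pM s_ge0) // natrM !natrX (ler_pM _ d3_ge0) ?(ltW laml) //.
  by rewrite lerXn2r // nnegrE.
have d_ge1 : 1 <= d by apply: ltW.
have main : 3 + 16 * (c1 * dd)%:R * (a * dd * ee)%:R <=
    (k * a)%:R * (d ^+ 2 * log2 d).
  move: (a) a_gt0 => b b_gt0; rewrite kE !natrM; set A := b%:R; set C := c1%:R.
  have C1 : 1 <= C :> R by rewrite ler1n.
  have A1 : 1 <= A :> R by rewrite ler1n.
  have CA : 1 <= C * A by rewrite -[1]mulr1 ler_pM.
  have dsq : 1 <= d ^+ 2 by rewrite exprn_ege1.
  have dd2' : dd%:R ^+ 2 <= 4 * d ^+ 2 :> R.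
    by rewrite (_ : 4 * d ^+ 2 = (2 * d) ^+ 2) ?lerXn2r ?nnegrE //; [lra | ring].
  have dL : 1 / 2 <= d ^+ 2 * log2 d.
    by rewrite -[1 / 2]mul1r ler_pM //; lra.
  have CAdL : 1 / 2 <= C * A * (d ^+ 2 * log2 d) by rewrite -[1 / 2]mul1r ler_pM //; lra.
  have q : dd%:R ^+ 2 * ee%:R <= 4 * d ^+ 2 * (7 * log2 d) :> R by rewrite ler_pM ?exprn_ge0.
  have q2 : C * A * (dd%:R ^+ 2 * ee%:R) <= C * A * (4 * d ^+ 2 * (7 * log2 d)).
    by rewrite ler_wpM2l //; lra.
  have -> : 3 + 16 * (C * dd%:R) * (A * dd%:R * ee%:R) =
     3 + 16 * (C * A * (dd%:R ^+ 2 * ee%:R)) by ring.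
  have -> : 454 * C * A * (d ^+ 2 * log2 d) =
     16 * (C * A * (4 * d ^+ 2 * (7 * log2 d))) + 6 * (C * A * (d ^+ 2 * log2 d)) by ring.
  by lra.
(* The bound by the scale of the net follows from the one by [K], because [K <= lam] and
   [1 <= d]. *)
split => //; apply: le_trans main _; rewrite -[leRHS]mulrA.
apply: ler_pM => //; first by rewrite mulr_ge0 ?exprn_ge0 //; lra.
by rewrite ler_wpM2r ?ler_weXn2l //; lra.
Qed.
End ParameterChoice.

(** * Successful runs on admissible instances *)

Section GoodRuns.
Context {R : realType}.

Lemma admissible_reachable (V : finType) (I : ca_instance R V) c lam d :
  admissible I c lam d -> forall v, dist_set (ca_graph I) v (ca_portals I) \is a fin_num.
Proof.
case=> -[Gok _ _ _] _ _ [net _] _ v; rewrite fin_numElt; apply/andP; split.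
  by apply: lt_le_trans (ltNyr 0) _; apply: dist_set_ge0.
by apply: le_lt_trans (net v) _; rewrite ltry.
Qed.

Lemma ca_solution_le (V : finType) (I : ca_instance R V) b b' f :
  is_ca_solution I b f -> b * ca_diam I <= b' * ca_diam I -> is_ca_solution I b' f.
Proof.
move=> [fP fle] le; split=> // v; apply: le_trans (fle v) _.
by rewrite leeD2l // lee_fin.
Qed.

Lemma good_run (c : R) : 0 < c -> c < 1 ->
  exists lam0, forall lam, lam0 <= lam -> exists2 cs, 0 < cs &
    forall (V : finType) (I : ca_instance R V) d,
      admissible I c lam d -> 0 < ca_diam I ->
      exists m J : nat, [/\ (0 < m <= #|V|)%N, (J <= #|V|)%N,
        unassigned (run I m J) = finset.set0 &
        1 + 16 * m%:R * J%:R <= 4 * cs * ln (4 / c) * (d ^+ 2 * log2 d)].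
Proof.
move=> c0 c1; have [i0 [i0P [lam0 H]]] := choose_parameters c0 c1.
exists lam0 => lam /H{H}[K K0 H].
have ln_gt : 0 < ln (4 / c) by rewrite ln_gt0 // ltr_pdivlMr //; lra.
(* This cancels the factor [4 ln (4 / c)] prescribed in the distortion, which is positive as
   [c < 1]. *)
exists (K / (4 * ln (4 / c))); first by rewrite divr_gt0 // mulr_gt0.
move=> V I d adm Delta_gt0; have reach := admissible_reachable adm.
have [Iok d1 [mu [mu0 doub dE]] [net sep] [cen [cenP censep]]] := adm.
have [Gok _ _ _] := Iok.
have [dd [J1 [i1 [mudd dd0 iJ packJ [le_lam le_K]]]]] := H mu d mu0 dE d1.
set m1 := (i0 * dd)%N in le_lam le_K.
set Lam := lam * d ^+ 3 * log2 d * ca_diam I in net sep.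
have i0_gt0 : (0 < i0)%N.
  rewrite lt0n; apply: contraTneq i0P => ->; rewrite -ltNge expr0.
  by rewrite ltr_pdivlMr // mul1r; lra.
(* The truncation brings the pair into the range searched by the program. Where it takes effect, the
   required cardinality bounds hold because [#|V| < 2 ^ #|V|]. *)
pose m := minn m1 #|V|; pose J := minn J1 #|V|.
have V0 : (0 < #|V|)%N by case: Gok.
have m_gt0 : (0 < m)%N by rewrite leq_min muln_gt0 i0_gt0 dd0.
have mJ : m%:R * J%:R <= m1%:R * J1%:R :> R.
  by rewrite -!natrM ler_nat leq_mul // geq_minl.
have Lam_gt0 : 0 < Lam.
  apply: lt_le_trans (_ : 3 * ca_diam I <= _); first by rewrite mulr_gt0.
  rewrite ler_pM2r //; apply: le_trans le_lam.
  by rewrite lerDl -mulrA mulr_ge0 // -natrM.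
exists m, J; split; first by rewrite m_gt0 geq_minr.
- by rewrite geq_minr.
(* One [Lam] covers the distance to the net, the other the detours of all phases. *)
- apply: (run_local Iok reach (center := cen) (rho := 2 * Lam)) => //.
  + move=> x; have [le|lt] := leqP #|V| m1.
      rewrite /m (minn_idPr le) ltnW //; apply: leq_ltn_trans (ltn_expl _ _) => //.
      exact: max_card.
    rewrite /m (minn_idPl (ltnW lt)).
    apply: leq_trans (_ : mu ^ i0 <= _)%N; last first.
      by rewrite /m1 mulnC expnM leq_exp2r.
    (* Portals are at least [c Lam] apart, more than twice the scale [c Lam / 3], and the radius
       [2 Lam] is [6 / c] times this scale, well below [2^i0]. *)
    apply: (packing (f := id) Gok doub (_ : 0 < c * Lam / 3)) => [||p q].
    * by rewrite divr_gt0 // mulr_gt0.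
    * move=> p; rewrite inE => /andP[_] /le_trans; apply; rewrite lee_fin.
      have : 28 / c * (c * Lam / 3) <= 2 ^+ i0 * (c * Lam / 3).
        by rewrite ler_wpM2r // ltW // divr_gt0 // mulr_gt0.
      apply: le_trans; rewrite (_ : 28 / c * (c * Lam / 3) = 28 / 3 * Lam); last first.
        by field; rewrite gt_eqF.
      by lra.
    * rewrite !inE => /andP[pP _] /andP[qP _] pq; apply: lt_le_trans (sep p q pP qP pq).
      by rewrite lte_fin; have := mulr_gt0 c0 Lam_gt0; lra.
  + move=> v; apply: le_trans (leeD2r _ (net v)) _; rewrite -EFinD lee_fin -/m -/J.
    have : (3 + 16 * m%:R * J%:R) * ca_diam I <= Lam; last by lra.
    by rewrite ler_pM2r //; apply: le_trans le_lam; move: mJ; rewrite -!mulrA; lra.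
  + move=> x; have [le|lt] := leqP #|V| J1.
      rewrite {2}/J (minn_idPr le); apply: leq_ltn_trans (ltn_expl _ _) => //.
      apply: leq_trans (card_clusters Iok); apply: subset_leq_card.
      by apply/fintype.subsetP => C; rewrite inE => /andP[].
    rewrite /J (minn_idPl (ltnW lt)).
    apply: leq_ltn_trans (_ : mu ^ i1 < _)%N; last first.
      apply: leq_ltn_trans (_ : 2 ^ (dd * i1) < _)%N; last by rewrite ltn_exp2l.
      by rewrite expnM; case: (i1) => // k; rewrite leq_exp2r.
    (* The scale is [c Delta / 7] because [1/3 > 2/7]. The radius [2 rho J1 = 4 Lam J1] is
       [28 Lam J1 / (c Delta)] times this scale, which is the origin of the 28. *)
    apply: (packing (f := cen) Gok doub (_ : 0 < c * ca_diam I / 7)) => [||C C'].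
    * by rewrite divr_gt0 // mulr_gt0.
    * move=> C; rewrite inE => /andP[_] /le_trans; apply; rewrite lee_fin.
      have : 28 / c * (lam * d ^+ 3 * log2 d) * J1%:R * (c * ca_diam I / 7) <=
          2 ^+ i1 * (c * ca_diam I / 7).
        by rewrite ler_wpM2r // ltW // divr_gt0 // mulr_gt0.
      apply: le_trans; rewrite /Lam le_eqVlt; apply/orP; left; apply/eqP.
      by field; rewrite gt_eqF.
    * rewrite !inE => /andP[CCC _] /andP[C'C _] CC'.
      apply: lt_le_trans (censep C C' CCC C'C CC').
      by rewrite lte_fin; have := mulr_gt0 c0 Delta_gt0; lra.
- have -> : 4 * (K / (4 * ln (4 / c))) * ln (4 / c) = K.
    by field; rewrite gt_eqF.
  by apply: le_trans le_K; move: mJ; rewrite -!mulrA; lra.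
Qed.

(* The distortion of a run depends on m J only, so that a run can be selected
   without knowing d. *)
Lemma good_run_solution (c : R) : 0 < c -> c < 1 ->
  exists lam0, forall lam, lam0 <= lam -> exists2 cs, 0 < cs &
    forall (V : finType) (I : ca_instance R V) d (x0 : V),
      admissible I c lam d ->
      exists m J : nat, [/\ (0 < m <= #|V|)%N, (J <= #|V|)%N,
        unassigned (run I m J) = finset.set0 &
        forall m' J' : nat, (0 < m')%N -> (m' * J' <= m * J)%N ->
          unassigned (run I m' J') = finset.set0 ->
          is_ca_solution I (4 * cs * ln (4 / c) * (d ^+ 2 * log2 d))
            (solution_of x0 (run I m' J'))].
Proof.
move=> c0 c1; have [lam0 H] := good_run c0 c1; exists lam0 => lam /H{H}[cs cs0 H].
exists cs => // V I d x0 adm; have reach := admissible_reachable adm.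
have [Iok _ _ _ _] := adm; have [Gok _ Delta0 _] := Iok.
(* For [Delta = 0] every additive error vanishes, so any run that assigns all clusters is a
   solution. *)
have [Deltaz|] := eqVneq (ca_diam I) 0.
  exists #|V|, #|V|; split => //; last 1 first.
  - move=> m' J' m'0 _ all; apply: ca_solution_le (run_solution Iok reach x0 m'0 all) _.
    by rewrite Deltaz !mulr0.
  - by rewrite leqnn andbT; case: Gok.
  - exact: run_full.
move=> Deltan.
have [|m [J [mV JV all le]]] := H V I d adm; first by rewrite lt0r Deltan.
exists m, J; split=> // m' J' m'0 mJ' all'.
apply: ca_solution_le (run_solution Iok reach x0 m'0 all') _.
rewrite ler_wpM2r //; apply: le_trans le.
by rewrite lerD2l -!mulrA ler_wpM2l // -!natrM ler_nat.
Qed.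
End GoodRuns.

Local Open Scope nat_scope.

(** * Polynomial-time functions *)

(** Canonical instances let the encoding be inferred from the type. They are chosen to agree with
    the encodings of the statement, so that an input tree is literally the encoding of nested lists
    and pairs. *)
Record encType := EncType { enc_sort :> Type; enc : enc_sort -> tree }.
Arguments enc {e} : rename.
Definition esize (X : encType) (x : X) : nat := tree_size (enc x).

Canonical nat_encType := EncType tree_of_nat.
Canonical bool_encType := EncType tree_of_bool.
Canonical pair_encType (X Y : encType) :=
  EncType (fun p : X * Y => Node (enc p.1) (enc p.2)).
Canonical seq_encType (X : encType) := EncType (tree_of_seq (@enc X)).
Canonical option_encType (X : encType) :=
  EncType (fun o : option X => if o is Some x then Node Leaf (enc x) else Leaf).

Lemma tree_size_gt0 x : 0 < tree_size x. Proof. by case: x. Qed.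

Lemma esize_gt0 (X : encType) (x : X) : 0 < esize x.
Proof. exact: tree_size_gt0. Qed.

Lemma esize_pair (X Y : encType) (x : X) (y : Y) :
  esize (x, y) = (esize x + esize y).+1.
Proof. by []. Qed.

Lemma esize_cons (X : encType) (x : X) (s : seq X) :
  esize (x :: s) = (esize x + esize s).+1.
Proof. by []. Qed.

Lemma size_le_esize (X : encType) (s : seq X) : size s < esize s.
Proof.
by elim: s => // x s IH; rewrite esize_cons /= ltnS (leq_trans IH) ?leq_addl.
Qed.

Lemma esize_seq_le (X : encType) (s : seq X) b :
  (forall x, List.In x s -> esize x <= b) -> esize s <= size s * b.+1 + 1.
Proof.
elim: s => // x s IH H; rewrite esize_cons /=.
have := H x (or_introl erefl); have := IH (fun y ys => H y (or_intror ys)); lia.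
Qed.

Lemma esize_In (X : encType) (s : seq X) x : List.In x s -> esize x < esize s.
Proof.
by elim: s => //= y s IH [->|/IH]; rewrite esize_cons; lia.
Qed.

Lemma esize_nth (X : encType) (x0 : X) (s : seq X) n :
  n < size s -> esize (nth x0 s n) < esize s.
Proof.
elim: s n => // x s IH [|n] /= ns; rewrite esize_cons; first by lia.
by have := IH n ns; lia.
Qed.

Lemma leq_exp_base k m n : m <= n -> m ^ k <= n ^ k.
Proof. by case: k => // k mn; rewrite leq_exp2r. Qed.

(** A single exponent suffices: as the base is at least 2, constants and sums are absorbed by
    raising [k]. *)
Definition poly_bounded (X : encType) (f : X -> nat) : Prop :=
  exists k, forall x, f x <= (esize x + 2) ^ k.

Section PolyBounded.
Context {X : encType}.
Implicit Types f g : X -> nat.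

Lemma pb_le f g : poly_bounded g -> (forall x, f x <= g x) -> poly_bounded f.
Proof. by move=> [k H] fg; exists k => x; apply: leq_trans (fg x) (H x). Qed.

Lemma pb_const n : poly_bounded (fun _ : X => n).
Proof.
exists n => x; apply: ltnW; apply: leq_trans (ltn_expl n (isT : 1 < 2)) _.
by case: n => // n; rewrite leq_exp2r // addnC.
Qed.

Lemma pb_esize : poly_bounded (@esize X).
Proof. by exists 1 => x; rewrite expn1 leq_addr. Qed.

Lemma pb_mul f g : poly_bounded f -> poly_bounded g ->
  poly_bounded (fun x => f x * g x).
Proof.
by move=> [k fk] [l gl]; exists (k + l) => x; rewrite expnD leq_mul.
Qed.

Lemma pb_add f g : poly_bounded f -> poly_bounded g ->
  poly_bounded (fun x => f x + g x).
Proof.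
move=> [k fk] [l gl]; exists (maxn k l).+1 => x.
have e1 : (esize x + 2) ^ k <= (esize x + 2) ^ maxn k l.
  by rewrite leq_pexp2l ?addn2 // leq_maxl.
have e2 : (esize x + 2) ^ l <= (esize x + 2) ^ maxn k l.
  by rewrite leq_pexp2l ?addn2 // leq_maxr.
rewrite expnS; have := fk x; have := gl x.
have : 2 * (esize x + 2) ^ maxn k l <= (esize x + 2) * (esize x + 2) ^ maxn k l.
  by rewrite leq_mul2r leq_addl orbT.
lia.
Qed.

Lemma pb_comp (Y : encType) (f : Y -> nat) (h : X -> Y) :
  poly_bounded f -> poly_bounded (fun x => esize (h x)) ->
  poly_bounded (fun x => f (h x)).
Proof.
move=> [k fk] [l hl]; exists (l.+1 * k) => x; apply: leq_trans (fk _) _.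
case: k fk => [|k] _; first by rewrite muln0 !expn0.
rewrite expnM leq_exp2r // expnS; have := hl x.
have : 0 < (esize x + 2) ^ l by rewrite expn_gt0 addn2.
have : 2 * (esize x + 2) ^ l <= (esize x + 2) * (esize x + 2) ^ l.
  by rewrite leq_mul2r leq_addl orbT.
have := esize_gt0 x; move: ((esize x + 2) ^ l) => e; nia.
Qed.

Lemma pb_exp f n : poly_bounded f -> poly_bounded (fun x => f x ^ n).
Proof.
move=> fb; elim: n => [|n IH]; first exact: pb_const.
by apply: pb_le (pb_mul fb IH) _ => x; rewrite expnS.
Qed.
End PolyBounded.

(* The command c i replaces the content of variable i by its image under f,
   leaving the variables below i untouched and using those above as scratch. *)
Definition polytime (X Y : encType) (f : X -> Y) : Prop :=
  exists (c : nat -> cmd) (t : X -> nat),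
  [/\ poly_bounded t, poly_bounded (fun x => esize (f x)) &
   forall x i s r, s i = enc x -> exists s' t', [/\ exec (c i) s r s' r t',
      t' <= t x, s' i = enc (f x) & forall j, j < i -> s' j = s j]].

Lemma update_same s i a : update s i a i = a.
Proof. by rewrite /update eqxx. Qed.

Lemma update_other s i a j : j != i -> update s i a j = s j.
Proof. by rewrite /update => /negbTE ->. Qed.

Lemma update_lt s i a j : j < i -> update s i a j = s j.
Proof. by move=> ji; rewrite update_other // ltn_eqF. Qed.

Lemma pt_expr (X Y : encType) (f : X -> Y) (e : nat -> expr) :
    poly_bounded (fun x => esize (f x)) ->
    (forall x s i, s i = enc x -> Defs.eval s (e i) = enc (f x)) -> polytime f.
Proof.
move=> fb H; exists (fun i => Assign i (e i)), (fun=> 1); split => //.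
  exact: pb_const.
move=> x i s r si; exists (update s i (Defs.eval s (e i))), 1; split => //.
- exact: exec_assign.
- by rewrite update_same (H x).
- by move=> j ji; rewrite update_lt.
Qed.

Lemma pt_cast (X Y : encType) (f : X -> Y) :
  (forall x, enc (f x) = enc x) -> polytime f.
Proof.
move=> H; apply: (@pt_expr _ _ _ EVar) => [|x s i /= ->]; last by rewrite H.
by apply: pb_le pb_esize _ => x; rewrite /esize H.
Qed.

Lemma pt_id (X : encType) : polytime (fun x : X => x).
Proof. exact: pt_cast. Qed.

Lemma pt_ext (X Y : encType) (f g : X -> Y) :
  f =1 g -> polytime f -> polytime g.
Proof. by move=> fg; have -> : g = f by apply/funext => x; rewrite fg. Qed.

Fixpoint const_expr (x : tree) : expr :=
  if x is Node y z then ENode (const_expr y) (const_expr z) else ELeaf.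

Lemma eval_const s x : Defs.eval s (const_expr x) = x.
Proof. by elim: x => //= y -> z ->. Qed.

Lemma pt_const (X Y : encType) (y : Y) : polytime (fun _ : X => y).
Proof.
apply: (@pt_expr _ _ _ (fun=> const_expr (enc y))) => [|x s i _].
  exact: pb_const.
exact: eval_const.
Qed.

Lemma pt_fst (X Y : encType) : polytime (fun p : X * Y => p.1).
Proof.
apply: (@pt_expr _ _ _ (fun i => EHd (EVar i))) => [|[x y] s i /= ->] //.
by apply: pb_le pb_esize _ => -[x y]; rewrite esize_pair /=; lia.
Qed.

Lemma pt_snd (X Y : encType) : polytime (fun p : X * Y => p.2).
Proof.
apply: (@pt_expr _ _ _ (fun i => ETl (EVar i))) => [|[x y] s i /= ->] //.
by apply: pb_le pb_esize _ => -[x y]; rewrite esize_pair /=; lia.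
Qed.

Lemma pt_size (X Y : encType) (f : X -> Y) :
  polytime f -> poly_bounded (fun x => esize (f x)).
Proof. by case=> c [t []]. Qed.

Lemma pt_comp (X Y Z : encType) (g : Y -> Z) (f : X -> Y) :
  polytime g -> polytime f -> polytime (fun x => g (f x)).
Proof.
move=> [c [t [tb gb gP]]] [c' [t' [tb' fb fP]]].
exists (fun i => Seq (c' i) (c i)), (fun x => t' x + t (f x)); split.
- by apply: pb_add => //; apply: pb_comp.
- exact: (pb_comp gb fb).
move=> x i s r si; have [s1 [t1 [e1 b1 v1 k1]]] := fP x i s r si.
have [s2 [t2 [e2 b2 v2 k2]]] := gP _ i s1 r v1.
exists s2, (t1 + t2); split => //.
- exact: exec_seq e1 e2.
- exact: leq_add.
- by move=> j ji; rewrite k2 // k1.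
Qed.

Lemma pt_pair (X Y Z : encType) (f : X -> Y) (g : X -> Z) :
  polytime f -> polytime g -> polytime (fun x => (f x, g x)).
Proof.
move=> [c [t [tb fb fP]]] [c' [t' [tb' gb gP]]].
exists (fun i => Seq (Assign i.+1 (EVar i)) (Seq (c i.+1)
   (Seq (Assign i.+2 (EVar i)) (Seq (c' i.+2)
      (Assign i (ENode (EVar i.+1) (EVar i.+2))))))),
  (fun x => 1 + (t x + (1 + (t' x + 1)))); split.
- by do !apply: pb_add => //; apply: pb_const.
- by apply: pb_le (pb_add (pb_add fb gb) (pb_const 1)) _ => x; rewrite esize_pair addn1.
move=> x i s r si.
have [|s1 [t1 [e1 b1 v1 k1]]] := fP x i.+1 (update s i.+1 (s i)) r.
  by rewrite update_same.
have s1i : s1 i = enc x by rewrite k1 // update_lt.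
have [|s2 [t2 [e2 b2 v2 k2]]] := gP x i.+2 (update s1 i.+2 (s1 i)) r.
  by rewrite update_same.
exists (update s2 i (Node (s2 i.+1) (s2 i.+2))), (1 + (t1 + (1 + (t2 + 1)))); split.
- apply: exec_seq; first exact: exec_assign.
  apply: exec_seq; first exact: e1.
  apply: exec_seq; first exact: exec_assign.
  apply: exec_seq; first exact: e2.
  exact: exec_assign.
- by rewrite !leq_add.
- by rewrite update_same v2 k2 // update_lt // v1.
- move=> j ji; have ji1 := ltn_trans ji (ltnSn i); have ji2 := ltn_trans ji1 (ltnSn i.+1).
  by rewrite update_lt // k2 // update_lt // k1 // update_lt.
Qed.

Lemma pt_if (X Y : encType) (b : X -> bool) (f g : X -> Y) :
  polytime b -> polytime f -> polytime g ->
  polytime (fun x => if b x then f x else g x).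
Proof.
move=> [c0 [t0 [tb0 bb bP]]] [c [t [tb fb fP]]] [c' [t' [tb' gb gP]]].
exists (fun i => Seq (Assign i.+1 (EVar i)) (Seq (c0 i.+1)
   (If (EVar i.+1) (c i) (c' i)))),
  (fun x => 1 + (t0 x + (t x + t' x + 1))); split.
- by do !apply: pb_add => //; apply: pb_const.
- by apply: pb_le (pb_add fb gb) _ => x; case: ifP => _; rewrite ?leq_addr ?leq_addl.
move=> x i s r si.
have [|s1 [t1 [e1 b1 v1 k1]]] := bP x i.+1 (update s i.+1 (s i)) r.
  by rewrite update_same.
have s1i : s1 i = enc x by rewrite k1 // update_lt.
have low j : j < i -> s1 j = s j.
  by move=> ji; have ji1 := ltn_trans ji (ltnSn i); rewrite k1 // update_lt.
case: (b x) v1 => v1.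
  have [s2 [t2 [e2 b2 v2 k2]]] := fP x i s1 r s1i.
  exists s2, (1 + (t1 + t2.+1)); split => //; last by move=> j ji; rewrite k2 // low.
    apply: exec_seq; first exact: exec_assign.
    apply: exec_seq; first exact: e1.
    by apply: exec_if_true => //=; rewrite v1.
  by lia.
have [s2 [t2 [e2 b2 v2 k2]]] := gP x i s1 r s1i.
exists s2, (1 + (t1 + t2.+1)); split => //; last by move=> j ji; rewrite k2 // low.
  apply: exec_seq; first exact: exec_assign.
  apply: exec_seq; first exact: e1.
  by apply: exec_if_false => //=; rewrite v1.
by lia.
Qed.

Lemma pt_match (X Y Z : encType) (o : X -> option Y) (f : X -> Y -> Z) (g : X -> Z) :
  polytime o -> polytime (fun p : X * Y => f p.1 p.2) -> polytime g ->
  polytime (fun x => if o x is Some y then f x y else g x).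
Proof.
move=> [c0 [t0 [tb0 ob oP]]] [c [t [tb fb fP]]] [c' [t' [tb' gb gP]]].
(* Time and output size of the [Some] branch as a function of [x] alone, to be bounded through the
   size of [o x]. *)
pose d x := if o x is Some y then t (x, y) + esize (f x y) else 0.
have db : poly_bounded d.
  have [k tk] := pb_add tb fb.
  have [l pl] : poly_bounded (fun x => esize x + esize (o x)).
    exact: pb_add pb_esize ob.
  exists (l.+2 * k) => x; rewrite /d; case ox: (o x) => [y|] //.
  apply: leq_trans (tk (x, y)) _; case: k tk => [|k] _; first by rewrite muln0.
  rewrite expnM leq_exp2r // esize_pair /= !expnS.
  have := pl x; rewrite ox /esize /= -/(esize x) -/(esize y).
  have := esize_gt0 x; move: ((esize x + 2) ^ l) (esize x) (esize y) => e u v; nia.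
exists (fun i => Seq (Assign i.+1 (EVar i)) (Seq (c0 i.+1)
   (If (EVar i.+1) (Seq (Assign i (ENode (EVar i) (ETl (EVar i.+1)))) (c i)) (c' i)))),
  (fun x => 1 + (t0 x + (d x + t' x + 2))); split.
- by do !apply: pb_add => //; apply: pb_const.
- apply: pb_le (pb_add db gb) _ => x; rewrite /d.
  by case: (o x) => [y|]; rewrite ?leq_addl // -addnA addnCA leq_addr.
move=> x i s r si.
have [|s1 [t1 [e1 b1 v1 k1]]] := oP x i.+1 (update s i.+1 (s i)) r.
  by rewrite update_same.
have s1i : s1 i = enc x by rewrite k1 // update_lt.
have low j : j < i -> s1 j = s j.
  by move=> ji; have ji1 := ltn_trans ji (ltnSn i); rewrite k1 // update_lt.
rewrite /d; case: (o x) v1 => [y|] v1.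
  have [|s2 [t2 [e2 b2 v2 k2]]] :=
      fP (x, y) i (update s1 i (Node (s1 i) (enc y))) r.
    by rewrite update_same s1i.
  exists s2, (1 + (t1 + (1 + t2).+1)); split => //.
  - apply: exec_seq; first exact: exec_assign.
    apply: exec_seq; first exact: e1.
    apply: exec_if_true => //=; first by rewrite v1.
    apply: exec_seq e2; have -> : enc y = Defs.eval s1 (ETl (EVar i.+1)).
      by rewrite /= v1.
    exact: exec_assign.
  - by move: b1 b2; simpl; lia.
  - by move=> j ji; rewrite k2 // update_lt // low.
have [s2 [t2 [e2 b2 v2 k2]]] := gP x i s1 r s1i.
exists s2, (1 + (t1 + t2.+1)); split => //; last by move=> j ji; rewrite k2 // low.
  apply: exec_seq; first exact: exec_assign.
  apply: exec_seq; first exact: e1.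
  by apply: exec_if_false => //=; rewrite v1.
by lia.
Qed.

Section Fold.
Variables (X A Y : encType) (b : X -> nat).
Variables (step : X -> A -> Y -> A) (a0 : X -> A) (l : X -> seq Y).
Hypotheses (stepP : polytime (fun p : X * (A * Y) => step p.1 p.2.1 p.2.2))
  (a0P : polytime a0) (lP : polytime l) (bb : poly_bounded b)
  (bP : forall x i, esize (foldl (step x) (a0 x) (take i (l x))) <= b x).

(** Iterating a polynomial-time step may square the accumulator each time; the bound [b] on all
    intermediate accumulators excludes this, and proving it is the real work in each application. *)
Lemma pt_foldl : polytime (fun x => foldl (step x) (a0 x) (l x)).
Proof.
have [c [t [tb _ sP]]] := stepP.
have [c0 [t0 [tb0 ab aP]]] := a0P; have [c1 [t1 [tb1 lb llP]]] := lP.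
have [k tk] := tb.
(* The cost of one iteration: the first 4 stands for the two pairing nodes and the 2 in
   [poly_bounded], the second for the loop test and three assignments. *)
pose T x := (esize x + b x + esize (l x) + 4) ^ k + 4.
have Tb : poly_bounded T.
  exact: pb_add (pb_exp k (pb_add (pb_add (pb_add pb_esize bb) lb) (pb_const 4)))
    (pb_const 4).
(* Variable [i] keeps the input, [i.+1] the rest of the list, [i.+2] the accumulator, and [i.+3] the
   argument and result of the step. *)
pose body i := Seq (Assign i.+3 (ENode (EVar i) (ENode (EVar i.+2) (EHd (EVar i.+1)))))
  (Seq (c i.+3) (Seq (Assign i.+2 (EVar i.+3)) (Assign i.+1 (ETl (EVar i.+1))))).
exists (fun i => Seq (Assign i.+1 (EVar i)) (Seq (c1 i.+1)
   (Seq (Assign i.+2 (EVar i)) (Seq (c0 i.+2)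
      (Seq (While (EVar i.+1) (body i)) (Assign i (EVar i.+2))))))),
  (fun x => 1 + (t1 x + (1 + (t0 x + (esize (l x) * T x + 1 + 1))))); split.
- exact: (pb_add (pb_const 1) (pb_add tb1 (pb_add (pb_const 1) (pb_add tb0
    (pb_add (pb_add (pb_mul lb Tb) (pb_const 1)) (pb_const 1)))))).
- apply: pb_le bb _ => x; have := bP x (size (l x)); by rewrite take_size.
move=> x i s r si.
have loop s1 n : n <= size (l x) -> s1 i = enc x ->
    s1 i.+1 = enc (drop n (l x)) -> s1 i.+2 = enc (foldl (step x) (a0 x) (take n (l x))) ->
    exists s2 t2, [/\ exec (While (EVar i.+1) (body i)) s1 r s2 r t2,
      t2 <= (size (l x) - n) * T x + 1,
      s2 i.+2 = enc (foldl (step x) (a0 x) (l x)) &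
      forall j, j <= i -> s2 j = s1 j].
  elim: {n}(size (l x) - n) {-2}n (erefl (size (l x) - n)) s1 => [|m IH] n mE s1 nl v0 v1 v2.
    have nE : n = size (l x) by lia.
    exists s1, 1; split => //.
    - by apply: exec_while_false; rewrite /= v1 nE drop_size.
    - by rewrite addn1.
    - by rewrite v2 nE take_size.
  have nlt : n < size (l x) by lia.
  have [y0] : exists y : Y, True by case: (l x) nlt => // y; exists y.
  move=> _; set y := nth y0 (l x) n; set a := foldl _ _ (take n _) in v2.
  rewrite (drop_nth y0 nlt) -/y in v1.
  set u1 := update s1 i.+3 (Node (s1 i) (Node (s1 i.+2) (enc y))).
  have [|u2 [t2 [e2 b2 w2 k2]]] := sP (x, (a, y)) i.+3 u1 r.
    by rewrite /u1 update_same v0 v2.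
  set u3 := update u2 i.+2 (u2 i.+3).
  set u4 := update u3 i.+1 (enc (drop n.+1 (l x))).
  have u4lt j : j <= i -> u4 j = s1 j.
    by move=> ji; rewrite /u4 update_lt // /u3 update_lt ?k2 ?/u1 ?update_lt //; lia.
  have [|||||s5 [t5 [e5 b5 w5 k5]]] := IH n.+1 _ u4.
  - lia.
  - lia.
  - by rewrite u4lt.
  - by rewrite /u4 update_same.
  - rewrite /u4 update_other ?/u3 ?update_same; last by lia.
    by rewrite w2 (take_nth y0) // foldl_rcons.
  exists s5, ((1 + (t2 + (1 + 1))) + t5).+1; split => //.
  - have h1 : exec (Assign i.+3 (ENode (EVar i) (ENode (EVar i.+2) (EHd (EVar i.+1)))))
        s1 r u1 r 1.
      rewrite /u1; have -> : enc y = Defs.eval s1 (EHd (EVar i.+1)) by rewrite /= v1.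
      exact: exec_assign.
    have h4 : exec (Assign i.+1 (ETl (EVar i.+1))) u3 r u4 r 1.
      rewrite /u4; have -> : enc (drop n.+1 (l x)) = Defs.eval u3 (ETl (EVar i.+1)).
        rewrite /= /u3 update_other; last by lia.
        by rewrite k2 /u1 ?update_other ?v1 //; lia.
      exact: exec_assign.
    apply: exec_while_true (exec_seq h1 (exec_seq e2 (exec_seq _ h4))) e5.
      by rewrite /= v1.
    exact: exec_assign.
  - have tT : t2 + 4 <= T x.
      rewrite leq_add2r; apply: leq_trans b2 (leq_trans (tk _) _).
      apply: leq_exp_base; rewrite !esize_pair.
      have ya : esize y < esize (l x).
        exact: esize_nth.
      have := bP x n; rewrite -/a; lia.
    by rewrite mE mulSn; move: b5; rewrite (_ : size (l x) - n.+1 = m); lia.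
  - by move=> j ji; rewrite k5 // u4lt.
have [|s1 [t2 [e1 b1 v1 k1]]] := llP x i.+1 (update s i.+1 (s i)) r.
  by rewrite update_same.
have s1i : s1 i = enc x by rewrite k1 // update_lt.
have [|s2 [t3 [e2 b2 v2 k2]]] := aP x i.+2 (update s1 i.+2 (s1 i)) r.
  by rewrite update_same.
have s2i j : j < i.+2 -> s2 j = s1 j by move=> ji; rewrite k2 // update_lt.
have [|||s3 [t4 [e3 b3 v3 k3]]] := loop s2 0 isT.
- by rewrite s2i // ltnW.
- by rewrite s2i // v1 drop0.
- by rewrite take0 v2.
exists (update s3 i (s3 i.+2)), (1 + (t2 + (1 + (t3 + (t4 + 1))))); split.
- apply: exec_seq; first exact: exec_assign.
  apply: exec_seq; first exact: e1.
  apply: exec_seq; first exact: exec_assign.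
  apply: exec_seq; first exact: e2.
  apply: exec_seq; first exact: e3.
  exact: exec_assign.
- have : size (l x) * T x <= esize (l x) * T x by rewrite leq_mul2r ltnW ?orbT ?size_le_esize.
  by move: b3; rewrite subn0; lia.
- by rewrite update_same v3.
- move=> j ji; have ji1 := ltn_trans ji (ltnSn i).
  by rewrite update_lt // k3 ?(ltnW ji) // s2i ?(ltn_trans ji1) // k1 // update_lt.
Qed.
End Fold.

Lemma pt_p1 (X Y Z : encType) (f : X -> Y * Z) :
  polytime f -> polytime (fun x => (f x).1).
Proof. exact: pt_comp (pt_fst Y Z). Qed.

Lemma pt_p2 (X Y Z : encType) (f : X -> Y * Z) :
  polytime f -> polytime (fun x => (f x).2).
Proof. exact: pt_comp (pt_snd Y Z). Qed.

Lemma pt_comp2 (X Y Z T : encType) (h : Y -> Z -> T) (f : X -> Y) (g : X -> Z) :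
  polytime (fun p : Y * Z => h p.1 p.2) -> polytime f -> polytime g ->
  polytime (fun x => h (f x) (g x)).
Proof. by move=> H Hf Hg; apply: (pt_comp H (pt_pair Hf Hg)). Qed.

Lemma pt_cons (X Y : encType) (f : X -> Y) (g : X -> seq Y) :
  polytime f -> polytime g -> polytime (fun x => f x :: g x).
Proof. by apply: pt_comp2; apply: pt_cast. Qed.

Lemma pt_some (X Y : encType) (f : X -> Y) :
  polytime f -> polytime (fun x => Some (f x)).
Proof.
move=> H; apply: (pt_comp (g := Some)) H.
apply: (@pt_expr _ _ _ (fun i => ENode ELeaf (EVar i))) => [|x s i /= -> //].
by apply: pb_le (pb_add pb_esize (pb_const 2)) _ => x; rewrite /esize /=; lia.
Qed.

Lemma pt_behead (X Y : encType) (f : X -> seq Y) :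
  polytime f -> polytime (fun x => behead (f x)).
Proof.
move=> H; apply: (pt_comp (g := behead)) H.
apply: (@pt_expr _ _ _ (fun i => ETl (EVar i))) => [|x s i /= ->]; last by case: x.
apply: pb_le pb_esize _ => -[|y s] //=; rewrite esize_cons; lia.
Qed.

Lemma pt_head_bool (X : encType) (f : X -> seq bool) :
  polytime f -> polytime (fun x => head false (f x)).
Proof.
move=> H; apply: (pt_comp (g := head false)) H.
apply: (@pt_expr _ _ _ (fun i => EHd (EVar i))) => [|x s i /= ->]; last by case: x.
apply: pb_le pb_esize _ => -[|y s] //=; rewrite esize_cons; lia.
Qed.

Lemma pt_neg (X : encType) (b : X -> bool) :
  polytime b -> polytime (fun x => ~~ b x).
Proof. by move=> H; apply: (pt_if H (pt_const _ false) (pt_const _ true)). Qed.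

Lemma pt_and (X : encType) (b c : X -> bool) :
  polytime b -> polytime c -> polytime (fun x => b x && c x).
Proof. by move=> Hb Hc; apply: (pt_if Hb Hc (pt_const _ false)). Qed.

Lemma pt_or (X : encType) (b c : X -> bool) :
  polytime b -> polytime c -> polytime (fun x => b x || c x).
Proof. by move=> Hb Hc; apply: (pt_if Hb (pt_const _ true) Hc). Qed.

Lemma pt_addb (X : encType) (b c : X -> bool) :
  polytime b -> polytime c -> polytime (fun x => b x (+) c x).
Proof.
move=> Hb Hc; apply: pt_ext (pt_if Hb (pt_neg Hc) Hc) => x.
by case: (b x); case: (c x).
Qed.

Lemma esize_catrev (X : encType) (s t : seq X) :
  esize (catrev s t) + 1 = esize s + esize t.
Proof.
elim: s t => [|x s IH] t; first by rewrite addnC.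
by rewrite /= IH !esize_cons; lia.
Qed.

Lemma esize_rev (X : encType) (s : seq X) : esize (rev s) = esize s.
Proof.
have /= := esize_catrev s [::]; rewrite -/(rev s).
by have -> : esize ([::] : seq X) = 1 by []; lia.
Qed.

Lemma esize_take (X : encType) (s : seq X) i : esize (take i s) <= esize s.
Proof.
elim: s i => [|x s IH] [|i] //=; rewrite ?esize_cons //.
by have := IH i; lia.
Qed.

Lemma esize_drop (X : encType) (s : seq X) i : esize (drop i s) <= esize s.
Proof. by elim: s i => [|x s IH] [|i] //=; rewrite esize_cons; have := IH i; lia. Qed.

Lemma esize_cat (X : encType) (s t : seq X) : esize (s ++ t) <= esize s + esize t.
Proof. by elim: s => [|x s IH] /=; rewrite ?leq_addl // !esize_cons; lia. Qed.

Lemma esize_rcons (X : encType) (s : seq X) x :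
  esize (rcons s x) = esize s + esize x + 1.
Proof.
elim: s => [|y s IH]; last by rewrite /= !esize_cons IH; lia.
by rewrite /= esize_cons addn1 addnC.
Qed.

Lemma catrev_foldl (T : Type) (s t : seq T) :
  catrev s t = foldl (fun acc y => y :: acc) t s.
Proof. by elim: s t => //= x s IH t. Qed.

Lemma pt_catrev (X Y : encType) (f g : X -> seq Y) :
  polytime f -> polytime g -> polytime (fun x => catrev (f x) (g x)).
Proof.
move=> Hf Hg; apply: (pt_ext (f := fun x => foldl (fun acc y => y :: acc) (g x) (f x))).
  by move=> x; rewrite catrev_foldl.
apply: (pt_foldl (b := fun x => esize (f x) + esize (g x))) => //.
- by apply: pt_cons; [apply: pt_p2 | apply: pt_p1]; apply: pt_p2; apply: pt_id.
- by apply: pb_add; apply: pt_size.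
- move=> x i; rewrite -catrev_foldl.
  by have := esize_catrev (take i (f x)) (g x); have := esize_take (f x) i; lia.
Qed.

Lemma pt_rev (X Y : encType) (f : X -> seq Y) :
  polytime f -> polytime (fun x => rev (f x)).
Proof. by move=> H; apply: pt_catrev H (pt_const _ [::]). Qed.

Lemma pt_cat (X Y : encType) (f g : X -> seq Y) :
  polytime f -> polytime g -> polytime (fun x => f x ++ g x).
Proof.
move=> Hf Hg; apply: (pt_ext (f := fun x => catrev (rev (f x)) (g x))).
  by move=> x; rewrite catrevE revK.
exact: pt_catrev (pt_rev Hf) Hg.
Qed.

Lemma pt_map (X Y Z : encType) (F : X -> Y -> Z) (l : X -> seq Y) :
  polytime (fun p : X * Y => F p.1 p.2) -> polytime l ->
  polytime (fun x => [seq F x y | y <- l x]).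
Proof.
move=> HF Hl.
apply: (pt_ext (f := fun x => rev (foldl (fun acc y => F x y :: acc) [::] (l x)))).
  move=> x /=; rewrite -[RHS]revK; congr rev.
  elim/last_ind: (l x) => // s y IH; by rewrite foldl_rcons IH map_rcons rev_rcons.
apply: pt_rev; have [k Fk] := pt_size HF.
apply: (pt_foldl (b := fun x => esize (l x) * ((esize x + esize (l x) + 3) ^ k).+1 + 1)).
- apply: pt_cons; last by apply: pt_p1; apply: pt_p2; apply: pt_id.
  apply: (pt_comp2 (h := F)) => //; last by apply: pt_p2; apply: pt_p2; apply: pt_id.
  by apply: pt_p1; apply: pt_id.
- exact: pt_const.
- exact: Hl.
- apply: pb_add; last exact: pb_const.
  apply: pb_mul; first exact: pt_size.
  apply: pb_le (pb_add (pb_exp k (pb_add (pb_add pb_esize (pt_size Hl)) (pb_const 3)))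
    (pb_const 1)) _ => x; by rewrite addn1.
move=> x i; have -> : foldl (fun acc y => F x y :: acc) [::] (take i (l x)) =
    rev [seq F x y | y <- take i (l x)].
  elim/last_ind: (take i (l x)) => // s y IH.
  by rewrite foldl_rcons IH map_rcons rev_rcons.
rewrite esize_rev; apply: leq_trans (esize_seq_le (b := (esize x + esize (l x) + 3) ^ k) _) _.
  move=> z /List.in_map_iff[y [<- yl]]; apply: leq_trans (Fk (x, y)) _.
  apply: leq_exp_base; rewrite esize_pair.
  by have := esize_In yl; have := esize_take (l x) i; lia.
rewrite leq_add2r leq_mul2r size_map size_take; apply/orP; right.
by have := size_le_esize (l x); case: ifP; lia.
Qed.

Lemma pt_foldl_bool (X Y : encType) (step : X -> bool -> Y -> bool) (b : X -> bool)
    (l : X -> seq Y) :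
  polytime (fun p : X * (bool * Y) => step p.1 p.2.1 p.2.2) -> polytime b ->
  polytime l -> polytime (fun x => foldl (step x) (b x) (l x)).
Proof.
move=> Hs Hb Hl; apply: (pt_foldl (b := fun=> 3)) => //; first exact: pb_const.
by move=> x i; case: foldl.
Qed.

Lemma pt_has (X Y : encType) (a : X -> Y -> bool) (l : X -> seq Y) :
  polytime (fun p : X * Y => a p.1 p.2) -> polytime l ->
  polytime (fun x => has (a x) (l x)).
Proof.
move=> Ha Hl; apply: (pt_ext (f := fun x => foldl (fun b y => b || a x y) false (l x))).
  move=> x; rewrite -[RHS]orFb; elim: (l x) false => [|y s IH] b /=; first by rewrite orbF.
  by rewrite IH orbA.
apply: pt_foldl_bool => //; last exact: pt_const.
apply: pt_or; first by apply: pt_p1; apply: pt_p2; apply: pt_id.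
apply: (pt_comp2 (h := a)) => //; last by apply: pt_p2; apply: pt_p2; apply: pt_id.
by apply: pt_p1; apply: pt_id.
Qed.

Lemma pt_all (X Y : encType) (a : X -> Y -> bool) (l : X -> seq Y) :
  polytime (fun p : X * Y => a p.1 p.2) -> polytime l ->
  polytime (fun x => all (a x) (l x)).
Proof.
move=> Ha Hl; apply: (pt_ext (f := fun x => ~~ has (fun y => ~~ a x y) (l x))).
  by move=> x; rewrite -all_predC; apply: eq_all => y /=; rewrite negbK.
by apply: pt_neg; apply: pt_has => //; apply: pt_neg.
Qed.

Lemma pt_filter (X Y : encType) (a : X -> Y -> bool) (l : X -> seq Y) :
  polytime (fun p : X * Y => a p.1 p.2) -> polytime l ->
  polytime (fun x => seq.filter (a x) (l x)).
Proof.
move=> Ha Hl.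
have E x s : foldl (fun acc y => if a x y then y :: acc else acc) [::] s =
    rev (seq.filter (a x) s).
  elim/last_ind: s => // s y IH; rewrite foldl_rcons IH filter_rcons.
  by case: ifP => //; rewrite rev_rcons.
apply: (pt_ext (f := fun x => rev (foldl
    (fun acc y => if a x y then y :: acc else acc) [::] (l x)))).
  by move=> x /=; rewrite E revK.
apply: pt_rev; apply: (pt_foldl (b := fun x => esize (l x))) => //.
- have acc : polytime (fun p : X * (seq Y * Y) => p.2.1).
    by apply: pt_p1; apply: pt_p2; apply: pt_id.
  have y : polytime (fun p : X * (seq Y * Y) => p.2.2).
    by apply: pt_p2; apply: pt_p2; apply: pt_id.
  apply: pt_if => //; last exact: pt_cons.
  by apply: (pt_comp2 (h := a)) => //; apply: pt_p1; apply: pt_id.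
- exact: pt_const.
- exact: pt_size.
- move=> x i; rewrite E esize_rev; apply: leq_trans (esize_take (l x) i).
  elim: (take i (l x)) => //= y s IH; case: ifP => _; rewrite !esize_cons; lia.
Qed.

Ltac pt_proj := by do ?[apply: pt_p1 | apply: pt_p2]; exact: pt_id.

(** * Binary arithmetic *)

Definition nat_of_bits (s : seq bool) : nat := foldr (fun (b : bool) n => b + n.*2) 0 s.

Fixpoint low_bits (p : BinNums.positive) : seq bool :=
  match p with
  | BinNums.xH => [::]
  | BinNums.xO q => false :: low_bits q
  | BinNums.xI q => true :: low_bits q
  end.

(** The bits below the leading one, least significant first. In this form a number has exactly the
    tree of its binary encoding, so conversions in either direction are casts. *)
Definition obits (n : nat) : option (seq bool) :=
  if bin_of_nat n is BinNums.Npos p then Some (low_bits p) else None.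

Definition nat_of_obits (o : option (seq bool)) : nat :=
  if o is Some s then nat_of_bits (rcons s true) else 0.

Lemma enc_obits n : enc (obits n) = enc n.
Proof.
rewrite /= /tree_of_nat /obits; case: bin_of_nat => //= p; congr Node.
by elim: p => //= p ->.
Qed.

Lemma obitsK n : nat_of_obits (obits n) = n.
Proof.
rewrite -[RHS]bin_of_natK /obits /nat_of_obits; case: bin_of_nat => //= p.
rewrite /nat_of_bits; elim: p => //= p ->; rewrite ?NatTrec.doubleE //=; lia.
Qed.

Lemma nat_of_obitsK o : obits (nat_of_obits o) = o.
Proof.
have [b <-] : exists b, (if b is BinNums.Npos p then Some (low_bits p) else None) = o.
  case: o => [s|]; last by exists BinNums.N0.
  have [p <-] : exists p, low_bits p = s.
    elim: s => [|b s [p <-]]; first by exists BinNums.xH.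
    by case: b; [exists (BinNums.xI p) | exists (BinNums.xO p)].
  by exists (BinNums.Npos p).
rewrite /obits; suff -> : bin_of_nat (nat_of_obits
  (if b is BinNums.Npos p then Some (low_bits p) else None)) = b by [].
rewrite -[RHS]nat_of_binK; congr bin_of_nat; case: b => //= p.
rewrite /nat_of_bits; elim: p => //= p ->; rewrite ?NatTrec.doubleE //=; lia.
Qed.

Lemma enc_nat_of_obits o : enc (nat_of_obits o) = enc o.
Proof. by rewrite -enc_obits nat_of_obitsK. Qed.

Definition bits (n : nat) : seq bool :=
  if obits n is Some s then rcons s true else [::].

Lemma bitsK n : nat_of_bits (bits n) = n.
Proof. by rewrite -[RHS]obitsK /bits /nat_of_obits; case: obits. Qed.

Lemma nat_of_bits_lt s : nat_of_bits s < 2 ^ size s.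
Proof. by elim: s => //= b s IH; rewrite expnS; case: b => /=; lia. Qed.

Lemma size_bits_le n k : (size (bits n) <= k) = (n < 2 ^ k).
Proof.
apply/idP/idP => [nk|].
  by rewrite -{1}(bitsK n) (leq_trans (nat_of_bits_lt _)) // leq_exp2l.
apply: contraTT; rewrite -!ltnNge ltnS -{2}(bitsK n) /bits; case: obits => [s|] //.
rewrite size_rcons ltnS => ks; apply: leq_trans (_ : 2 ^ size s <= _).
  by rewrite leq_exp2l.
rewrite /nat_of_bits; elim: s {ks} => //= b s IH; rewrite expnS.
by move: IH; case: b; lia.
Qed.

Lemma esize_bits_bound (s : seq bool) : esize s <= 4 * size s + 1.
Proof.
elim: s => // b s IH; rewrite esize_cons /=.
by have : esize b <= 3 by [case: b]; lia.
Qed.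

Lemma esize_nat_le n : esize n <= 4 * size (bits n) + 1.
Proof.
have -> : esize n = esize (obits n) by rewrite /esize enc_obits.
rewrite /bits; case: obits => // s; rewrite size_rcons.
have := esize_bits_bound s.
by rewrite [esize (Some s)](_ : _ = (esize s).+2) //; lia.
Qed.

Lemma size_bits_esize n : size (bits n) <= esize n.
Proof.
have -> : esize n = esize (obits n) by rewrite /esize enc_obits.
rewrite /bits; case: obits => // s; rewrite size_rcons.
apply: leq_trans (size_le_esize (s : seq bool)) _.
by rewrite [esize (Some s)](_ : _ = (esize s).+2) //; lia.
Qed.

Lemma lt_exp_bits n : n < 2 ^ size (bits n).
Proof. by rewrite -size_bits_le. Qed.

Lemma size_bits_add m n :
  size (bits (m + n)) <= (maxn (size (bits m)) (size (bits n))).+1.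
Proof.
rewrite size_bits_le expnS mul2n -addnn -addSn; apply: leq_add.
  by apply: leq_trans (lt_exp_bits m) _; rewrite leq_exp2l // leq_maxl.
by apply: ltnW; apply: leq_trans (lt_exp_bits n) _; rewrite leq_exp2l // leq_maxr.
Qed.

Lemma size_bits_mul m n : size (bits (m * n)) <= size (bits m) + size (bits n).
Proof.
rewrite size_bits_le expnD.
have := lt_exp_bits m; have := lt_exp_bits n.
move: (2 ^ _) (2 ^ _) => a b; nia.
Qed.

Lemma pt_bits (X : encType) (f : X -> nat) : polytime f -> polytime (fun x => bits (f x)).
Proof.
move=> H.
apply: (pt_ext (f := fun x => if obits (f x) is Some s then rev (true :: rev s) else [::])).
  by move=> x; rewrite /bits; case: obits => // s; rewrite rev_cons revK.
apply: (pt_match (f := fun _ s => rev (true :: rev s))); last exact: pt_const.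
  by apply: (pt_comp (g := obits)) => //; apply: pt_cast => n; rewrite enc_obits.
apply: pt_rev; apply: pt_cons; first exact: pt_const.
by apply: pt_rev; pt_proj.
Qed.

(* from the most significant bit, possibly with leading zeros *)
Definition nat_of_msb (s : seq bool) : nat := nat_of_obits
  (foldl (fun o b => if o is Some t then Some (b :: t) else if b then Some [::] else None)
     None s).

Lemma nat_of_msbE s : nat_of_msb s = nat_of_bits (rev s).
Proof.
rewrite /nat_of_msb; elim/last_ind: s => // s b IH.
rewrite foldl_rcons rev_rcons /= -IH; case: foldl => [t|] /=; first by case: b.
by case: b.
Qed.

Lemma pt_nat_of_msb (X : encType) (f : X -> seq bool) :
  polytime f -> polytime (fun x => nat_of_msb (f x)).
Proof.
move=> H; apply: (pt_comp (g := nat_of_obits)).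
  by apply: pt_cast => o; rewrite enc_nat_of_obits.
apply: (pt_foldl (b := fun x => esize (f x) + 3)) => //.
- apply: (pt_match (o := fun p : X * (option (seq bool) * bool) => p.2.1)
      (f := fun p t => Some (p.2.2 :: t))).
  + by pt_proj.
  + by apply: pt_some; apply: pt_cons; pt_proj.
  + apply: pt_if; [by pt_proj | exact: pt_const | exact: pt_const].
- exact: pt_const.
- by apply: pb_add; [apply: pt_size | apply: pb_const].
move=> x i; apply: leq_trans (_ : esize (take i (f x)) + 3 <= _); last first.
  by rewrite leq_add2r esize_take.
elim/last_ind: (take i (f x)) => // s b IH; rewrite foldl_rcons.
rewrite esize_rcons.
case: foldl IH => [t|] IH; last by case: b; rewrite /esize /=; lia.
move: IH; rewrite [esize (Some t)](_ : _ = (esize t).+2) //.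
rewrite [esize (Some (b :: t))](_ : _ = (esize (b :: t)).+2) // esize_cons; lia.
Qed.

Lemma nat_of_bits_split s : nat_of_bits s = head false s + (nat_of_bits (behead s)).*2.
Proof. by case: s. Qed.

Lemma nat_of_bits_rcons s b : nat_of_bits (rcons s b) = nat_of_bits s + 2 ^ size s * b.
Proof.
elim: s => [|c s IH] /=; first by case: b.
rewrite -/(nat_of_bits _) IH expnS -/(nat_of_bits _).
by case: b {IH}; case: c; lia.
Qed.

Lemma behead_dropS (T : Type) n (s : seq T) : behead (drop n s) = drop n.+1 s.
Proof. by elim: s n => [|x s IH] [|n] //=; rewrite ?drop0 // IH. Qed.

(* carry, remaining digits of the two summands, and digits of the sum in reverse *)
Definition adder_state := (bool * (seq bool * (seq bool * seq bool)))%type.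

Definition adder_step (st : adder_state) : adder_state :=
  let a := head false st.2.1 in let b := head false st.2.2.1 in
  (a && b || st.1 && (a || b),
   (behead st.2.1, (behead st.2.2.1, (a (+) b (+) st.1) :: st.2.2.2))).

(** The list [l] serves as a clock: only its length matters. *)
Definition adder (s t : seq bool) (l : seq bool) : adder_state :=
  foldl (fun st _ => adder_step st) (false, (s, (t, [::]))) l.

Lemma adder_inv s t l : let st := adder s t l in
  [/\ st.2.1 = drop (size l) s, st.2.2.1 = drop (size l) t, size st.2.2.2 = size l &
   nat_of_bits (rev st.2.2.2) +
     2 ^ size l * (st.1 + nat_of_bits st.2.1 + nat_of_bits st.2.2.1) =
   nat_of_bits s + nat_of_bits t].
Proof.
elim/last_ind: l => [|l x IH] /=; first by rewrite !drop0; split => //; rewrite mul1n.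
rewrite /adder foldl_rcons -/(adder s t l) size_rcons.
case: (adder s t l) IH => c [r1 [r2 out]] /= [e1 e2 e3 e4]; split.
- by rewrite e1 behead_dropS.
- by rewrite e2 behead_dropS.
- by rewrite e3.
rewrite -e4 rev_cons nat_of_bits_rcons size_rev e3 -addnA; congr (_ + _).
rewrite expnS [2 * _]mulnC -mulnA -mulnDr; congr (_ * _).
rewrite (nat_of_bits_split r1) (nat_of_bits_split r2).
by case: (head false r1); case: (head false r2); case: c {e4} => /=; lia.
Qed.

(** After as many ticks as there are digits in [s ++ t], both summands are exhausted; the additional
    tick flushes the carry. *)
Lemma adderP s t x : nat_of_msb (adder s t (rcons (s ++ t) x)).2.2.2 =
  nat_of_bits s + nat_of_bits t.
Proof.
rewrite nat_of_msbE; have [e1 e2 _ <-] := adder_inv s t (rcons (s ++ t) x).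
rewrite e1 e2 !drop_oversize ?size_rcons ?size_cat; [|lia|lia].
rewrite /= addn0 addn0; suff -> : (adder s t (rcons (s ++ t) x)).1 = false.
  by rewrite muln0 addn0.
rewrite /adder foldl_rcons -/(adder s t (s ++ t)) /=.
have [-> -> _ _] := adder_inv s t (s ++ t).
by rewrite !drop_oversize ?size_cat ?leq_addr ?leq_addl //= andbF.
Qed.

Ltac pt_bool := repeat first
  [ exact: pt_const | apply: pt_and | apply: pt_or | apply: pt_addb | apply: pt_neg
  | apply: pt_head_bool | apply: pt_behead | apply: pt_pair | apply: pt_cons
  | pt_proj ].

Lemma pt_add (X : encType) (f g : X -> nat) :
  polytime f -> polytime g -> polytime (fun x => f x + g x).
Proof.
apply: (pt_comp2 (h := addn)).
pose s (p : nat * nat) := bits p.1; pose t (p : nat * nat) := bits p.2.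
have ps : polytime s by apply: pt_bits; pt_proj.
have pt : polytime t by apply: pt_bits; pt_proj.
apply: (pt_ext (f := fun p => nat_of_msb
    (adder (s p) (t p) (s p ++ (t p ++ [:: true]))).2.2.2)).
  by move=> p; rewrite catA cats1 adderP !bitsK.
apply: pt_nat_of_msb; do 3!apply: pt_p2.
have pcl : polytime (fun p => s p ++ (t p ++ [:: true])).
  by apply: pt_cat => //; apply: pt_cat => //; apply: pt_const.
apply: (pt_foldl (X := pair_encType nat_encType nat_encType)
  (A := pair_encType bool_encType (pair_encType (seq_encType bool_encType)
     (pair_encType (seq_encType bool_encType) (seq_encType bool_encType))))
  (step := fun _ st _ => adder_step st)
  (b := fun p => esize (s p) + esize (t p) + 4 * esize (s p ++ (t p ++ [:: true])) + 7)) => //.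
- by rewrite /adder_step; pt_bool.
- by apply: pt_pair; [exact: pt_const | do !apply: pt_pair => //; exact: pt_const].
- apply: pb_add; last exact: pb_const.
  apply: pb_add; first by apply: pb_add; apply: pt_size.
  by apply: pb_mul; [apply: pb_const | apply: pt_size].
move=> p i; set l := take i _; have := adder_inv (s p) (t p) l.
rewrite -/(adder (s p) (t p) l); case: (adder _ _ l) => c [r1 [r2 out]] /= [e1 e2 e3 _].
rewrite !esize_pair e1 e2.
have := esize_drop (s p) (size l); have := esize_drop (t p) (size l).
have := esize_bits_bound out; rewrite e3.
have lsz : size l <= esize (s p ++ t p ++ [:: true]).
  by rewrite ltnW // (leq_trans _ (esize_take _ i)) // size_le_esize.
have arith (c' o t' t0 s' s0 n S : nat) : o <= 4 * n + 1 -> t' <= t0 -> s' <= s0 ->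
    n <= S -> c' <= 3 -> c' + (s' + (t' + o).+1).+1 < s0 + t0 + 4 * S + 7 by lia.
by move=> h1 h2 h3; apply: arith h1 h2 h3 lsz _; case: c.
Qed.

(** Digits come least significant first, so a later difference overrides the verdict so far; the
    initial verdict decides the case of equality. *)
Definition comparator_step (st : bool * (seq bool * seq bool)) :=
  let a := head false st.2.1 in let b := head false st.2.2 in
  (if a (+) b then b else st.1, (behead st.2.1, behead st.2.2)).

Lemma comparatorP (l : seq bool) c s t : size s <= size l -> size t <= size l ->
  (foldl (fun st (_ : bool) => comparator_step st) (c, (s, t)) l).1 =
    (nat_of_bits s < nat_of_bits t) || (nat_of_bits s == nat_of_bits t) && c.
Proof.
elim: l c s t => [|x l IH] c s t.
  by rewrite !leqn0 => /nilP -> /nilP ->.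
move=> sl tl; rewrite /= IH ?size_behead; [|by move: sl => /=; lia|by move: tl => /=; lia].
rewrite (nat_of_bits_split s) (nat_of_bits_split t).
move: (nat_of_bits _) (nat_of_bits _) => u v.
by case: (head false s); case: (head false t); case: c => /=; lia.
Qed.

Lemma comparator_rest (l : seq bool) c s t :
  (foldl (fun st (_ : bool) => comparator_step st) (c, (s, t)) l).2 =
    (drop (size l) s, drop (size l) t).
Proof.
elim/last_ind: l => [|l x IH]; first by rewrite !drop0.
rewrite foldl_rcons size_rcons -!behead_dropS; move: IH.
by case: foldl => c' [u v] /= [-> ->].
Qed.

Lemma pt_leq (X : encType) (f g : X -> nat) :
  polytime f -> polytime g -> polytime (fun x => f x <= g x).
Proof.
apply: (pt_comp2 (h := leq)).
pose s (p : nat * nat) := bits p.1; pose t (p : nat * nat) := bits p.2.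
have ps : polytime s by apply: pt_bits; pt_proj.
have pt : polytime t by apply: pt_bits; pt_proj.
apply: (pt_ext (f := fun p =>
    (foldl (fun st (_ : bool) => comparator_step st) (true, (s p, t p)) (s p ++ t p)).1)).
  move=> p; rewrite comparatorP ?size_cat ?leq_addr ?leq_addl // !bitsK andbT.
  by rewrite orbC -leq_eqVlt.
apply: pt_p1.
apply: (pt_foldl (X := pair_encType nat_encType nat_encType)
  (A := pair_encType bool_encType (pair_encType (seq_encType bool_encType)
     (seq_encType bool_encType)))
  (step := fun _ st _ => comparator_step st)
  (b := fun p => esize (s p) + esize (t p) + 5)).
- rewrite /comparator_step; apply: pt_pair; last by pt_bool.
  by apply: pt_if; pt_bool.
- by apply: pt_pair; [exact: pt_const | apply: pt_pair].
- by apply: pt_cat.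
- by apply: pb_add; [apply: pb_add; apply: pt_size | apply: pb_const].
move=> p i; set l := take i _; have := comparator_rest l true (s p) (t p).
case: foldl => cm r /= ->.
rewrite !esize_pair.
have arith (c' t' t0 s' s0 : nat) : t' <= t0 -> s' <= s0 ->
    c' <= 3 -> (c' + (s' + t').+1).+1 <= s0 + t0 + 5 by lia.
by apply: arith (esize_drop _ _) (esize_drop _ _) _; case: (cm).
Qed.

Lemma pt_eqn (X : encType) (f g : X -> nat) :
  polytime f -> polytime g -> polytime (fun x => f x == g x).
Proof.
move=> Hf Hg; apply: pt_ext (pt_and (pt_leq Hf Hg) (pt_leq Hg Hf)) => x.
by rewrite eqn_leq.
Qed.

Lemma pt_succ (X : encType) (f : X -> nat) :
  polytime f -> polytime (fun x => (f x).+1).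
Proof.
by move=> H; apply: pt_ext (pt_add H (pt_const _ 1)) => x; rewrite addn1.
Qed.

Lemma pt_ltn (X : encType) (f g : X -> nat) :
  polytime f -> polytime g -> polytime (fun x => f x < g x).
Proof. by move=> Hf Hg; apply: pt_leq (pt_succ Hf) Hg. Qed.

Lemma horner_bits n (s : seq bool) :
  foldl (fun acc (b : bool) => acc + acc + (if b then n else 0)) 0 s =
    nat_of_bits (rev s) * n.
Proof.
elim/last_ind: s => // s b IH; rewrite foldl_rcons IH rev_rcons /=.
by rewrite -/(nat_of_bits _); case: b; lia.
Qed.

Lemma pt_mul (X : encType) (f g : X -> nat) :
  polytime f -> polytime g -> polytime (fun x => f x * g x).
Proof.
apply: (pt_comp2 (h := muln)).
apply: (pt_ext (f := fun p : nat * nat => foldl (fun acc (b : bool) =>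
    acc + acc + (if b then p.2 else 0)) 0 (rev (bits p.1)))).
  by move=> p; rewrite horner_bits revK bitsK.
apply: (pt_foldl (X := pair_encType nat_encType nat_encType) (A := nat_encType)
  (b := fun p => 4 * (esize p.1 + esize p.2) + 1)).
- apply: pt_add; first by apply: pt_add; pt_proj.
  by apply: pt_if; [pt_proj | pt_proj | exact: pt_const].
- exact: pt_const.
- by apply: pt_rev; apply: pt_bits; pt_proj.
- apply: pb_add; last exact: pb_const.
  by apply: pb_mul; [exact: pb_const|]; apply: pb_add; apply: pt_size; pt_proj.
move=> p i; rewrite horner_bits; set l := take _ _.
apply: leq_trans (esize_nat_le _) _; rewrite leq_add2r leq_mul2l /=.
apply: leq_trans (size_bits_mul _ _) _; apply: leq_add; last exact: size_bits_esize.
rewrite size_bits_le; apply: leq_trans (nat_of_bits_lt _) _.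
rewrite leq_exp2l // size_rev /l size_take size_rev.
by case: ifP => [/ltnW/leq_trans|_]; [apply|]; apply: size_bits_esize.
Qed.

Lemma foldl_size (T : Type) (s : seq T) n : foldl (fun n _ => n.+1) n s = n + size s.
Proof. by elim: s n => [|x s IH] n /=; rewrite ?addn0 // IH addSnnS. Qed.

Lemma size_bits_id n : size (bits n) <= n.
Proof. by rewrite size_bits_le ltn_expl. Qed.

Lemma pt_size_seq (X Y : encType) (l : X -> seq Y) :
  polytime l -> polytime (fun x => size (l x)).
Proof.
move=> H; apply: (pt_ext (f := fun x => foldl (fun n _ => n.+1) 0 (l x))).
  by move=> x; rewrite foldl_size.
apply: (pt_foldl (A := nat_encType) (b := fun x => 4 * esize (l x) + 1)) => //.
- by apply: pt_succ; pt_proj.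
- exact: pt_const.
- apply: pb_add; last exact: pb_const.
  by apply: pb_mul; [exact: pb_const | apply: pt_size].
move=> x i; rewrite foldl_size; apply: leq_trans (esize_nat_le _) _.
rewrite leq_add2r leq_mul2l /=; apply: leq_trans (size_bits_id _) _.
by rewrite ltnW // (leq_trans _ (esize_take _ i)) // size_le_esize.
Qed.

Lemma pt_count (X Y : encType) (a : X -> Y -> bool) (l : X -> seq Y) :
  polytime (fun p : X * Y => a p.1 p.2) -> polytime l ->
  polytime (fun x => count (a x) (l x)).
Proof.
move=> Ha Hl; apply: pt_ext (pt_size_seq (pt_filter Ha Hl)) => x.
by rewrite size_filter.
Qed.

Lemma nth_foldl (T : Type) (x0 : T) s i n d :
  (foldl (fun st y => (st.1.+1, if st.1 == i then y else st.2)) (n, d) s) =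
    (n + size s, if n <= i < n + size s then nth x0 s (i - n) else d).
Proof.
elim: s n d => [|x s IH] n d /=.
  by rewrite addn0; case: ifP => // h; exfalso; lia.
rewrite IH addSnnS; congr pair; case: (ltngtP n i) => [lt|gt|<-] //=.
- by rewrite -(subnSK lt).
- by rewrite subnn ifT //; lia.
Qed.

Lemma pt_nth (X Y : encType) (x0 : Y) (l : X -> seq Y) (i : X -> nat) :
  polytime l -> polytime i -> polytime (fun x => nth x0 (l x) (i x)).
Proof.
apply: (pt_comp2 (h := nth x0)).
apply: (pt_ext (f := fun p : seq Y * nat => (foldl (fun st y =>
    (st.1.+1, if st.1 == p.2 then y else st.2)) (0, x0) p.1).2)).
  move=> [s j] /=; rewrite (nth_foldl x0) /= subn0 add0n.
  by case: ltnP => // sj; rewrite nth_default.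
apply: pt_p2; apply: (pt_foldl (X := pair_encType (seq_encType Y) nat_encType)
  (A := pair_encType nat_encType Y)
  (step := fun p st y => (st.1.+1, if st.1 == p.2 then y else st.2))
  (b := fun p => 5 * esize p.1 + esize x0 + 2)).
- apply: pt_pair; first by apply: pt_succ; pt_proj.
  apply: pt_if; [apply: pt_eqn| |]; pt_proj.
- exact: pt_const.
- pt_proj.
- apply: pb_add; last exact: pb_const.
  apply: pb_add; last exact: pb_const.
  by apply: pb_mul; [exact: pb_const | apply: pt_size; pt_proj].
move=> [s j] k; rewrite (nth_foldl x0) esize_pair /= add0n subn0.
have szk : size (take k s) <= esize s.
  by rewrite ltnW // (leq_trans _ (esize_take s k)) // size_le_esize.
have := esize_nat_le (size (take k s)); have := size_bits_id (size (take k s)).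
case: ifP => [jk|_]; last by lia.
by have := esize_nth x0 jk; have := esize_take s k; lia.
Qed.

Lemma In_mem (T : eqType) (x : T) s : List.In x s -> x \in s.
Proof.
by elim: s => //= y s IH [->|/IH]; rewrite inE ?eqxx // => ->; rewrite orbT.
Qed.

Lemma iota_foldl (T : Type) (s : seq T) :
  foldl (fun st _ => (st.1.+1, st.1 :: st.2)) (0, [::]) s = (size s, rev (iota 0 (size s))).
Proof.
elim/last_ind: s => // s x IH; rewrite foldl_rcons IH size_rcons.
by congr pair; rewrite -[(size s).+1]addn1 iotaD rev_cat.
Qed.

(** The range is bounded by the length of a list, not by a number: numbers are binary, so [iota 0 n]
    is exponentially larger than [n]. The loops of the program therefore run over lists derived from
    the vertices and test their actual bound inside. *)
Lemma pt_iota (X Y : encType) (l : X -> seq Y) :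
  polytime l -> polytime (fun x => iota 0 (size (l x))).
Proof.
move=> H; apply: (pt_ext (f := fun x => rev
    (foldl (fun st _ => (st.1.+1, st.1 :: st.2)) (0, [::]) (l x)).2)).
  by move=> x; rewrite iota_foldl revK.
apply: pt_rev; apply: pt_p2; apply: (pt_foldl
  (A := pair_encType nat_encType (seq_encType nat_encType))
  (step := fun _ st _ => (st.1.+1, st.1 :: st.2))
  (b := fun x => (esize (l x)).+1 * (4 * esize (l x) + 2) + 2)) => //.
- apply: pt_pair; first by apply: pt_succ; pt_proj.
  by apply: pt_cons; pt_proj.
- exact: pt_const.
- apply: pb_add; last exact: pb_const.
  apply: pb_mul.
    by apply: pb_le (pb_add (pt_size H) (pb_const 1)) _ => x; rewrite addn1.
  apply: pb_add; last exact: pb_const.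
  by apply: pb_mul; [exact: pb_const | apply: pt_size].
move=> x i; rewrite iota_foldl esize_pair esize_rev.
set n := size _; have nl : n <= esize (l x).
  by rewrite ltnW // (leq_trans _ (esize_take _ i)) // size_le_esize.
have small m : m <= n -> esize m <= 4 * esize (l x) + 1.
  move=> mn; apply: leq_trans (esize_nat_le _) _; rewrite leq_add2r leq_mul2l /=.
  exact: leq_trans (size_bits_id _) (leq_trans mn nl).
have elems m : List.In m (iota 0 n) -> esize m <= 4 * esize (l x) + 1.
  by move=> /In_mem; rewrite mem_iota => /andP[_ mn]; apply: small; apply: ltnW.
have := @esize_seq_le nat_encType _ _ elems; rewrite size_iota.
by have := small n (leqnn n); move: nl; clear; nia.
Qed.

Section Compositions.
Variables (X A B C D E F T : encType).

Lemma pt_comp3 (h : A -> B -> C -> T) (a : X -> A) (b : X -> B) (c : X -> C) :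
  polytime (fun p : A * (B * C) => h p.1 p.2.1 p.2.2) ->
  polytime a -> polytime b -> polytime c -> polytime (fun x => h (a x) (b x) (c x)).
Proof. by move=> H Ha Hb Hc; apply: (pt_comp H (pt_pair Ha (pt_pair Hb Hc))). Qed.

Lemma pt_comp4 (h : A -> B -> C -> D -> T) (a : X -> A) (b : X -> B) (c : X -> C)
    (d : X -> D) :
  polytime (fun p : A * (B * (C * D)) => h p.1 p.2.1 p.2.2.1 p.2.2.2) ->
  polytime a -> polytime b -> polytime c -> polytime d ->
  polytime (fun x => h (a x) (b x) (c x) (d x)).
Proof.
by move=> H Ha Hb Hc Hd; apply: (pt_comp H (pt_pair Ha (pt_pair Hb (pt_pair Hc Hd)))).
Qed.

Lemma pt_comp5 (h : A -> B -> C -> D -> E -> T) (a : X -> A) (b : X -> B) (c : X -> C)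
    (d : X -> D) (e : X -> E) :
  polytime (fun p : A * (B * (C * (D * E))) =>
    h p.1 p.2.1 p.2.2.1 p.2.2.2.1 p.2.2.2.2) ->
  polytime a -> polytime b -> polytime c -> polytime d -> polytime e ->
  polytime (fun x => h (a x) (b x) (c x) (d x) (e x)).
Proof.
move=> H Ha Hb Hc Hd He.
exact: (pt_comp H (pt_pair Ha (pt_pair Hb (pt_pair Hc (pt_pair Hd He))))).
Qed.

Lemma pt_comp6 (h : A -> B -> C -> D -> E -> F -> T) (a : X -> A) (b : X -> B)
    (c : X -> C) (d : X -> D) (e : X -> E) (f : X -> F) :
  polytime (fun p : A * (B * (C * (D * (E * F)))) =>
    h p.1 p.2.1 p.2.2.1 p.2.2.2.1 p.2.2.2.2.1 p.2.2.2.2.2) ->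
  polytime a -> polytime b -> polytime c -> polytime d -> polytime e -> polytime f ->
  polytime (fun x => h (a x) (b x) (c x) (d x) (e x) (f x)).
Proof.
move=> H Ha Hb Hc Hd He Hf.
exact: (pt_comp H (pt_pair Ha (pt_pair Hb (pt_pair Hc (pt_pair Hd (pt_pair He Hf)))))).
Qed.

Lemma pt_isSome (o : X -> option A) : polytime o -> polytime (fun x => isSome (o x)).
Proof.
move=> Ho; apply: (pt_match (f := fun _ _ => true) (g := fun=> false) Ho);
  exact: pt_const.
Qed.

Lemma pt_odflt (a : A) (o : X -> option A) :
  polytime o -> polytime (fun x => odflt a (o x)).
Proof.
move=> Ho; apply: (pt_match (f := fun _ y => y) (g := fun=> a) Ho); last exact: pt_const.
exact: pt_snd.
Qed.
End Compositions.

Lemma pt_mem (X : encType) (v : X -> nat) (s : X -> seq nat) :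
  polytime v -> polytime s -> polytime (fun x => v x \in s x).
Proof.
move=> Hv Hs; apply: (pt_ext (f := fun x => has (fun y => y == v x) (s x))).
  by move=> x; rewrite -has_pred1.
apply: pt_has => //; apply: pt_eqn; first exact: pt_snd.
exact: (pt_comp Hv (pt_fst _ _)).
Qed.

(** A hook of [pt_step], redefined whenever further functions of the program are known to be
    polynomial. *)
Ltac pt_user := fail.

Ltac pt_step := first [assumption | exact: pt_const | exact: pt_id | exact: pt_fst | exact: pt_snd | lazymatch goal with
  | |- polytime (fun x => @?a x && @?b x) => apply: pt_and
  | |- polytime (fun x => @?a x || @?b x) => apply: pt_or
  | |- polytime (fun x => ~~ (@?a x)) => apply: pt_neg
  | |- polytime (fun x => isSome (@?a x)) => apply: pt_isSome
  | |- polytime (fun x => Some (@?a x)) => apply: pt_some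
  | |- polytime (fun x => pair (@?a x) (@?b x)) => apply: pt_pair
  | |- polytime (fun x => cons (@?a x) (@?b x)) => apply: pt_cons
  | |- polytime (fun x => S (@?a x)) => apply: pt_succ
  | |- polytime (fun x => leq (S (@?a x)) (@?b x)) => apply: pt_ltn
  | |- polytime (fun x => leq (@?a x) (@?b x)) => apply: pt_leq
  | |- polytime (fun x => eq_op (@?a x) (@?b x)) => apply: pt_eqn
  | |- polytime (fun x => addn (@?a x) (@?b x)) => apply: pt_add
  | |- polytime (fun x => muln (@?a x) (@?b x)) => apply: pt_mul
  | |- polytime (fun x => nth ?x0 (@?a x) (@?b x)) => apply: pt_nth
  | |- polytime (fun x => odflt ?x0 (@?b x)) => apply: pt_odflt
  | |- polytime (fun x => in_mem (@?a x) (mem (@?b x))) => apply: pt_mem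
  | |- polytime (fun x => has (@?a x) (@?b x)) => apply: pt_has
  | |- polytime (fun x => all (@?a x) (@?b x)) => apply: pt_all
  | |- polytime (fun x => count (@?a x) (@?b x)) => apply: pt_count
  | |- polytime (fun x => map (@?a x) (@?b x)) => apply: pt_map
  | |- polytime (fun x => cat (@?a x) (@?b x)) => apply: pt_cat
  | |- polytime (fun x => behead (@?a x)) => apply: pt_behead
  | |- polytime (fun x => iota 0 (size (@?a x))) => apply: pt_iota
  | |- polytime (fun x => fst (@?a x)) => apply: pt_p1
  | |- polytime (fun x => snd (@?a x)) => apply: pt_p2
  end | pt_user | apply: pt_if].
Ltac pt := repeat pt_step.

(** [None] stands for [+oo]. *)
Definition ole (a b : option nat) : bool :=
  if b is Some y then (if a is Some x then x <= y else false) else true.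
Definition oadd (a b : option nat) : option nat :=
  if a is Some x then (if b is Some y then Some (x + y) else None) else None.
Definition omin (a b : option nat) : option nat := if ole a b then a else b.

Lemma pt_ole (X : encType) (a b : X -> option nat) :
  polytime a -> polytime b -> polytime (fun x => ole (a x) (b x)).
Proof.
move=> Ha Hb; apply: (pt_match (f := fun x y => if a x is Some z then z <= y else false)
  (g := fun=> true) Hb); last exact: pt_const.
apply: (pt_match (o := fun p : X * nat => a p.1) (f := fun p z => z <= p.2)
  (g := fun=> false)); last exact: pt_const.
- exact: (pt_comp Ha (pt_fst _ _)).
- by pt.
Qed.

Lemma pt_oadd (X : encType) (a b : X -> option nat) :
  polytime a -> polytime b -> polytime (fun x => oadd (a x) (b x)).
Proof.
move=> Ha Hb; apply: (pt_match (f := fun x y => if b x is Some z then Some (y + z) else None)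
  (g := fun=> None) Ha); last exact: pt_const.
apply: (pt_match (o := fun p : X * nat => b p.1) (f := fun p z => Some (p.2 + z))
  (g := fun=> None)); last exact: pt_const.
- exact: (pt_comp Hb (pt_fst _ _)).
- by pt.
Qed.

Lemma pt_omin (X : encType) (a b : X -> option nat) :
  polytime a -> polytime b -> polytime (fun x => omin (a x) (b x)).
Proof. by move=> Ha Hb; apply: (pt_if (pt_ole Ha Hb) Ha Hb). Qed.

(** * The program *)

(* weight matrix, clusters, diameter, portals; vertices are 0, ..., n - 1 *)
Notation nat_instance :=
  (seq (seq (option nat)) * (seq (seq nat) * (nat * seq nat)))%type.
Notation nat_state := (seq (option nat * option nat)).

Section Program.
Implicit Types (e : nat_instance) (U : seq bool) (H D : seq (option nat))
  (st : nat_state).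

Definition vertices e : seq nat := iota 0 (size e.1).
Definition oweight e v u : option nat := nth None (nth [::] e.1 v) u.

Definition orelax_edge e D v a u : option nat :=
  if oweight e v u is Some w then omin a (oadd (nth None D u) (Some w)) else a.

Definition orelax e U D v : option nat :=
  if nth false U v then foldl (orelax_edge e D v) (nth None D v) (vertices e)
  else nth None D v.

Definition obellman_ford e U D : seq (option nat) :=
  foldl (fun D _ => [seq orelax e U D v | v <- vertices e]) D (vertices e).

Definition sget st v : option nat * option nat := nth (None, None) st v.

Definition ounassigned e st : seq bool :=
  [seq ~~ isSome (sget st v).1 | v <- vertices e].

Definition olevels e st : seq (option nat) :=
  obellman_ford e (ounassigned e st) [seq (sget st v).2 | v <- vertices e].

Definition olevel_at p (x : option nat * option nat) : option nat :=
  if x.1 is Some q then if q == p then x.2 else None else None.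

Definition oportal_levels e st p : seq (option nat) :=
  obellman_ford e (ounassigned e st) [seq olevel_at p (sget st v) | v <- vertices e].

Definition oreached e H st p r : seq bool :=
  [seq nth false (ounassigned e st) v &&
     ole (nth None (oportal_levels e st p) v)
       (oadd (nth None H v) (Some (2 * e.2.2.1 * r))) | v <- vertices e].

Definition otouched e H st p r (C : seq nat) : bool :=
  has (nth false (oreached e H st p r)) C.

Definition ocount e H st p r : nat := count (otouched e H st p r) e.2.1.

(** A guarded loop over the vertices, hence equal to [2^m] only up to the number of vertices, which
    is the range in which [m] is tried. *)
Definition two_power e m : nat :=
  foldl (fun a i => if i < m then a + a else a) 1 (vertices e).

Definition othin e m H st p r : bool :=
  4 * two_power e m * ocount e H st p r.+1 <=
    5 * two_power e m * ocount e H st p r + ocount e H st p (8 * m).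

(** Eight copies of the vertex list give the range of length [8 n] in which all radii below [8 m]
    lie. *)
Definition radii e : seq nat :=
  let v := vertices e in
  iota 0 (size (v ++ (v ++ (v ++ (v ++ (v ++ (v ++ (v ++ v)))))))).

Definition opick_radius e m H st p : nat :=
  foldl (fun b r => if (r < 8 * m) && othin e m H st p r then r else b) 0 (radii e).

Definition ocapture e H st p r : nat_state :=
  [seq if has (fun C => (v \in C) && otouched e H st p r C) e.2.1
       then (Some p, oadd (nth None H v) (Some (2 * e.2.2.1 * r.+1)))
       else sget st v | v <- vertices e].

Definition ostep e m H st p : nat_state := ocapture e H st p (opick_radius e m H st p).

Definition ophase e m st : nat_state := foldl (ostep e m (olevels e st)) st e.2.2.2.

Definition oinit_portal e v : option nat :=
  foldl (fun b p => if has (fun C => (v \in C) && (p \in C)) e.2.1 then Some p else b)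
    None e.2.2.2.

Definition oinit e : nat_state :=
  [seq (oinit_portal e v, if isSome (oinit_portal e v) then Some e.2.2.1 else None)
     | v <- vertices e].

Definition orun e m J : nat_state :=
  foldl (fun st j => if j < J then ophase e m st else st) (oinit e) (vertices e).

Definition otry e m J : option (nat * seq nat) :=
  if all (fun v => isSome (sget (orun e m J) v).1) (vertices e)
  then Some (m * J, [seq odflt 0 (sget (orun e m J) v).1 | v <- vertices e]) else None.

Definition obetter (a o : option (nat * seq nat)) : option (nat * seq nat) :=
  if o is Some x then
    (if a is Some y then (if y.1 <= x.1 then a else Some x) else Some x) else a.

Definition obest (l : seq (option (nat * seq nat))) := foldl obetter None l.

(** [behead] drops [m = 0], which admits no radius; [J = 0] is kept, as the initial assignment may
    already be complete. *)
Definition solve e : seq nat :=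
  let range := iota 0 (size (0 :: vertices e)) in
  if obest [seq obest [seq otry e m J | J <- range] | m <- behead range] is Some x
  then x.2 else [::].

(** Accumulators are measured by bit length, which an addition raises by at most one over the larger
    operand; so it grows linearly with the number of rounds. *)
Definition owidth (o : option nat) : nat := if o is Some x then size (bits x) else 0.
Definition width D : nat := \max_(o <- D) owidth o.

Lemma owidth_nth D v : owidth (nth None D v) <= width D.
Proof.
have [vD|vD] := ltnP v (size D); last by rewrite nth_default.
by rewrite /width (big_nth None) big_mkord (leq_bigmax (Ordinal vD)).
Qed.

Lemma width_leP D k : (forall v, v < size D -> owidth (nth None D v) <= k) -> width D <= k.
Proof.
by move=> H; rewrite /width (big_nth None) big_mkord; apply/bigmax_leqP => i _; apply: H.
Qed.

Lemma esize_option_le (o : option nat) : esize o <= 4 * owidth o + 3.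
Proof.
case: o => [x|] //; rewrite [esize (Some x)](_ : _ = (esize x).+2) //.
by have := esize_nat_le x; rewrite /owidth; lia.
Qed.

Lemma owidth_esize (o : option nat) : owidth o <= esize o.
Proof.
case: o => [x|] //; rewrite [esize (Some x)](_ : _ = (esize x).+2) //.
by have := size_bits_esize x; rewrite /owidth; lia.
Qed.

Lemma esize_seq_nth (X : encType) (x0 : X) (s : seq X) b :
  (forall i, i < size s -> esize (nth x0 s i) <= b) -> esize s <= size s * b.+1 + 1.
Proof.
elim: s => // x s IH H; rewrite esize_cons /=.
have := H 0 isT; have := IH (fun i si => H i.+1 si); rewrite /=; lia.
Qed.

Lemma esize_vector_le D k : width D <= k -> esize D <= size D * (4 * k + 4) + 1.
Proof.
move=> Dk; have := @esize_seq_nth _ None D (4 * k + 3) _.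
rewrite -addnS => -> // v vD; apply: leq_trans (esize_option_le _) _.
by rewrite leq_add2r leq_mul2l (leq_trans (owidth_nth D v) Dk).
Qed.

Lemma width_esize D : width D <= esize D.
Proof.
apply: width_leP => v vD; apply: leq_trans (owidth_esize _) _.
exact: ltnW (esize_nth _ vD).
Qed.

Lemma owidth_min a b k : owidth a <= k -> owidth b <= k -> owidth (omin a b) <= k.
Proof. by rewrite /omin; case: ifP. Qed.

Lemma owidth_add a b k : owidth a <= k -> owidth b <= k -> owidth (oadd a b) <= k.+1.
Proof.
case: a => [x|] //; case: b => [y|] //= ak bk.
by apply: leq_trans (size_bits_add _ _) _; rewrite ltnS geq_max ak.
Qed.

Lemma esize_instance e : [/\ esize e.1 < esize e, esize e.2.1 < esize e,
  esize e.2.2.1 < esize e & esize e.2.2.2 < esize e].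
Proof. by case: e => a [b [c d]]; rewrite !esize_pair /=; split; lia. Qed.

Lemma owidth_weight e v u : owidth (oweight e v u) <= esize e.
Proof.
rewrite /oweight; have [e1 _ _ _] := esize_instance e.
have [vD|vD] := ltnP v (size e.1); last by rewrite (nth_default _ vD) nth_nil.
apply: leq_trans (owidth_nth _ _) (leq_trans (width_esize _) _).
exact: ltnW (ltn_trans (esize_nth _ vD) e1).
Qed.

Lemma size_vertices e : size (vertices e) < esize e.
Proof.
have [e1 _ _ _] := esize_instance e.
by rewrite size_iota (ltn_trans (size_le_esize _)).
Qed.

(** Every candidate is an entry of the old [D] plus a weight, and minima create no new values: a
    round adds one bit, however many edges are relaxed. *)
Lemma orelax_fold_width e D v a k l : width D <= k -> esize e <= k -> owidth a <= k.+1 ->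
  owidth (foldl (orelax_edge e D v) a l) <= k.+1.
Proof.
move=> Dk ek; elim: l a => //= u l IH a ak; apply: IH; rewrite /orelax_edge.
case E: (oweight e v u) => [w|] //; apply: owidth_min => //.
apply: owidth_add; first exact: leq_trans (owidth_nth _ _) Dk.
by rewrite -E (leq_trans (owidth_weight _ _ _)).
Qed.

Lemma orelax_width e U D k : width D <= k -> esize e <= k ->
  width [seq orelax e U D v | v <- vertices e] <= k.+1.
Proof.
move=> Dk ek; apply: width_leP => i; rewrite size_map => iv.
rewrite (nth_map 0) // /orelax; have := leq_trans (owidth_nth D (nth 0 (vertices e) i)) Dk.
by case: ifP => _ h; [apply: orelax_fold_width|]; rewrite // leqW.
Qed.

Lemma bellman_ford_fold_width e U D k (l : seq nat) : width D <= k -> esize e <= k ->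
  width (foldl (fun D _ => [seq orelax e U D v | v <- vertices e]) D l) <= k + size l.
Proof.
elim: l D k => [|u l IH] D k Dk ek /=; first by rewrite addn0.
by rewrite addnS -addSn; apply: IH; [apply: orelax_width | apply: leqW].
Qed.

Lemma bellman_ford_fold_size e U D (l : seq nat) :
  size (foldl (fun D _ => [seq orelax e U D v | v <- vertices e]) D l) <=
    size D + size (vertices e).
Proof.
elim/last_ind: l => [|l u _]; first exact: leq_addr.
by rewrite foldl_rcons size_map leq_addl.
Qed.

End Program.

(** * Running time of a single step *)

Section ProgramPolytime.
Implicit Types (e : nat_instance) (U : seq bool) (H D : seq (option nat))
  (st : nat_state).

Lemma pt_vertices (X : encType) (e : X -> nat_instance) :
  polytime e -> polytime (fun x => vertices (e x)).
Proof. by move=> He; rewrite /vertices; pt. Qed.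

Ltac pt_user ::= lazymatch goal with
  | |- polytime (fun x => vertices (@?a x)) => apply: pt_vertices
  | |- polytime (fun x => ole (@?a x) (@?b x)) => apply: pt_ole
  | |- polytime (fun x => oadd (@?a x) (@?b x)) => apply: pt_oadd
  | |- polytime (fun x => omin (@?a x) (@?b x)) => apply: pt_omin
  end.

Lemma pt_oweight (X : encType) (e : X -> nat_instance) (v u : X -> nat) :
  polytime e -> polytime v -> polytime u ->
  polytime (fun x => oweight (e x) (v x) (u x)).
Proof. by move=> He Hv Hu; rewrite /oweight; pt. Qed.

Lemma pt_orelax (X : encType) (e : X -> nat_instance) (U : X -> seq bool)
    (D : X -> seq (option nat)) (v : X -> nat) :
  polytime e -> polytime U -> polytime D -> polytime v ->
  polytime (fun x => orelax (e x) (U x) (D x) (v x)).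
Proof.
apply: (pt_comp4 (h := orelax)); rewrite /orelax.
apply: pt_if; [by pt | | by pt].
pose m (p : nat_instance * (seq bool * (seq (option nat) * nat))) :=
  esize p.1 + esize p.2.2.1.
apply: (pt_foldl (b := fun p => 4 * (m p).+1 + 3)
  (step := fun (p : nat_instance * (seq bool * (seq (option nat) * nat))) =>
     orelax_edge p.1 p.2.2.1 p.2.2.2)); [ | by pt | by pt | | ].
- rewrite /orelax_edge.
  apply: (pt_match (o := fun p => oweight p.1.1 p.1.2.2.2 p.2.2)
     (f := fun p w => omin p.2.1 (oadd (nth None p.1.2.2.1 p.2.2) (Some w)))
     (g := fun p => p.2.1)); [|by pt|by pt].
  by apply: pt_oweight; pt.
- apply: pb_add; last exact: pb_const.
  apply: pb_mul; first exact: pb_const.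
  apply: (pb_le (g := fun p => m p + 1)); last by move=> p; rewrite addn1.
  by apply: pb_add; [apply: pb_add; apply: pt_size; pt | exact: pb_const].
clear e U D v; move=> [e [U [D v]]] i /=; apply: leq_trans (esize_option_le _) _.
rewrite leq_add2r leq_mul2l /= /m /=.
have wD : width D <= esize e + esize D by rewrite (leq_trans (width_esize D)) ?leq_addl.
apply: orelax_fold_width => //; first exact: leq_addr.
by apply: leqW; apply: leq_trans wD; apply: owidth_nth.
Qed.

Lemma pt_obellman_ford (X : encType) (e : X -> nat_instance) (U : X -> seq bool)
    (D : X -> seq (option nat)) :
  polytime e -> polytime U -> polytime D ->
  polytime (fun x => obellman_ford (e x) (U x) (D x)).
Proof.
apply: (pt_comp3 (h := obellman_ford)); rewrite /obellman_ford.
pose S (p : nat_instance * (seq bool * seq (option nat))) := esize p.1 + esize p.2.2.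
apply: (pt_foldl (b := fun p => S p * (4 * (S p + S p) + 4) + 1)
  (step := fun (p : nat_instance * (seq bool * seq (option nat))) D (_ : nat) =>
     [seq orelax p.1 p.2.1 D v | v <- vertices p.1])); [ | by pt | by pt | | ].
- apply: pt_map; last by pt.
  by apply: pt_orelax; pt.
- have Sb : poly_bounded S by apply: pb_add; apply: pt_size; pt.
  apply: pb_add; last exact: pb_const.
  apply: pb_mul => //; apply: pb_add; last exact: pb_const.
  by apply: pb_mul; [exact: pb_const | apply: pb_add].
clear e U D; move=> [e [U D]] i /=; rewrite /S /=.
set l := take i _; have szl : size l <= esize e.
  rewrite size_take; have := size_vertices e; case: ifP; lia.
have wD : width D <= esize e + esize D by rewrite (leq_trans (width_esize D)) ?leq_addl.
apply: leq_trans (esize_vector_le (bellman_ford_fold_width U l wD (leq_addr _ _))) _.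
rewrite leq_add2r; apply: leq_mul.
  apply: leq_trans (bellman_ford_fold_size _ _ _ _) _; rewrite addnC leq_add //.
    by rewrite ltnW // size_vertices.
  by rewrite ltnW // size_le_esize.
by rewrite leq_add2r leq_mul2l /= leq_add2l (leq_trans szl) // leq_addr.
Qed.

Lemma pt_sget (X : encType) (st : X -> nat_state) (v : X -> nat) :
  polytime st -> polytime v -> polytime (fun x => sget (st x) (v x)).
Proof. by move=> Hst Hv; rewrite /sget; pt. Qed.

Lemma pt_ounassigned (X : encType) (e : X -> nat_instance) (st : X -> nat_state) :
  polytime e -> polytime st -> polytime (fun x => ounassigned (e x) (st x)).
Proof.
apply: (pt_comp2 (h := ounassigned)); rewrite /ounassigned.
by apply: pt_map; [do 3!pt_step; apply: pt_sget; pt | pt].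
Qed.

Lemma pt_olevels (X : encType) (e : X -> nat_instance) (st : X -> nat_state) :
  polytime e -> polytime st -> polytime (fun x => olevels (e x) (st x)).
Proof.
apply: (pt_comp2 (h := olevels)); rewrite /olevels.
apply: pt_obellman_ford; [by pt| by apply: pt_ounassigned; pt|].
by apply: pt_map; [pt_step; apply: pt_sget; pt | pt].
Qed.

Lemma pt_olevel_at (X : encType) (p : X -> nat) (o : X -> option nat * option nat) :
  polytime p -> polytime o -> polytime (fun x => olevel_at (p x) (o x)).
Proof.
apply: (pt_comp2 (h := olevel_at)); rewrite /olevel_at.
apply: (pt_match (X := pair_encType nat_encType
   (pair_encType (option_encType nat_encType) (option_encType nat_encType)))
  (o := fun p => p.2.1) (f := fun p q => if q == p.1 then p.2.2 else None)
  (g := fun=> None)); pt.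
Qed.

Lemma pt_oportal_levels (X : encType) (e : X -> nat_instance) (st : X -> nat_state)
    (p : X -> nat) :
  polytime e -> polytime st -> polytime p ->
  polytime (fun x => oportal_levels (e x) (st x) (p x)).
Proof.
apply: (pt_comp3 (h := oportal_levels)); rewrite /oportal_levels.
apply: pt_obellman_ford; [by pt| by apply: pt_ounassigned; pt|].
by apply: pt_map; [apply: pt_olevel_at; [pt | apply: pt_sget; pt] | pt].
Qed.

Ltac pt_user ::= lazymatch goal with
  | |- polytime (fun x => vertices (@?a x)) => apply: pt_vertices
  | |- polytime (fun x => ole (@?a x) (@?b x)) => apply: pt_ole
  | |- polytime (fun x => oadd (@?a x) (@?b x)) => apply: pt_oadd
  | |- polytime (fun x => omin (@?a x) (@?b x)) => apply: pt_omin
  | |- polytime (fun x => sget (@?a x) (@?b x)) => apply: pt_sget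
  | |- polytime (fun x => ounassigned (@?a x) (@?b x)) => apply: pt_ounassigned
  | |- polytime (fun x => olevels (@?a x) (@?b x)) => apply: pt_olevels
  | |- polytime (fun x => oportal_levels (@?a x) (@?b x) (@?c x)) =>
       apply: pt_oportal_levels
  end.

Lemma pt_oreached (X : encType) (e : X -> nat_instance) (H : X -> seq (option nat))
    (st : X -> nat_state) (p r : X -> nat) :
  polytime e -> polytime H -> polytime st -> polytime p -> polytime r ->
  polytime (fun x => oreached (e x) (H x) (st x) (p x) (r x)).
Proof. by apply: (pt_comp5 (h := oreached)); rewrite /oreached; pt. Qed.

Lemma pt_otouched (X : encType) (e : X -> nat_instance) (H : X -> seq (option nat))
    (st : X -> nat_state) (p r : X -> nat) (C : X -> seq nat) :
  polytime e -> polytime H -> polytime st -> polytime p -> polytime r -> polytime C ->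
  polytime (fun x => otouched (e x) (H x) (st x) (p x) (r x) (C x)).
Proof.
apply: (pt_comp6 (h := otouched)); rewrite /otouched; apply: pt_has; last by pt.
by apply: pt_nth; [apply: pt_oreached; pt | pt].
Qed.

Lemma pt_ocount (X : encType) (e : X -> nat_instance) (H : X -> seq (option nat))
    (st : X -> nat_state) (p r : X -> nat) :
  polytime e -> polytime H -> polytime st -> polytime p -> polytime r ->
  polytime (fun x => ocount (e x) (H x) (st x) (p x) (r x)).
Proof.
apply: (pt_comp5 (h := ocount)); rewrite /ocount; apply: pt_count; last by pt.
by apply: pt_otouched; pt.
Qed.

Lemma two_power_fold_le m (l : seq nat) a :
  foldl (fun a i => if i < m then a + a else a) a l <= a * 2 ^ size l.
Proof.
elim: l a => [|i l IH] a /=; first by rewrite muln1.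
apply: leq_trans (IH _) _; rewrite expnS mulnA leq_mul2r; apply/orP; right.
by case: ifP; lia.
Qed.

Lemma pt_two_power (X : encType) (e : X -> nat_instance) (m : X -> nat) :
  polytime e -> polytime m -> polytime (fun x => two_power (e x) (m x)).
Proof.
apply: (pt_comp2 (h := two_power)); rewrite /two_power.
apply: (pt_foldl (b := fun p : nat_instance * nat => 4 * (esize p.1 + 1) + 1)
  (step := fun (p : nat_instance * nat) a i => if i < p.2 then a + a else a)); try by pt.
- apply: pb_add; last exact: pb_const.
  apply: pb_mul; first exact: pb_const.
  by apply: pb_add; [apply: pt_size; pt | exact: pb_const].
clear e m; move=> [e m] i /=; apply: leq_trans (esize_nat_le _) _.
rewrite leq_add2r leq_mul2l /= size_bits_le.
apply: leq_ltn_trans (two_power_fold_le _ _ _) _; rewrite mul1n ltn_exp2l //.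
by rewrite size_take addn1 ltnS; have := size_vertices e; case: ifP; lia.
Qed.

Ltac pt_user ::= lazymatch goal with
  | |- polytime (fun x => vertices (@?a x)) => apply: pt_vertices
  | |- polytime (fun x => ole (@?a x) (@?b x)) => apply: pt_ole
  | |- polytime (fun x => oadd (@?a x) (@?b x)) => apply: pt_oadd
  | |- polytime (fun x => omin (@?a x) (@?b x)) => apply: pt_omin
  | |- polytime (fun x => sget (@?a x) (@?b x)) => apply: pt_sget
  | |- polytime (fun x => olevels (@?a x) (@?b x)) => apply: pt_olevels
  | |- polytime (fun x => otouched (@?a x) (@?b x) (@?c x) (@?d x) (@?f x) (@?g x)) =>
       apply: pt_otouched
  | |- polytime (fun x => ocount (@?a x) (@?b x) (@?c x) (@?d x) (@?f x)) =>
       apply: pt_ocount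
  | |- polytime (fun x => two_power (@?a x) (@?b x)) => apply: pt_two_power
  end.

Lemma pt_othin (X : encType) (e : X -> nat_instance) (m : X -> nat)
    (H : X -> seq (option nat)) (st : X -> nat_state) (p r : X -> nat) :
  polytime e -> polytime m -> polytime H -> polytime st -> polytime p -> polytime r ->
  polytime (fun x => othin (e x) (m x) (H x) (st x) (p x) (r x)).
Proof. by apply: (pt_comp6 (h := othin)); rewrite /othin; pt. Qed.

Lemma pt_radii (X : encType) (e : X -> nat_instance) :
  polytime e -> polytime (fun x => radii (e x)).
Proof. by move=> He; rewrite /radii; pt. Qed.

Lemma pick_fold_le (c : pred nat) b k (l : seq nat) :
  b <= k -> (forall r, r \in l -> r <= k) ->
  foldl (fun b r => if c r then r else b) b l <= k.
Proof.
elim: l b => //= r l IH b bk lk; apply: IH.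
  by case: ifP => // _; apply: lk; rewrite mem_head.
by move=> x xl; apply: lk; rewrite inE xl orbT.
Qed.

Lemma radii_le e r : r \in radii e -> r <= 8 * esize e.
Proof.
by rewrite mem_iota !size_cat; have := size_vertices e; lia.
Qed.

Lemma opick_radius_le e m H st p : opick_radius e m H st p <= 8 * esize e.
Proof. by apply: pick_fold_le => // r; apply: radii_le. Qed.

Lemma pt_opick_radius (X : encType) (e : X -> nat_instance) (m : X -> nat)
    (H : X -> seq (option nat)) (st : X -> nat_state) (p : X -> nat) :
  polytime e -> polytime m -> polytime H -> polytime st -> polytime p ->
  polytime (fun x => opick_radius (e x) (m x) (H x) (st x) (p x)).
Proof.
apply: (pt_comp5 (h := opick_radius)); rewrite /opick_radius.
pose T : Type := (nat_instance * (nat * (seq (option nat) * (nat_state * nat))))%type.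
apply: (pt_foldl (A := nat_encType) (Y := nat_encType)
  (b := fun p => 4 * (8 * esize p.1) + 1)
  (step := fun (x : T) b r =>
     if (r < 8 * x.2.1) && othin x.1 x.2.1 x.2.2.1 x.2.2.2.1 x.2.2.2.2 r then r else b)).
- apply: pt_if; [|by pt|by pt].
  by apply: pt_and; [pt | apply: pt_othin; pt].
- by pt.
- by apply: pt_radii; pt.
- apply: pb_add; last exact: pb_const.
  do 2!(apply: pb_mul; first exact: pb_const).
  by apply: pt_size; pt.
clear e m H st p; move=> [e [m [H [st p]]]] i /=; apply: leq_trans (esize_nat_le _) _.
rewrite leq_add2r leq_mul2l /=; apply: leq_trans (size_bits_id _) _.
by apply: pick_fold_le => // r /mem_take; apply: radii_le.
Qed.

Lemma pt_ocapture (X : encType) (e : X -> nat_instance)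
    (H : X -> seq (option nat)) (st : X -> nat_state) (p r : X -> nat) :
  polytime e -> polytime H -> polytime st -> polytime p -> polytime r ->
  polytime (fun x => ocapture (e x) (H x) (st x) (p x) (r x)).
Proof. by apply: (pt_comp5 (h := ocapture)); rewrite /ocapture; pt. Qed.

Lemma pt_ostep (X : encType) (e : X -> nat_instance) (m : X -> nat)
    (H : X -> seq (option nat)) (st : X -> nat_state) (p : X -> nat) :
  polytime e -> polytime m -> polytime H -> polytime st -> polytime p ->
  polytime (fun x => ostep (e x) (m x) (H x) (st x) (p x)).
Proof.
apply: (pt_comp5 (h := ostep)); rewrite /ostep; apply: pt_ocapture; try by pt.
by apply: pt_opick_radius; pt.
Qed.

End ProgramPolytime.

(** * Bit lengths of states and running time of whole runs *)

Section ProgramBounds.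
Implicit Types (e : nat_instance) (U : seq bool) (H D : seq (option nat))
  (st : nat_state).

Definition state_width st : nat := \max_(x <- st) maxn (owidth x.1) (owidth x.2).

Lemma state_width_leP st k :
  (forall v, v < size st -> owidth (sget st v).1 <= k /\ owidth (sget st v).2 <= k) ->
  state_width st <= k.
Proof.
move=> h; rewrite /state_width (big_nth (None, None)) big_mkord.
by apply/bigmax_leqP => i _; rewrite geq_max; have [-> ->] := h i (ltn_ord i).
Qed.

Lemma sget_width st v : owidth (sget st v).1 <= state_width st /\
  owidth (sget st v).2 <= state_width st.
Proof.
rewrite /sget; have [vs|vs] := ltnP v (size st); last by rewrite nth_default.
suff : maxn (owidth (nth (None, None) st v).1) (owidth (nth (None, None) st v).2) <=
    state_width st by rewrite geq_max => /andP[].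
rewrite /state_width (big_nth (None, None)) big_mkord.
exact: (leq_bigmax (Ordinal vs)).
Qed.

Lemma esize_state_le st k : state_width st <= k -> esize st <= size st * (8 * k + 8) + 1.
Proof.
move=> sk; rewrite (_ : 8 * k + 8 = (8 * k + 7).+1); last by rewrite -addnS.
apply: (esize_seq_nth (x0 := (None, None))) => i si.
have [w1 w2] := sget_width st i; rewrite /sget in w1 w2.
case: (nth _ st i) w1 w2 => a b /= w1 w2; rewrite esize_pair.
have := esize_option_le a; have := esize_option_le b; lia.
Qed.

Lemma state_width_esize st : state_width st <= esize st.
Proof.
apply: state_width_leP => v vs; have := esize_nth (None, None) vs; rewrite /sget.
case: (nth _ st v) => a b; rewrite esize_pair /=.
by have := owidth_esize a; have := owidth_esize b; lia.
Qed.

Lemma olevels_width e st k : state_width st <= k -> esize e <= k ->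
  width (olevels e st) <= k + esize e.
Proof.
move=> sk ek; rewrite /olevels /obellman_ford.
apply: leq_trans (bellman_ford_fold_width _ _ (_ : _ <= k) ek) _.
  apply: width_leP => i; rewrite size_map => iv; rewrite (nth_map 0) //.
  by have [_ w] := sget_width st (nth 0 (vertices e) i); apply: leq_trans sk.
by rewrite leq_add2l ltnW // size_vertices.
Qed.

Lemma ocapture_width e H st p r k : size (bits p) <= k -> width H < k ->
    r <= 8 * esize e -> 9 * esize e + 3 < k -> state_width st <= k ->
  state_width (ocapture e H st p r) <= k.
Proof.
move=> pk Hk rk ek sk; apply: state_width_leP => i; rewrite size_map => iv.
rewrite /sget (nth_map 0) //; case: ifP => _; last first.
  by have [w1 w2] := sget_width st (nth 0 (vertices e) i); split; apply: leq_trans sk.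
split => //=; rewrite -(prednK (leq_ltn_trans (leq0n _) Hk)).
have kE : k.-1.+1 = k by rewrite (prednK (leq_ltn_trans (leq0n _) Hk)).
apply: owidth_add; first by rewrite -ltnS kE (leq_ltn_trans (owidth_nth _ _)).
rewrite -ltnS kE; apply: leq_ltn_trans ek.
apply: leq_trans (size_bits_mul _ _) _.
have h1 := size_bits_mul 2 e.2.2.1; have h2 : size (bits 2) <= 2 by rewrite size_bits_le.
have h3 := size_bits_id r.+1; have h4 := size_bits_esize e.2.2.1.
have [_ _ h5 _] := esize_instance e; lia.
Qed.

Lemma size_ocapture e H st p r : size (ocapture e H st p r) = size (vertices e).
Proof. by rewrite size_map. Qed.

(** The bound does not grow with [l]: the values written are computed from [H], fixed throughout the
    phase, and not from earlier states. *)
Lemma phase_fold_width e m H st k (l : seq nat) :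
    (forall p, p \in l -> size (bits p) <= k) -> width H < k ->
    9 * esize e + 3 < k -> state_width st <= k ->
  state_width (foldl (ostep e m H) st l) <= k.
Proof.
move=> lk Hk ek; elim: l lk st => //= p l IH lk st sk; apply: IH.
  by move=> q ql; apply: lk; rewrite inE ql orbT.
apply: ocapture_width => //; first by apply: lk; rewrite mem_head.
exact: opick_radius_le.
Qed.

Lemma phase_fold_size e m H st (l : seq nat) :
  size (foldl (ostep e m H) st l) <= size st + size (vertices e).
Proof.
elim/last_ind: l => [|l p _]; first exact: leq_addr.
by rewrite foldl_rcons size_ocapture leq_addl.
Qed.

Lemma size_bits_portal e p : p \in e.2.2.2 -> size (bits p) <= esize e.
Proof.
move=> pP; have [_ _ _ h] := esize_instance e.
apply: leq_trans (size_bits_esize _) _.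
move: (pP); rewrite -index_mem => ip; rewrite -(nth_index 0 pP).
exact: ltnW (ltn_trans (esize_nth _ ip) h).
Qed.

Lemma ophase_fold_width e m st k (l : seq nat) : {subset l <= e.2.2.2} ->
    state_width st <= k -> esize e <= k ->
  state_width (foldl (ostep e m (olevels e st)) st l) <= k + (10 * esize e + 4).
Proof.
move=> lP sk ek; have wH := olevels_width sk ek; apply: phase_fold_width.
- by move=> p /lP/size_bits_portal; lia.
- lia.
- lia.
- by apply: leq_trans sk (leq_addr _ _).
Qed.

Lemma pt_ophase (X : encType) (e : X -> nat_instance) (m : X -> nat)
    (st : X -> nat_state) :
  polytime e -> polytime m -> polytime st ->
  polytime (fun x => ophase (e x) (m x) (st x)).
Proof.
apply: (pt_comp3 (h := ophase)); rewrite /ophase.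
pose T : Type := (nat_instance * (nat * nat_state))%type.
pose S (p : T) := esize p.2.2 + esize p.1.
(* The levels are turned into an additional input of the loop, so that they are computed once,
   before it. *)
apply: (pt_comp4 (h := fun e m st H => foldl (ostep e m H) st e.2.2.2)
  (a := fun p : T => p.1) (b := fun p : T => p.2.1) (c := fun p : T => p.2.2)
  (d := fun p : T => olevels p.1 p.2.2)); [| by pt | by pt | by pt | by apply: pt_olevels; pt].
pose T' : Type := (nat_instance * (nat * (nat_state * seq (option nat))))%type.
pose S' (p : T') := esize p.1 + (esize p.2.2.1 + esize p.2.2.2).
apply: (pt_foldl
  (b := fun p : T' => S' p * (8 * (S' p + (10 * esize p.1 + 4)) + 8) + 1)
  (step := fun (p : T') st q => ostep p.1 p.2.1 p.2.2.2 st q)); [|by pt|by pt| |].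
- by apply: pt_ostep; pt.
- have eb : poly_bounded (fun p : T' => esize p.1) by apply: pt_size; pt.
  have Sb : poly_bounded S'.
    by apply: pb_add => //; apply: pb_add; apply: pt_size; pt.
  apply: pb_add; last exact: pb_const.
  apply: pb_mul => //; apply: pb_add; last exact: pb_const.
  apply: pb_mul; first exact: pb_const.
  apply: pb_add => //; apply: pb_add; last exact: pb_const.
  by apply: pb_mul => //; exact: pb_const.
clear e m st; move=> [e [m [st H]]] i /=; rewrite /S' /=.
set K := _ + (_ + 4).
have wK : state_width (foldl (ostep e m H) st (take i e.2.2.2)) <= K.
  have := width_esize H; have := state_width_esize st => w1 w2.
  apply: phase_fold_width; rewrite /K; [|lia|lia|lia].
  by move=> p /mem_take/size_bits_portal; lia.
apply: leq_trans (esize_state_le wK) _; rewrite leq_add2r leq_mul2r; apply/orP; right.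
apply: leq_trans (phase_fold_size _ _ _ _ _) _.
apply: leq_trans (leq_add (ltnW (size_le_esize st)) (ltnW (size_vertices e))) _.
lia.
Qed.

Lemma oinit_portal_fold_mem e v b (l : seq nat) : {subset l <= e.2.2.2} ->
    (if b is Some p then p \in e.2.2.2 else true) ->
  if foldl (fun b p => if has (fun C => (v \in C) && (p \in C)) e.2.1 then Some p else b)
      b l is Some p then p \in e.2.2.2 else true.
Proof.
elim: l b => //= q l IH b lP bP; apply: IH => [x xl|].
  by apply: lP; rewrite inE xl orbT.
by case: ifP => // _; apply: lP; rewrite mem_head.
Qed.

Lemma oinit_portal_esize e v (l : seq nat) : {subset l <= e.2.2.2} ->
  owidth (foldl (fun b p =>
    if has (fun C => (v \in C) && (p \in C)) e.2.1 then Some p else b) None l) <= esize e.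
Proof.
move=> lP; have := @oinit_portal_fold_mem e v None l lP isT.
by case: foldl => // p /size_bits_portal.
Qed.

Lemma pt_oinit_portal (X : encType) (e : X -> nat_instance) (v : X -> nat) :
  polytime e -> polytime v -> polytime (fun x => oinit_portal (e x) (v x)).
Proof.
apply: (pt_comp2 (h := oinit_portal)); rewrite /oinit_portal.
apply: (pt_foldl (b := fun p : nat_instance * nat => 4 * esize p.1 + 3)
  (step := fun (x : nat_instance * nat) b p =>
    if has (fun C => (x.2 \in C) && (p \in C)) x.1.2.1 then Some p else b)); try by pt.
- apply: pb_add; last exact: pb_const.
  by apply: pb_mul; [exact: pb_const | apply: pt_size; pt].
clear e v; move=> [e v] i /=; apply: leq_trans (esize_option_le _) _.
rewrite leq_add2r leq_mul2l /=; apply: oinit_portal_esize.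
by move=> p /mem_take.
Qed.

Lemma oinit_width e : state_width (oinit e) <= esize e.
Proof.
apply: state_width_leP => i; rewrite size_map => iv.
rewrite /sget (nth_map 0) //=; split; first exact: oinit_portal_esize.
case: isSome => //=; have [_ _ h _] := esize_instance e.
exact: leq_trans (size_bits_esize _) (ltnW h).
Qed.

(** A phase increases the bit length by an amount that depends on the instance only, so a run
    increases it linearly in the number of phases. *)
Lemma run_fold_width e m J st k (l : seq nat) : state_width st <= k -> esize e <= k ->
  state_width (foldl (fun st j => if j < J then ophase e m st else st) st l) <=
    k + size l * (10 * esize e + 4).
Proof.
elim: l st k => [|j l IH] st k sk ek /=; first by rewrite addn0.
rewrite mulSn addnA; apply: IH; last by apply: leq_trans ek (leq_addr _ _).
case: ifP => _; last by apply: leq_trans sk (leq_addr _ _).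
exact: ophase_fold_width.
Qed.

Lemma run_fold_size e m J st (l : seq nat) : size st <= size (vertices e) ->
  size (foldl (fun st j => if j < J then ophase e m st else st) st l) <= size (vertices e).
Proof.
elim: l st => //= j l IH st sv; apply: IH; case: ifP => // _; rewrite /ophase.
elim/last_ind: e.2.2.2 => // s p _.
by rewrite foldl_rcons size_ocapture.
Qed.

Ltac pt_user ::= lazymatch goal with
  | |- polytime vertices => exact: (pt_vertices (pt_id _))
  | |- polytime (fun x => vertices (@?a x)) => apply: pt_vertices
  | |- polytime (fun x => sget (@?a x) (@?b x)) => apply: pt_sget
  | |- polytime (fun x => ophase (@?a x) (@?b x) (@?c x)) => apply: pt_ophase
  | |- polytime (fun x => oinit_portal (@?a x) (@?b x)) => apply: pt_oinit_portal
  end.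

Lemma pt_oinit (X : encType) (e : X -> nat_instance) :
  polytime e -> polytime (fun x => oinit (e x)).
Proof. by move=> He; apply: (pt_comp (g := oinit)) He; rewrite /oinit; pt. Qed.

Lemma pt_orun (X : encType) (e : X -> nat_instance) (m J : X -> nat) :
  polytime e -> polytime m -> polytime J ->
  polytime (fun x => orun (e x) (m x) (J x)).
Proof.
apply: (pt_comp3 (h := orun)); rewrite /orun.
pose T : Type := (nat_instance * (nat * nat))%type.
pose K (p : T) := esize p.1 + esize p.1 * (10 * esize p.1 + 4).
apply: (pt_foldl (b := fun p : T => esize p.1 * (8 * K p + 8) + 1)
  (step := fun (p : T) st j => if j < p.2.2 then ophase p.1 p.2.1 st else st)).
- by pt.
- by apply: pt_oinit; pt.
- by pt.
- have eb : poly_bounded (fun p : T => esize p.1) by apply: pt_size; pt.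
  apply: pb_add; last exact: pb_const.
  apply: pb_mul => //; apply: pb_add; last exact: pb_const.
  apply: pb_mul; first exact: pb_const.
  apply: pb_add => //; apply: pb_mul => //; apply: pb_add; last exact: pb_const.
  by apply: pb_mul => //; exact: pb_const.
clear e m J; move=> [e [m J]] i /=; rewrite /K /=.
set l := take i _; have szl : size l <= esize e.
  rewrite size_take; have := size_vertices e; case: ifP; lia.
have w := run_fold_width m J l (oinit_width e) (leqnn _).
apply: leq_trans (esize_state_le w) _; rewrite leq_add2r; apply: leq_mul.
  apply: leq_trans (run_fold_size _ _ _ _) _; first by rewrite size_map.
  exact: ltnW (size_vertices e).
by rewrite leq_add2r leq_mul2l /= leq_add2l leq_mul2r szl orbT.
Qed.

Lemma pt_otry (X : encType) (e : X -> nat_instance) (m J : X -> nat) :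
  polytime e -> polytime m -> polytime J ->
  polytime (fun x => otry (e x) (m x) (J x)).
Proof.
apply: (pt_comp3 (h := otry)); rewrite /otry.
have run_pt (Y : encType) (f : Y -> nat_instance * (nat * nat)) : polytime f ->
    polytime (fun y => orun (f y).1 (f y).2.1 (f y).2.2).
  by move=> Hf; apply: pt_orun; pt.
apply: pt_if; last by pt.
  by apply: pt_all; [do 2!pt_step; apply: pt_sget; [apply: run_pt; pt | pt] | pt].
apply: pt_some; apply: pt_pair; first by pt.
by apply: pt_map; [do 2!pt_step; apply: pt_sget; [apply: run_pt; pt | pt] | pt].
Qed.

Lemma pt_obest (X : encType) (l : X -> seq (option (nat * seq nat))) :
  polytime l -> polytime (fun x => obest (l x)).
Proof.
move=> Hl; apply: (pt_comp (g := obest)) Hl; rewrite /obest.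
pose O : encType := option_encType (pair_encType nat_encType (seq_encType nat_encType)).
apply: (pt_foldl (X := seq_encType O) (A := O) (Y := O) (b := fun l => esize l)
  (step := fun _ a o => obetter a o)); [| by pt | by pt | exact: pb_esize |].
- rewrite /obetter.
  apply: (pt_match (X := pair_encType (seq_encType O) (pair_encType O O))
    (o := fun p => p.2.2)
    (f := fun p x => if p.2.1 is Some y then (if y.1 <= x.1 then p.2.1 else Some x)
       else Some x) (g := fun p => p.2.1)); [by pt| |by pt].
  apply: (pt_match (X := pair_encType (pair_encType (seq_encType O) (pair_encType O O))
       (pair_encType nat_encType (seq_encType nat_encType)))
    (o := fun p => p.1.2.1)
    (f := fun p y => if y.1 <= p.2.1 then p.1.2.1 else Some p.2)
    (g := fun p => Some p.2)); by pt.
(* The accumulator is always [None] or an entry of the list, hence no larger than the list. *)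
move=> s i; have : foldl obetter None (take i s) = None \/
    exists2 k, k < size s & foldl obetter None (take i s) = nth None s k.
  elim: i => [|i IH]; first by left; rewrite take0.
  have [is_|is_] := ltnP i (size s); last first.
    by move: IH; rewrite !take_oversize // ltnW.
  rewrite (take_nth None is_) foldl_rcons /obetter.
  case E: (nth None s i) => [x|] //; have alt : exists2 k, k < size s & Some x = nth None s k.
    by exists i.
  case F: (foldl _ _ _) IH => [y|] IH; last by right.
  by case: ifP => _; [|right].
case=> [->|[k ks ->]]; first exact: esize_gt0.
exact: ltnW (esize_nth _ ks).
Qed.

Lemma pt_solve (X : encType) (e : X -> nat_instance) :
  polytime e -> polytime (fun x => solve (e x)).
Proof.
move=> He; apply: (pt_comp (g := solve)) He; rewrite /solve.
apply: (pt_match (X := pair_encType _ (pair_encType _ (pair_encType _ _)))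
  (o := fun e : nat_instance => obest [seq obest [seq otry e m J |
     J <- iota 0 (size (0 :: vertices e))] | m <- behead (iota 0 (size (0 :: vertices e)))])
  (f := fun _ x => x.2) (g := fun=> [::])); [|by pt|by pt].
apply: pt_obest; apply: pt_map; last by pt.
apply: pt_obest; apply: pt_map; last by pt.
by apply: pt_otry; pt.
Qed.

End ProgramBounds.

(** * Clearing the denominators of rational data *)

Lemma pt_flatten (X Y : encType) (l : X -> seq (seq Y)) :
  polytime l -> polytime (fun x => flatten (l x)).
Proof.
move=> Hl; have E s : foldl cat [::] s = flatten s :> seq Y.
  by elim/last_ind: s => // s y IH; rewrite foldl_rcons IH flatten_rcons.
apply: (pt_ext (f := fun x => foldl cat [::] (l x))) => [x|]; first exact: E.
apply: (pt_foldl (b := fun x => esize (l x)) (step := fun _ => cat)) => //.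
- by apply: pt_cat; pt.
- exact: pt_const.
- exact: pt_size.
move=> x i; rewrite E; apply: leq_trans (esize_take (l x) i).
elim: (take i (l x)) => //= s t IH; rewrite esize_cons.
by apply: leq_trans (esize_cat _ _) _; apply: leqW; rewrite leq_add2l.
Qed.

Notation raw_instance :=
  (seq (seq (option (nat * nat))) * (seq (seq nat) * ((nat * nat) * seq nat)))%type.

(** Scaling by the product of all denominators avoids division: an entry is multiplied by the
    product of the others, whose bit length is bounded by the size of the list. Missing edges
    contribute the neutral 1. *)
Definition denominators (x : raw_instance) : seq nat :=
  x.2.2.1.2 :: flatten [seq [seq if o is Some q then q.2 else 1 | o <- row] | row <- x.1].

Definition cofactor_step (b : nat) (st : bool * nat) (y : nat) : bool * nat :=
  if ~~ st.1 && (y == b) then (true, st.2) else (st.1, st.2 * y).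

(* the product of ds without one occurrence of b *)
Definition prod_but (ds : seq nat) (b : nat) : nat :=
  (foldl (cofactor_step b) (false, 1) ds).2.

Definition scale (ds : seq nat) (q : nat * nat) : nat := q.1 * prod_but ds q.2.

Definition scaled (x : raw_instance) : nat_instance :=
  ([seq [seq omap (scale (denominators x)) o | o <- row] | row <- x.1],
   (x.2.1, (scale (denominators x) x.2.2.1, x.2.2.2))).

Lemma prod_butP (ds : seq nat) b : b \in ds -> b * prod_but ds b = \prod_(y <- ds) y.
Proof.
rewrite /prod_but; have used a s : (foldl (cofactor_step b) (true, a) s) =
    (true, a * \prod_(y <- s) y).
  elim: s a => [|y s IH] a /=; first by rewrite big_nil muln1.
  by rewrite IH big_cons mulnA.
have main a s : b \in s -> b * (foldl (cofactor_step b) (false, a) s).2 =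
    a * \prod_(y <- s) y.
  elim: s a => //= y s IH a; rewrite inE big_cons /cofactor_step /= eq_sym.
  case: eqP => [-> _|_ /= bs]; first by rewrite -/(cofactor_step b) used /= mulnCA.
  by rewrite -/(cofactor_step b) IH // mulnA.
by move=> /main ->; rewrite mul1n.
Qed.

Lemma cofactor_fold_size b st (s : seq nat) :
  size (bits (foldl (cofactor_step b) st s).2) <= size (bits st.2) + esize s.
Proof.
elim: s st => [|y s IH] st /=; first exact: leq_addr.
rewrite esize_cons; apply: leq_trans (IH _) _.
have : size (bits (cofactor_step b st y).2) <= size (bits st.2) + esize y.
  rewrite /cofactor_step; case: ifP => _ /=; first exact: leq_addr.
  by apply: leq_trans (size_bits_mul _ _) _; rewrite leq_add2l size_bits_esize.
lia.
Qed.

Lemma pt_prod_but (X : encType) (ds : X -> seq nat) (b : X -> nat) :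
  polytime ds -> polytime b -> polytime (fun x => prod_but (ds x) (b x)).
Proof.
apply: (pt_comp2 (h := prod_but)); rewrite /prod_but; apply: pt_p2.
apply: (pt_foldl (X := pair_encType (seq_encType nat_encType) nat_encType)
  (A := pair_encType bool_encType nat_encType) (Y := nat_encType)
  (b := fun p => 4 * (1 + esize p.1) + 5)
  (step := fun p => cofactor_step p.2)); [|by pt|by pt| |].
- by rewrite /cofactor_step; pt.
- apply: pb_add; last exact: pb_const.
  apply: pb_mul; first exact: pb_const.
  by apply: pb_add; [exact: pb_const | apply: pt_size; pt].
clear ds b; move=> [s b] i /=; have := cofactor_fold_size b (false, 1) (take i s).
case: foldl => c a /= ha; rewrite esize_pair.
have arith (c' a' w k j : nat) : a' <= 4 * w + 1 -> k <= j -> w <= 1 + k -> c' <= 3 ->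
  (c' + a').+1 <= 4 * (1 + j) + 5 by lia.
apply: arith (esize_nat_le a) (esize_take s i) ha _; by case: c.
Qed.

Lemma pt_scaled : polytime scaled.
Proof.
have pt_denominators (X : encType) (x : X -> raw_instance) : polytime x ->
    polytime (fun y => denominators (x y)).
  move=> Hx; apply: (pt_comp (g := denominators)) Hx; rewrite /denominators.
  apply: pt_cons; first by pt.
  apply: pt_flatten; apply: pt_map; last by pt.
  apply: pt_map; last by pt.
  apply: (pt_match (o := fun p : raw_instance * seq (option (nat * nat)) *
      option (nat * nat) => p.2) (f := fun _ q => q.2) (g := fun=> 1)); by pt.
have pt_scale (X : encType) (ds : X -> seq nat) (q : X -> nat * nat) :
    polytime ds -> polytime q -> polytime (fun y => scale (ds y) (q y)).
  move=> Hd Hq; rewrite /scale; apply: pt_mul; first by pt.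
  by apply: pt_prod_but; pt.
rewrite /scaled; apply: pt_pair; last first.
  apply: pt_pair; first by pt.
  apply: pt_pair; last by pt.
  by apply: pt_scale; [apply: pt_denominators; pt | pt].
apply: pt_map; last by pt.
apply: pt_map; last by pt.
apply: (pt_match (o := fun p : raw_instance * seq (option (nat * nat)) *
    option (nat * nat) => p.2)
  (f := fun p q => Some (scale (denominators p.1.1) q)) (g := fun=> None)); [by pt| |by pt].
by apply: pt_some; apply: pt_scale; [apply: pt_denominators; pt | pt].
Qed.

Local Open Scope ring_scope.

(** * Correctness of the program *)

Section Folds.

Lemma foldl_simulation (A B T U : Type) (rel : A -> B -> Prop) (g : U -> T)
    (f : A -> T -> A) (f' : B -> U -> B) (s : seq U) a b :
  (forall a b x, List.In x s -> rel a b -> rel (f a (g x)) (f' b x)) ->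
  rel a b -> rel (foldl f a (map g s)) (foldl f' b s).
Proof.
elim: s a b => //= x s IH a b H ab; apply: IH => [c d y ys|]; first by apply: H; right.
by apply: H => //; left.
Qed.

Lemma foldl_iter (A T : Type) (f : A -> A) (s : seq T) a :
  foldl (fun a _ => f a) a s = iter (size s) f a.
Proof. by elim: s a => //= x s IH a; rewrite IH -iterSr iterS. Qed.

Lemma foldl_iter_lt (A : Type) (f : A -> A) a J n : (J <= n)%N ->
  foldl (fun a j => if (j < J)%N then f a else a) a (iota 0 n) = iter J f a.
Proof.
move=> Jn; rewrite -(subnKC Jn) iotaD foldl_cat add0n.
have -> : foldl (fun a j => if (j < J)%N then f a else a) a (iota 0 J) = iter J f a.
  rewrite -[in RHS](size_iota 0 J) -foldl_iter.
  have : all (fun j => j < J)%N (iota 0 J) by apply/allP => j; rewrite mem_iota.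
  by elim: (iota 0 J) a => //= j s IH a /andP[-> sJ]; rewrite IH.
have : all (fun j => J <= j)%N (iota J (n - J)).
  by apply/allP => j; rewrite mem_iota => /andP[].
elim: (iota J (n - J)) (iter J f a) => //= j s IH b /andP[jJ sJ].
by rewrite ltnNge jJ /= IH.
Qed.

Lemma count_enum (T : finType) (A : {set T}) (Q : pred T) :
  count Q (enum A) = #|[set x in A | Q x]|.
Proof.
rewrite -size_filter cardE; congr size; rewrite /enum_mem -filter_predI.
by apply: eq_filter => x; rewrite /= inE andbC.
Qed.

End Folds.

Section Best.
Implicit Types (l : seq (option (nat * seq nat))).

Lemma obest_rcons l o : obest (rcons l o) = obetter (obest l) o.
Proof. exact: foldl_rcons. Qed.

Lemma obest_mem l x : obest l = Some x -> Some x \in l.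
Proof.
elim/last_ind: l x => // l o IH x; rewrite obest_rcons mem_rcons inE.
case: o => [y|]; last by rewrite /obetter => /IH ->; rewrite orbT.
case E: (obest l) => [z|] /=; last by move=> ->; rewrite eqxx.
by case: ifP => _; [rewrite -E => /IH -> | move=> ->]; rewrite ?orbT ?eqxx.
Qed.

Lemma obest_le l y : Some y \in l -> exists2 x, obest l = Some x & (x.1 <= y.1)%N.
Proof.
elim/last_ind: l => // l o IH; rewrite obest_rcons mem_rcons inE => /orP[/eqP <-|/IH].
  rewrite /obetter; case E: (obest l) => [z|]; last by exists y.
  by case: ifP => zy; [exists z | exists y].
move=> [x -> xy]; case: o => [z|] /=; last by exists x.
case: ifP => xz; first by exists x.
by exists z => //; apply: leq_trans xy; rewrite ltnW // ltnNge xz.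
Qed.
End Best.

Section Simulation.
Context {R : realType} (n : nat) (I : ca_instance rat 'I_n).
Let Ir : ca_instance R 'I_n := map_ca_instance (ratr : rat -> R) I.
Hypothesis Iok : is_ca_instance Ir.

Definition rat_pair (q : rat) : nat * nat := (`|numq q|%N, `|denq q|%N).

Definition raw : raw_instance :=
  ([seq [seq if adj (ca_graph I) i j then Some (rat_pair (wt (ca_graph I) i j)) else None
        | j <- enum 'I_n] | i <- enum 'I_n],
   ([seq [seq nat_of_ord v | v <- enum C] | C : {set 'I_n} <- enum (ca_clusters I)],
     (rat_pair (ca_diam I), [seq nat_of_ord p | p <- enum (ca_portals I)]))).

(** Because the trees coincide, the program for [raw_instance] runs directly on the prescribed
    input. *)
Lemma enc_raw : enc raw = tree_of_ca_instance I.
Proof.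
have seqE (T : Type) (X : encType) (f : T -> X) (s : seq T) :
    tree_of_seq (fun x => enc (f x)) s = tree_of_seq (@enc X) (map f s).
  by elim: s => //= x s ->.
rewrite /tree_of_ca_instance /=; congr Node; [|congr Node; [|congr Node]].
- rewrite /tree_of_wgraph -seqE /=; congr (tree_of_seq _ _); apply/funext => i.
  rewrite -seqE; congr (tree_of_seq _ _); apply/funext => j.
  by case: ifP.
- by rewrite -seqE /=; congr (tree_of_seq _ _); apply/funext => C; rewrite -seqE.
- by rewrite -seqE.
Qed.

Let e : nat_instance := scaled raw.
Definition unit_scale : nat := \prod_(y <- denominators raw) y.
Local Notation D := unit_scale.

Lemma den_gt0 y : y \in denominators raw -> (0 < y)%N.
Proof.
rewrite inE => /orP[/eqP ->|]; first by rewrite /= absz_gt0 denq_neq0.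
case/flattenP => row /mapP[r]; case/mapP => i _ -> ->.
case/mapP => o; case/mapP => j _ -> ->.
by case: ifP => //= _; rewrite absz_gt0 denq_neq0.
Qed.

Lemma unit_scale_gt0 : (0 < D)%N.
Proof.
rewrite /unit_scale big_seq; apply: prodn_cond_gt0 => y; exact: den_gt0.
Qed.

Definition oval (o : option nat) : \bar R :=
  if o is Some k then (k%:R / D%:R)%:E else +oo%E.

Let D_gt0 : 0 < D%:R :> R. Proof. by rewrite ltr0n unit_scale_gt0. Qed.

Lemma oval_add a b : oval (oadd a b) = (oval a + oval b)%E.
Proof.
case: a => [x|] /=; last by case: b.
by case: b => [y|] //=; rewrite natrD mulrDl EFinD.
Qed.

Lemma oval_le a b : ole a b = (oval a <= oval b)%E.
Proof.
case: b => [y|] /=; last by rewrite leey.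
by case: a => [x|] //=; rewrite lee_fin ler_pM2r ?invr_gt0 // ler_nat.
Qed.

Lemma oval_min a b : oval (omin a b) = Order.min (oval a) (oval b).
Proof. by rewrite /omin oval_le minEle; case: ifP. Qed.

Lemma scaleP (q : rat) : 0 <= q -> `|denq q|%N \in denominators raw ->
  oval (Some (scale (denominators raw) (rat_pair q))) = (ratr q)%:E.
Proof.
move=> q0 dq; rewrite /= /scale natrM; congr EFin.
have /(congr1 (fun k : nat => k%:R : R)) := prod_butP dq; rewrite -/D natrM => Deq.
have d0 : (`|denq q|%N)%:R != 0 :> R by rewrite pnatr_eq0 -lt0n den_gt0.
have num0 : 0 <= numq q by rewrite numq_ge0.
rewrite -Deq /ratr; have -> : (numq q)%:~R = (`|numq q|%N)%:R :> R.
  by rewrite natr_absz ger0_norm.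
have -> : (denq q)%:~R = (`|denq q|%N)%:R :> R by rewrite natr_absz gtr0_norm // denq_gt0.
have p0 : (prod_but (denominators raw) `|denq q|)%:R != 0 :> R.
  by apply: contraTneq D_gt0 => p0; rewrite -Deq p0 mulr0 ltxx.
by field; rewrite d0.
Qed.

Let G := ca_graph Ir.
Let CC := ca_clusters I.

Lemma size_e : size e.1 = n.
Proof. by rewrite 2!size_map size_enum_ord. Qed.

Lemma verticesE : vertices e = [seq nat_of_ord v | v <- enum 'I_n].
Proof. by rewrite /vertices size_e val_enum_ord. Qed.

Lemma clustersE : e.2.1 = [seq [seq nat_of_ord v | v <- enum C] | C : {set 'I_n} <- enum CC].
Proof. by []. Qed.

Lemma portalsE : e.2.2.2 = [seq nat_of_ord p | p <- enum (ca_portals I)].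
Proof. by []. Qed.

Lemma nth_enum (T : Type) (x0 : T) (f : 'I_n -> T) (v : 'I_n) :
  nth x0 [seq f i | i <- enum 'I_n] v = f v.
Proof. by rewrite (nth_map v) ?size_enum_ord // nth_ord_enum. Qed.

Lemma nth_vertices (T : Type) (x0 : T) (f : nat -> T) (v : 'I_n) :
  nth x0 [seq f i | i <- vertices e] v = f v.
Proof. by rewrite verticesE -map_comp nth_enum. Qed.

Lemma in_cluster (C : {set 'I_n}) (v : 'I_n) :
  (nat_of_ord v \in [seq nat_of_ord u | u <- enum C]) = (v \in C).
Proof. by rewrite mem_map ?mem_enum //; apply: ord_inj. Qed.

Lemma diam_ge0 : 0 <= ca_diam I.
Proof. by case: Iok => _ _; rewrite /= ler0q. Qed.

Lemma oval_diam : oval (Some e.2.2.1) = (ca_diam Ir)%:E.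
Proof.
by apply: scaleP; [exact: diam_ge0 | rewrite /denominators mem_head].
Qed.

Lemma oval_diam_mul k : oval (Some (2 * e.2.2.1 * k)%N) =
  (2 * ca_diam Ir * k%:R)%:E.
Proof.
have E : e.2.2.1%:R / D%:R = ca_diam Ir by apply: EFin_inj; exact: oval_diam.
by move: E; move: (e.2.2.1) => a <-; rewrite /oval !natrM; congr EFin; rewrite mulrA mulrAC.
Qed.

Lemma oweight_adj (v u : 'I_n) :
  if adj G v u then exists2 w, oweight e v u = Some w & oval (Some w) = (wt G v u)%:E
  else oweight e v u = None.
Proof.
have -> : oweight e v u = if adj G v u then
    Some (scale (denominators raw) (rat_pair (wt (ca_graph I) v u))) else None.
  rewrite /oweight /e /scaled /raw /= -map_comp nth_enum /= -map_comp nth_enum /=.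
  by case: ifP.
case avu: (adj G v u) => //; eexists; first by [].
apply: scaleP.
  have [[_ _ _ _ /(_ v u avu) wpos] _ _ _] := Iok.
  have : 0 < ratr (wt (ca_graph I) v u) :> R := wpos.
  by rewrite ltr0q => /ltW.
rewrite inE; apply/orP; right; apply/flattenP.
eexists; first by apply: map_f; apply: map_f; exact: (mem_enum 'I_n v).
apply/mapP; eexists; first by apply: map_f; exact: (mem_enum 'I_n u).
by rewrite (_ : adj (ca_graph I) v u = true).
Qed.

Definition represents (D : seq (option nat)) (F : 'I_n -> \bar R) : Prop :=
  forall v : 'I_n, oval (nth None D v) = F v.

Definition represents_state st (s : @state R 'I_n) : Prop := forall v : 'I_n,
  (sget st v).1 = omap (@nat_of_ord n) (s v).1 /\ oval (sget st v).2 = (s v).2.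

Definition represents_set (U : seq bool) (S : {set 'I_n}) : Prop :=
  forall v : 'I_n, nth false U v = (v \in S).

Lemma orelaxP D F U S (v : 'I_n) : represents D F -> represents_set U S ->
  oval (orelax e U D v) = relax G S F v.
Proof.
move=> DF US; rewrite /orelax /relax US; case: ifP => // _; rewrite verticesE.
apply: (foldl_simulation (rel := fun a b => oval a = b)) => [a b u _ ab|]; last exact: DF.
rewrite /orelax_edge; have := oweight_adj v u; case: ifP => [_ [w -> wE]|_ ->] //.
by rewrite oval_min oval_add wE DF ab.
Qed.

Lemma obellman_fordP D F U S : represents D F -> represents_set U S ->
  represents (obellman_ford e U D) (bellman_ford G S F).
Proof.
move=> DF US; rewrite /obellman_ford /bellman_ford.
have -> : #|'I_n| = size (vertices e) by rewrite card_ord size_iota size_e.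
rewrite foldl_iter; elim: (size _) => //= k IH v.
by rewrite nth_vertices; apply: orelaxP.
Qed.

Lemma ounassignedP st s : represents_state st s ->
  represents_set (ounassigned e st) (unassigned s).
Proof.
move=> ss v; rewrite nth_vertices inE; have [-> _] := ss v.
by case: (s v).1.
Qed.

Lemma olevelsP st s : represents_state st s -> represents (olevels e st) (levels Ir s).
Proof.
move=> ss; apply: obellman_fordP; last exact: ounassignedP.
by move=> v; rewrite nth_vertices; have [] := ss v.
Qed.

Lemma oportal_levelsP st s (p : 'I_n) : represents_state st s ->
  represents (oportal_levels e st p) (portal_levels Ir s p).
Proof.
move=> ss; apply: obellman_fordP; last exact: ounassignedP.
move=> v; rewrite nth_vertices /olevel_at; have [-> <-] := ss v.
case: (s v).1 => [q|] //=; rewrite -[Some q == Some p]/(q == p) -val_eqE /=.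
by case: ifP.
Qed.

Section Step.
Variables (st : nat_state) (s : @state R 'I_n) (Hl : seq (option nat)) (H : 'I_n -> \bar R).
Hypotheses (ss : represents_state st s) (HH : represents Hl H).

Lemma oreachedP (p : 'I_n) r :
  represents_set (oreached e Hl st p r) (reached Ir H s p r).
Proof.
move=> v; rewrite nth_vertices inE (ounassignedP ss) oval_le oval_add.
by rewrite (oportal_levelsP p ss) HH oval_diam_mul.
Qed.

Lemma otouchedP (p : 'I_n) r (C : {set 'I_n}) :
  otouched e Hl st p r [seq nat_of_ord v | v <- enum C] =
    [exists v in C, v \in reached Ir H s p r].
Proof.
rewrite /otouched has_map; apply/hasP/exists_inP => [[v]|[v vC vr]].
  by rewrite mem_enum /= oreachedP => vC vr; exists v.
by exists v; rewrite ?mem_enum //= oreachedP.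
Qed.

Lemma ocountP (p : 'I_n) r : ocount e Hl st p r = #|touched Ir H s p r|.
Proof.
rewrite /ocount clustersE count_map -count_enum; apply: eq_count => C /=.
exact: otouchedP.
Qed.

Lemma two_powerE m : (m <= n)%N -> two_power e m = (2 ^ m)%N.
Proof.
move=> mn; rewrite /two_power /vertices size_e.
rewrite (foldl_iter_lt (fun a => a + a)%N _ mn).
by elim: m {mn} => //= m ->; rewrite addnn -mul2n expnS.
Qed.

Lemma opick_radiusP m (p : 'I_n) : (m <= n)%N ->
  opick_radius e m Hl st p = pick_radius Ir m H s p.
Proof.
move=> mn; have thinE r : othin e m Hl st p r = thin Ir m H s p r.
  by rewrite /othin /thin two_powerE // !ocountP.
rewrite /opick_radius /pick_radius.
(* On the second part the guard [r < 8 m] fails, so the last hit is the one of [pick_radius]. *)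
have -> : radii e = iota 0 (8 * m) ++ iota (8 * m) (8 * n - 8 * m).
  have sz : size (vertices e) = n by rewrite size_iota size_e.
  rewrite /radii !size_cat sz -[X in _ ++ iota X _]add0n -iotaD; congr iota; lia.
rewrite foldl_cat.
have low (b : nat) l : {subset l <= iota 0 (8 * m)} ->
    foldl (fun b r => if (r < 8 * m)%N && othin e m Hl st p r then r else b) b l =
    foldl (fun b r => if thin Ir m H s p r then r else b) b l.
  elim: l b => //= r l IH b lm; rewrite thinE.
  have : r \in iota 0 (8 * m) by apply: lm; rewrite mem_head.
  rewrite mem_iota /= => ->; apply: IH => x xl; apply: lm.
  by rewrite inE xl orbT.
rewrite (low 0%N (iota 0 (8 * m))) //.
set b := foldl _ 0%N _.
have : all (fun r => 8 * m <= r)%N (iota (8 * m) (8 * n - 8 * m)).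
  by apply/allP => j; rewrite mem_iota => /andP[].
elim: (iota _ _) => //= r l IH /andP[rm lm].
by rewrite ltnNge rm /= IH.
Qed.

Lemma ocaptureP (p : 'I_n) r :
  represents_state (ocapture e Hl st p r) (capture Ir H s p r).
Proof.
move=> v; rewrite /sget /ocapture nth_vertices.
have -> : has (fun C => (nat_of_ord v \in C) && otouched e Hl st p r C) e.2.1 =
    (finset.pblock CC v \in touched Ir H s p r).
  rewrite clustersE has_map; apply/hasP/idP => [[C]|vt].
    rewrite mem_enum /= in_cluster otouchedP => CCC /andP[vC Ct].
    by rewrite (clusterE Iok CCC vC) inE; apply/andP.
  exists (finset.pblock CC v); first by rewrite mem_enum; apply: (cluster_in Iok).
  rewrite /= in_cluster (mem_cluster Iok) otouchedP.
  by move: vt; rewrite inE => /andP[].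
rewrite /capture; case: ifP => _ //=.
by rewrite oval_add HH oval_diam_mul.
Qed.
End Step.

Lemma ophaseP m st s : (m <= n)%N -> represents_state st s ->
  represents_state (ophase e m st) (phase Ir m s).
Proof.
move=> mn ss; rewrite /ophase /phase portalsE.
apply: (foldl_simulation (rel := represents_state)) => // st' s' p _ ss'.
rewrite /ostep /step (opick_radiusP ss' (olevelsP ss)) //.
exact: ocaptureP ss' (olevelsP ss) _ _.
Qed.

Lemma oinitP : represents_state (oinit e) (init_state Ir).
Proof.
move=> v; rewrite /sget /oinit nth_vertices /init_state.
have -> : oinit_portal e v = omap (@nat_of_ord n)
    (foldl (fun b p => if p \in finset.pblock CC v then Some p else b) None
       (enum (ca_portals I))).
  rewrite /oinit_portal portalsE.
  apply: (foldl_simulation (rel := fun a b => a = omap (@nat_of_ord n) b)) => //.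
  move=> a b p _ ->; have -> : has (fun C => (nat_of_ord v \in C) && (nat_of_ord p \in C))
      e.2.1 = (p \in finset.pblock CC v).
    rewrite clustersE has_map; apply/hasP/idP => [[C]|pv].
      rewrite mem_enum /= !in_cluster => CCC /andP[vC pC].
      by rewrite (clusterE Iok CCC vC).
    exists (finset.pblock CC v); first by rewrite mem_enum; apply: (cluster_in Iok).
    by rewrite /= !in_cluster (mem_cluster Iok).
  by case: ifP.
rewrite /=; case: foldl => [p|] //=; split => //.
exact: oval_diam.
Qed.

Lemma orunP m J : (m <= n)%N -> (J <= n)%N ->
  represents_state (orun e m J) (run Ir m J).
Proof.
move=> mn Jn; rewrite /orun /vertices size_e foldl_iter_lt //.
by elim: J {Jn} => [|J IH]; [exact: oinitP | exact: ophaseP].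
Qed.

Lemma otryP m J : (m <= n)%N -> (J <= n)%N ->
  otry e m J = if unassigned (run Ir m J) == finset.set0
    then Some ((m * J)%N, [seq odflt 0%N (omap (@nat_of_ord n) (run Ir m J v).1)
                             | v <- enum 'I_n])
    else None.
Proof.
move=> mn Jn; have rr := orunP mn Jn; rewrite /otry verticesE all_map.
have -> : all (preim (@nat_of_ord n) (fun v => isSome (sget (orun e m J) v).1)) (enum 'I_n) =
    (unassigned (run Ir m J) == finset.set0).
  apply/allP/eqP => [h|h v _].
    apply/setP => v; rewrite finset.in_set0 unassignedE.
    have := h v (mem_enum _ _); rewrite /= (rr v).1.
    by case: (run Ir m J v).1.
  have : v \notin unassigned (run Ir m J) by rewrite h finset.in_set0.
  by rewrite unassignedE /= (rr v).1; case: (run Ir m J v).1.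
case: ifP => // _; congr (Some (_, _)); rewrite -map_comp.
by apply: eq_map => v /=; rewrite (rr v).1.
Qed.

(** A successful pair in the search range bounds the product of the pair selected. The latter may be
    a different pair, which is harmless since the distortion depends on the product only. *)
Lemma solveP m J : (0 < m <= n)%N -> (J <= n)%N ->
    unassigned (run Ir m J) = finset.set0 ->
  exists m' J', [/\ (0 < m')%N, (m' * J' <= m * J)%N,
    unassigned (run Ir m' J') = finset.set0 &
    solve e = [seq odflt 0%N (omap (@nat_of_ord n) (run Ir m' J' v).1) | v <- enum 'I_n]].
Proof.
move=> /andP[m0 mn] Jn all_assigned; rewrite /solve.
have -> : size (0%N :: vertices e) = n.+1 by rewrite /= size_iota size_e.
set inner := fun m => obest _; rewrite -[behead _]/(iota 1 n).
have [x1 x1E x1le] : exists2 x, inner m = Some x & (x.1 <= m * J)%N.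
  apply: (@obest_le _ (m * J, _)%N).
  apply/mapP; exists J; first by rewrite mem_iota.
  by rewrite otryP // all_assigned eqxx.
have [x2 x2E x2le] : exists2 x, obest [seq inner m | m <- iota 1 n] = Some x &
    (x.1 <= x1.1)%N.
  by apply: obest_le; rewrite -x1E; apply: map_f; rewrite mem_iota m0 add1n.
rewrite x2E; have /mapP[m' m'P /esym] := obest_mem x2E.
move=> /obest_mem/mapP[J' J'P].
rewrite !mem_iota !add1n /= add0n ltnS in m'P J'P *.
have /andP[m'0 m'n] := m'P; rewrite otryP //.
case: eqP => // all' [x2eq].
exists m', J'; rewrite x2eq; split => //.
by move: x2le; rewrite x2eq => /leq_trans; apply.
Qed.

End Simulation.

(** A deterministic program leaves the coin tape unread, so its answer is good for every tape. *)
Lemma polytime_randomized (X : Type) (A B : encType) (g : X -> A) (f : A -> B)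
    (promise : X -> Prop) (good : X -> tree -> Prop) :
  polytime f -> (forall x, promise x -> good x (enc (f (g x)))) ->
  randomized_polytime (fun x => enc (g x)) promise good.
Proof.
(* Sizes are at least 1, so [(size + 2)^k <= 3^k * size^k]. *)
move=> [c [t [[k tk] _ run_c]]] gP; exists (c 0%N), (3 ^ k)%N, k => x px.
set T := (_ + _)%N.
have tT : (t (g x) <= T)%N.
  apply: leq_trans (tk _) (leq_trans _ (leq_addr _ _)).
  rewrite -expnMn; apply: leq_exp_base; rewrite -/(esize (g x)).
  by have := esize_gt0 (g x); lia.
have out r : outputs (c 0%N) T (enc (g x)) r (enc (f (g x))).
  have [|s' [t' [ex le vs _]]] :=
      run_c (g x) 0%N (update (fun=> Leaf) 0%N (enc (g x))) r.
    by rewrite update_same.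
  by exists s', r, t'; split => //; apply: leq_trans tT.
split=> [r|]; first by exists (enc (f (g x))).
have -> : [set r : T.-tuple bool | `[< exists2 y, outputs (c 0%N) T (enc (g x)) r y
    & good x y >]] = [set: T.-tuple bool].
  apply/setP => r; rewrite !inE; apply/asboolP; exists (enc (f (g x))) => //.
  exact: gP.
by rewrite cardsT card_tuple card_bool leq_mul2r orbT.
Qed.

Theorem theorem5p6 (R : realType) (cL : R)
    (cL_gt0 : 0 < cL) (cL_lt1 : cL < 1) (cL_net : dangling_net_constant cL) :
  exists lam0 : R, forall lam : R, lam0 <= lam ->
  exists cs : R, 0 < cs /\
    let beta (d : R) := 4 * cs * ln (4 / cL) * (d ^+ 2 * log2 d) in
    (forall (V : finType) (I : ca_instance R V) (d : R),
       admissible I cL lam d ->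
       exists f : {set V} -> V, is_ca_solution I (beta d) f) /\
    ca_polytime cL lam beta.
Proof.
have [lam0 H] := good_run_solution cL_gt0 cL_lt1.
exists lam0 => lam /H{H}[cs cs0 H]; exists cs; split => //= .
have vertex (V : finType) (I : ca_instance R V) d : admissible I cL lam d ->
    exists x0 : V, True.
  by case=> -[[/card_gt0P[x0 _] _ _ _ _] _ _ _] _ _ _ _; exists x0.
split=> [V I d adm|].
  have [x0 _] := vertex _ _ _ adm.
  have [m [J [/andP[m0 _] _ all_assigned sol]]] := H V I d x0 adm.
  by exists (solution_of x0 (run I m J)); apply: sol.
rewrite /ca_polytime.
have -> : (fun X : rat_problem R => tree_of_ca_instance (rp_inst X)) =
    (fun X => enc (raw (rp_inst X))).
  by apply/funext => X; rewrite enc_raw.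
apply: (polytime_randomized (f := fun x => solve (scaled x))).
  by apply: pt_solve; apply: pt_scaled.
move=> [n I d] /= adm; set Ir := real_inst _ in adm *.
have [x0 _] := vertex _ _ _ adm; have [Iok _ _ _ _] := adm.
have [m [J [m0 mn all_assigned sol]]] := H _ Ir d x0 adm.
rewrite card_ord in m0 mn.
have [m' [J' [m'0 le all' ->]]] := solveP Iok m0 mn all_assigned.
exists (solution_of x0 (run Ir m' J')); first exact: sol.
have [vs _] := run_inv Iok (admissible_reachable adm) J' m'0.
rewrite /tree_of_solution /=.
have seqE (s : seq 'I_n) (f g : 'I_n -> nat) : f =1 g ->
    tree_of_seq tree_of_nat (map f s) = tree_of_seq (fun v => tree_of_nat (g v)) s.
  by move=> fg; elim: s => //= v s ->; rewrite fg.
(* Every vertex has a portal, so the default 0 in the output list does not occur. *)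
apply: seqE => v; have : v \notin unassigned (run Ir m' J').
  by rewrite all' finset.in_set0.
rewrite unassignedE; case E: (run Ir m' J' v).1 => [p|] //= _.
by rewrite -[LHS]/(nat_of_ord p) -(portal_of_solution Iok x0 vs E).
Qed.
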